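(* Work in the theory ZFC + A1–A4 (listed in the context) in the language $\{\in, R\}$. Let $\kappa$ be a reflective cardinal, i.e. $R(\kappa)$ holds. Then: (a) $V_\kappa$ satisfies ZFC, and (as a theorem schema) $(V_\kappa,\in)$ is an elementary substructure of $(V,\in)$. (b) In $\mathrm{HOD}$, $\kappa$ is fully indescribable.
   Context: The language is first-order set theory with an additional unary predicate symbol $R$; ''$\kappa$ is a reflective cardinal'' means $R(\kappa)$. ZFC here means the usual axioms with separation and replacement for formulas not mentioning $R$. The additional axioms are: A1. $\forall x \exists y \forall z\,(z \in y \Leftrightarrow z \in x \wedge R(z))$. A2. $\forall a\,(R(a) \Rightarrow a \text{ is an ordinal})$. A3. For all $a,b,c$: if $a$ is an ordinal, $R(b)$, $R(c)$ and $0<a<b<c$, then $R(a)$ holds if and only if for all (codes of) formulas $\varphi$ of set theory (without $R$) with two free variables and all $s\in V_a$, $(V_b\models\varphi(a,s)) \Leftrightarrow (V_c\models \varphi(b,s))$. A4. There is a proper class of reflective cardinals. A cardinal $\kappa$ is fully indescribable if (as a schema) for every formula $\varphi$ of the language of set theory (without $R$) with two free variables: $\forall A\subset\kappa\,(\varphi(\kappa,A)\Rightarrow \exists\lambda<\kappa\ \varphi(\lambda,A\cap\lambda))$, where formulas are evaluated in the universe. ''In $\mathrm{HOD}$'' means that this is relativized to $\mathrm{HOD}$, the class of hereditarily ordinal definable sets of $(V,\in)$ (so $A\in\mathrm{HOD}$ and $\varphi$ is evaluated in $\mathrm{HOD}$).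
   Formalization: The cardinal κ is additionally assumed to be positive: A1–A4 leave R(0) undecided, and for κ = 0 both claims fail, since V_0 is empty and there is no λ < 0. *)

(* Defs.v *)
(* A theory is rendered by its models: [M : Type] with
   [E : M -> M -> Prop] for membership, and Leibniz equality for "=".
   Notions that the theory defines by a single formula are predicates on [M]
   built with quantifiers over [M] only; schemas range over the type [fml]. *)
From Stdlib Require Import List.
Import ListNotations.

Set Implicit Arguments.
Unset Strict Implicit.

(* Formulas of set theory with named variables.  The formation rules are
   abstracted in [Syntax] so that the axioms of ZFC, written once, can be read
   both as actual formulas and as codes of formulas inside a model. *)
Class Syntax (F : Type) := {
  Mem : nat -> nat -> F;
  Eql : nat -> nat -> F;
  Neg : F -> F;
  And : F -> F -> F;
  Ex : nat -> F -> F
}.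

Inductive fml : Type :=
| FMem (i j : nat)
| FEql (i j : nat)
| FNeg (p : fml)
| FAnd (p q : fml)
| FEx (i : nat) (p : fml).

#[global] Instance fml_syntax : Syntax fml :=
  {| Mem := FMem; Eql := FEql; Neg := FNeg; And := FAnd; Ex := FEx |}.

Fixpoint free (k : nat) (p : fml) : Prop :=
  match p with
  | FMem i j | FEql i j => k = i \/ k = j
  | FNeg p => free k p
  | FAnd p q => free k p \/ free k q
  | FEx i p => k <> i /\ free k p
  end.

(* Free variables among v_0, v_1. *)
Definition fml2 (p : fml) : Prop := forall k, free k p -> k = 0 \/ k = 1.

Section ZFCAxioms.
Context {F : Type} {S : Syntax F}.

Definition Or (p q : F) : F := Neg (And (Neg p) (Neg q)).
Definition Imp (p q : F) : F := Neg (And p (Neg q)).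
Definition Iff (p q : F) : F := And (Imp p q) (Imp q p).
Definition All (i : nat) (p : F) : F := Neg (Ex i (Neg p)).

Definition ax_extensionality : F :=
  All 0 (All 1 (Imp (All 2 (Iff (Mem 2 0) (Mem 2 1))) (Eql 0 1))).

Definition ax_foundation : F :=
  All 0 (Imp (Ex 1 (Mem 1 0))
             (Ex 1 (And (Mem 1 0) (Neg (Ex 2 (And (Mem 2 1) (Mem 2 0))))))).

Definition ax_pairing : F :=
  All 0 (All 1 (Ex 2 (All 3 (Iff (Mem 3 2) (Or (Eql 3 0) (Eql 3 1)))))).

Definition ax_union : F :=
  All 0 (Ex 1 (All 2 (Iff (Mem 2 1) (Ex 3 (And (Mem 3 0) (Mem 2 3)))))).

Definition ax_powerset : F :=
  All 0 (Ex 1 (All 2 (Iff (Mem 2 1) (All 3 (Imp (Mem 3 2) (Mem 3 0)))))).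

Definition ax_infinity : F :=
  Ex 0 (And (Ex 1 (And (Mem 1 0) (All 2 (Neg (Mem 2 1)))))
            (All 1 (Imp (Mem 1 0)
               (Ex 2 (And (Mem 2 0)
                          (All 3 (Iff (Mem 3 2) (Or (Mem 3 1) (Eql 3 1))))))))).

(* Every family of nonempty pairwise disjoint sets has a transversal. *)
Definition ax_choice : F :=
  All 0 (Imp
    (And (All 1 (Imp (Mem 1 0) (Ex 2 (Mem 2 1))))
         (All 1 (All 2 (Imp (And (And (Mem 1 0) (Mem 2 0))
                                 (Ex 3 (And (Mem 3 1) (Mem 3 2))))
                            (Eql 1 2)))))
    (Ex 1 (All 2 (Imp (Mem 2 0)
       (Ex 3 (All 4 (Iff (And (Mem 4 2) (Mem 4 1)) (Eql 4 3)))))))).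

(* In both schemas v_1 must not be free in [p]; all other variables may be. *)
Definition ax_separation (p : F) : F :=
  All 0 (Ex 1 (All 2 (Iff (Mem 2 1) (And (Mem 2 0) p)))).

(* [p] is read as p(v_2, v_3); the premise says that for every v_2 in v_0
   there is a unique v_3 with p. *)
Definition ax_replacement (p : F) : F :=
  All 0 (Imp (All 2 (Imp (Mem 2 0) (Ex 1 (All 3 (Iff p (Eql 3 1))))))
             (Ex 1 (All 3 (Iff (Mem 3 1) (Ex 2 (And (Mem 2 0) p)))))).

Definition ZFC_finite_part : list F :=
  [ax_extensionality; ax_foundation; ax_pairing; ax_union; ax_powerset;
   ax_infinity; ax_choice].

End ZFCAxioms.

Definition ZFC (p : fml) : Prop :=
  In p ZFC_finite_part \/
  exists q, ~ free 1 q /\ (p = ax_separation q \/ p = ax_replacement q).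

Section Satisfaction.
Variables (M : Type) (E : M -> M -> Prop).

Definition update (e : nat -> M) (i : nat) (x : M) : nat -> M :=
  fun j => if Nat.eqb j i then x else e j.

Fixpoint sat (e : nat -> M) (p : fml) : Prop :=
  match p with
  | FMem i j => E (e i) (e j)
  | FEql i j => e i = e j
  | FNeg p => ~ sat e p
  | FAnd p q => sat e p /\ sat e q
  | FEx i p => exists x, sat (update e i x) p
  end.

(* p(x, y), for [p] with free variables among v_0, v_1. *)
Definition sat2 (p : fml) (x y : M) : Prop :=
  sat (fun i => match i with 0 => x | _ => y end) p.

(* Free variables, in particular the parameters of the schemas, are
   universally quantified. *)
Definition models_ZFC : Prop := forall p, ZFC p -> forall e, sat e p.

(* The membership relation of the substructure with domain [D]: truth in it is
   relativization to [D]. *)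
Definition restr (D : M -> Prop) (x y : {x : M | D x}) : Prop :=
  E (proj1_sig x) (proj1_sig y).

End Satisfaction.

Arguments restr {M} E D x y.

Definition elementary_substructure
    (M : Type) (E : M -> M -> Prop) (D : M -> Prop) : Prop :=
  (exists x, D x) /\
  forall (p : fml) (e : nat -> {x : M | D x}),
    sat (restr E D) e p <-> sat E (fun i => proj1_sig (e i)) p.

Section Universe.
Variables (M : Type) (E : M -> M -> Prop).
Local Notation "x ∈ y" := (E x y) (at level 70, no associativity).

Definition subset (x y : M) : Prop := forall z, z ∈ x -> z ∈ y.
Definition empty (x : M) : Prop := forall z, ~ z ∈ x.
Definition is_inter (z x y : M) : Prop := forall w, w ∈ z <-> w ∈ x /\ w ∈ y.
Definition is_succ (y x : M) : Prop := forall z, z ∈ y <-> z ∈ x \/ z = x.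
Definition is_upair (p x y : M) : Prop := forall z, z ∈ p <-> z = x \/ z = y.

Definition is_pair (p x y : M) : Prop :=
  exists s t, is_upair s x x /\ is_upair t x y /\ is_upair p s t.

(* (x, y) ∈ f *)
Definition has_pair (f x y : M) : Prop := exists p, is_pair p x y /\ p ∈ f.

Definition function_on (f a : M) : Prop :=
  (forall p, p ∈ f -> exists x y, x ∈ a /\ is_pair p x y) /\
  (forall x, x ∈ a -> exists! y, has_pair f x y).

Definition function_into (f a b : M) : Prop :=
  function_on f a /\ forall x y, has_pair f x y -> y ∈ b.

Definition bijection (f a b : M) : Prop :=
  function_into f a b /\
  (forall x x' y, has_pair f x y -> has_pair f x' y -> x = x') /\
  (forall y, y ∈ b -> exists x, has_pair f x y).

Definition transitive (x : M) : Prop := forall y, y ∈ x -> subset y x.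

Definition ordinal (a : M) : Prop :=
  transitive a /\
  (forall x y, x ∈ a -> y ∈ a -> x ∈ y \/ x = y \/ y ∈ x) /\
  (forall u, subset u a -> ~ empty u ->
     exists m, m ∈ u /\ forall x, x ∈ u -> ~ x ∈ m).

Definition cardinal (k : M) : Prop :=
  ordinal k /\ forall a, a ∈ k -> ~ exists f, bijection f a k.

Definition positive (a : M) : Prop := exists z, empty z /\ z ∈ a.

Fixpoint is_numeral (n : nat) (x : M) : Prop :=
  match n with
  | 0 => empty x
  | S n => exists y, is_numeral n y /\ is_succ x y
  end.

Definition inductive (x : M) : Prop :=
  (exists z, empty z /\ z ∈ x) /\
  (forall y, y ∈ x -> exists s, is_succ s y /\ s ∈ x).

Definition is_omega (w : M) : Prop :=
  inductive w /\ forall x, inductive x -> subset w x.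

Definition is_nat (n : M) : Prop := exists w, is_omega w /\ n ∈ w.

(* v = V_a, by the recursion: V_b is the union of the power sets of the V_c
   for c < b. *)
Definition is_V (a v : M) : Prop :=
  ordinal a /\
  exists f d, is_succ d a /\ function_on f d /\
    (forall b w, has_pair f b w ->
       forall z, z ∈ w <-> exists c u, c ∈ b /\ has_pair f c u /\ subset z u) /\
    has_pair f a v.

(* Codes of formulas are elements of [M], and variables are indexed by the
   natural numbers of [M]; neither need be standard. The codes are (0,(i,j))
   for v_i ∈ v_j, (1,(i,j)) for v_i = v_j, (2,x) for the negation of x,
   (3,(x,y)) for the conjunction, (4,(i,x)) for the quantification of x by
   "there exists v_i". *)
Definition tagged (n : nat) (c x : M) : Prop :=
  exists t, is_numeral n t /\ is_pair c t x.
Definition tagged2 (n : nat) (c x y : M) : Prop :=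
  exists p, is_pair p x y /\ tagged n c p.

Definition code_mem (c i j : M) : Prop := tagged2 0 c i j.
Definition code_eql (c i j : M) : Prop := tagged2 1 c i j.
Definition code_neg (c x : M) : Prop := tagged 2 c x.
Definition code_and (c x y : M) : Prop := tagged2 3 c x y.
Definition code_ex (c i x : M) : Prop := tagged2 4 c i x.

Definition form_closed (X : M) : Prop :=
  forall c,
    (exists i j, is_nat i /\ is_nat j /\ (code_mem c i j \/ code_eql c i j)) \/
    (exists x, x ∈ X /\ code_neg c x) \/
    (exists x y, x ∈ X /\ y ∈ X /\ code_and c x y) \/
    (exists i x, is_nat i /\ x ∈ X /\ code_ex c i x) ->
    c ∈ X.

Definition is_form (c : M) : Prop := forall X, form_closed X -> c ∈ X.

(* v_i is free in the formula coded by [c]: the least relation closed under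
   the usual clauses. *)
Definition free_closed (X : M) : Prop :=
  forall i c, is_form c ->
    (exists j, code_mem c i j \/ code_mem c j i \/
               code_eql c i j \/ code_eql c j i) \/
    (exists x, code_neg c x /\ has_pair X i x) \/
    (exists x y, code_and c x y /\ (has_pair X i x \/ has_pair X i y)) \/
    (exists j x, code_ex c j x /\ i <> j /\ has_pair X i x) ->
    has_pair X i c.

Definition is_free (i c : M) : Prop :=
  is_form c /\ forall X, free_closed X -> has_pair X i c.

Definition is_form2 (c : M) : Prop :=
  is_form c /\ forall i, is_free i c -> is_numeral 0 i \/ is_numeral 1 i.

Definition assignment (A e : M) : Prop :=
  exists w, is_omega w /\ function_into e w A.

(* e' is e with the value at i changed to x. *)
Definition is_update (e' e i x : M) : Prop :=
  forall j y, has_pair e' j y <-> (j = i /\ y = x) \/ (j <> i /\ has_pair e j y).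

(* S is a satisfaction relation for (A, ∈): the pairs (c, e) in S obey the
   Tarski clauses. *)
Definition sat_relation (A S : M) : Prop :=
  forall c e, is_form c -> assignment A e ->
    (forall i j, code_mem c i j ->
       (has_pair S c e <->
        exists x y, has_pair e i x /\ has_pair e j y /\ x ∈ y)) /\
    (forall i j, code_eql c i j ->
       (has_pair S c e <-> exists x, has_pair e i x /\ has_pair e j x)) /\
    (forall x, code_neg c x -> (has_pair S c e <-> ~ has_pair S x e)) /\
    (forall x y, code_and c x y ->
       (has_pair S c e <-> has_pair S x e /\ has_pair S y e)) /\
    (forall i x, code_ex c i x ->
       (has_pair S c e <->
        exists y e', y ∈ A /\ assignment A e' /\ is_update e' e i y /\
                     has_pair S x e')).

(* (A, ∈) satisfies the formula coded by c under the assignment e. *)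
Definition Sat (A c e : M) : Prop :=
  exists S, sat_relation A S /\ has_pair S c e.

Definition Sat2 (A c x y : M) : Prop :=
  exists e z o, assignment A e /\ is_numeral 0 z /\ is_numeral 1 o /\
    has_pair e z x /\ has_pair e o y /\ Sat A c e.

(* A formula is read here as the property of being a code of it. *)
Local Instance code_syntax : Syntax (M -> Prop) := {|
  Mem := fun i j c => exists x y, is_numeral i x /\ is_numeral j y /\ code_mem c x y;
  Eql := fun i j c => exists x y, is_numeral i x /\ is_numeral j y /\ code_eql c x y;
  Neg := fun p c => exists x, p x /\ code_neg c x;
  And := fun p q c => exists x y, p x /\ q y /\ code_and c x y;
  Ex := fun i p c => exists x y, is_numeral i x /\ p y /\ code_ex c x y |}.

(* Includes the instances of the schemas for all formulas of [M]. *)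
Definition is_ZFC_code (c : M) : Prop :=
  (exists p, In p ZFC_finite_part /\ p c) \/
  (exists x, is_form x /\ (forall i, is_numeral 1 i -> ~ is_free i x) /\
     (ax_separation (eq x) c \/ ax_replacement (eq x) c)).

Definition set_models_ZFC (A : M) : Prop :=
  forall c, is_ZFC_code c -> forall e, assignment A e -> Sat A c e.

(* x is the unique element of some V_a satisfying there a formula with v_0
   for the unknown and ordinals as the values of the other variables. *)
Definition OD (x : M) : Prop :=
  exists a v c e z, is_V a v /\ is_form c /\ assignment v e /\
    (forall j y, has_pair e j y -> ordinal y) /\
    is_numeral 0 z /\ x ∈ v /\
    forall y e', y ∈ v -> assignment v e' -> is_update e' e z y ->
      (Sat v c e' <-> y = x).

(* The transitive closure of {x} is included in OD. *)
Definition HOD (x : M) : Prop :=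
  forall y, (forall t, transitive t -> x ∈ t -> y ∈ t) -> OD y.

Definition fully_indescribable (k : M) : Prop :=
  cardinal k /\
  forall p, fml2 p -> forall A, subset A k -> sat2 E p k A ->
    exists l B, l ∈ k /\ is_inter B A l /\ sat2 E p l B.

Variable R : M -> Prop.

(* [A3] is restricted to positive ordinals; the theory does not decide R(0). *)
Record reflective_theory : Prop := {
  reflective_ZFC : models_ZFC E;
  A1 : forall x, exists y, forall z, z ∈ y <-> z ∈ x /\ R z;
  A2 : forall a, R a -> ordinal a;
  A3 : forall a b c va vb vc,
    ordinal a -> R b -> R c -> positive a -> a ∈ b -> b ∈ c ->
    is_V a va -> is_V b vb -> is_V c vc ->
    (R a <->
     forall p s, is_form2 p -> s ∈ va -> (Sat2 vb p a s <-> Sat2 vc p b s));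
  A4 : ~ exists x, forall a, a ∈ x <-> R a
}.

End Universe.

(* Main.v *)
(* Let [k < l < m] be reflective. By A3, [V_l |= phi(k, s)] if and only if
   [V_m |= phi(l, s)], for [s] in [V_k]. Taking for [phi(x, s)] the statement
   "[V_x] satisfies the formula coded in [s] under the assignment coded in [s]",
   which is absolute for [V_l] and [V_m], shows that [V_k] is an elementary
   substructure of [V_l], also with respect to nonstandard formulas. The
   reflective [V_l] therefore form an elementary chain with union [V], and [V_k]
   satisfies replacement because the image of a set of [V_k] under a function
   definable over [V_k] is an element of [V_l]. Moreover [k] and [l] now satisfy
   the same formulas in [V] with parameters from [V_k].

   If indescribability failed in HOD at [k], it would fail at [l] too, and
   ordinal definability allows to choose the counterexamples [A_k] and [A_l] by
   one formula with parameters in [V_k]. By indiscernibility [A_l] and [A_k] have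
   the same elements below [k], so that [k] reflects the property of [A_l] below
   [l], a contradiction. The same choice, applied to bijections from a smaller
   ordinal onto [k] and onto [l], shows that [k] is a cardinal. *)
From Stdlib Require Import List Arith Lia Classical ClassicalEpsilon FunctionalExtensionality.
Require Import Defs.

Set Implicit Arguments.
Unset Strict Implicit.

(** * Definability *)

(** The model may have nonstandard numbers. Its own ZFC contains instances for nonstandard formulas,
    and an ordinal definable set may be defined by a nonstandard code, so elementarity and choice
    are carried out with the internal relation [Sat]; actual formulas enter through [code]. Since
    the schemas of ZFC do not mention [R], every set formed and every induction inside the model
    needs a proof of definability by a formula of set theory, which is the purpose of [Rf] and [Df].
    Before A3 can compare truth in [V_k] and [V_l], the levels must be known to compute satisfaction
    correctly. That reflective cardinals are limits above omega is therefore derived first, from A3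
    with formulas simple enough to be absolute without it. No well-order of HOD is built. The code
    of a definition and a bound on its relevant variables are fixed as parameters in [V_k], and only
    the stage and the relevant ordinals are minimized. The set chosen at [k] need not belong to
    [V_k], so its comparison with the one chosen at [l] goes through single elements of [V_k]. *)

Definition scons {N : Type} (x : N) (e : nat -> N) (n : nat) : N :=
  match n with 0 => x | S n => e n end.

(** De Bruijn indices free renaming and the introduction of constants from variable capture; [named]
    leads back to [fml]. *)
Inductive dbf : Type :=
| DMem (i j : nat)
| DEql (i j : nat)
| DNeg (p : dbf)
| DAnd (p q : dbf)
| DEx (p : dbf).

Fixpoint dsat {N : Type} (E : N -> N -> Prop) (e : nat -> N) (p : dbf) : Prop :=
  match p with
  | DMem i j => E (e i) (e j)
  | DEql i j => e i = e j
  | DNeg p => ~ dsat E e p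
  | DAnd p q => dsat E e p /\ dsat E e q
  | DEx p => exists x, dsat E (scons x e) p
  end.

Definition up (f : nat -> nat) : nat -> nat := scons 0 (fun n => S (f n)).

Fixpoint dren (f : nat -> nat) (p : dbf) : dbf :=
  match p with
  | DMem i j => DMem (f i) (f j)
  | DEql i j => DEql (f i) (f j)
  | DNeg p => DNeg (dren f p)
  | DAnd p q => DAnd (dren f p) (dren f q)
  | DEx p => DEx (dren (up f) p)
  end.

Lemma scons_up {N : Type} (x : N) (e : nat -> N) (f : nat -> nat) :
  (fun n => scons x e (up f n)) = scons x (fun n => e (f n)).
Proof. extensionality n; destruct n; reflexivity. Qed.

Lemma ex_iff {N : Type} (P Q : N -> Prop) :
  (forall x, P x <-> Q x) -> (exists x, P x) <-> (exists x, Q x).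
Proof. intros H; split; intros [x Hx]; exists x; apply H, Hx. Qed.

Lemma dsat_ren {N : Type} (E : N -> N -> Prop) p : forall e f,
  dsat E e (dren f p) <-> dsat E (fun n => e (f n)) p.
Proof.
  induction p; intros e f; simpl; try tauto.
  - rewrite IHp; tauto.
  - rewrite IHp1, IHp2; tauto.
  - apply ex_iff; intros x; rewrite IHp, scons_up; tauto.
Qed.

(** An upper bound on the free variables is enough, so sums stand for maxima and a quantifier keeps
    the bound of its body. *)
Fixpoint bound (p : dbf) : nat :=
  match p with
  | DMem i j | DEql i j => S (i + j)
  | DNeg p | DEx p => bound p
  | DAnd p q => bound p + bound q
  end.

Lemma dsat_ext {N : Type} (E : N -> N -> Prop) p : forall e e',
  (forall n, n < bound p -> e n = e' n) -> dsat E e p <-> dsat E e' p.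
Proof.
  induction p; intros e e' H; simpl in *.
  - rewrite !H by lia; tauto.
  - rewrite !H by lia; tauto.
  - rewrite (IHp e e'); [tauto | auto].
  - rewrite (IHp1 e e'), (IHp2 e e'); [tauto | |]; intros; apply H; lia.
  - apply ex_iff; intros x; apply IHp; intros [|n] Hn; simpl; auto; apply H; lia.
Qed.

Fixpoint fresh (f : nat -> nat) (n : nat) : nat :=
  match n with 0 => 0 | S n => S (f n) + fresh f n end.

Lemma fresh_gt f n i : i < n -> f i < fresh f n.
Proof.
  induction n; simpl; intros H; [lia|].
  destruct (Nat.eq_dec i n); [subst; lia | assert (f i < fresh f n) by (apply IHn; lia); lia].
Qed.

(* [f] names the free variables. *)
Fixpoint named (f : nat -> nat) (p : dbf) : fml :=
  match p with
  | DMem i j => FMem (f i) (f j)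
  | DEql i j => FEql (f i) (f j)
  | DNeg p => FNeg (named f p)
  | DAnd p q => FAnd (named f p) (named f q)
  | DEx p => let m := fresh f (bound p) in FEx m (named (scons m f) p)
  end.

Lemma sat_named {N : Type} (E : N -> N -> Prop) p : forall e f,
  sat E e (named f p) <-> dsat E (fun n => e (f n)) p.
Proof.
  induction p; intros e f; simpl; try tauto.
  - rewrite IHp; tauto.
  - rewrite IHp1, IHp2; tauto.
  - apply ex_iff; intros x; rewrite IHp; apply dsat_ext; intros [|n] Hn; simpl; unfold update.
    + rewrite Nat.eqb_refl; reflexivity.
    + destruct (Nat.eqb_spec (f n) (fresh f (bound p))); [|reflexivity].
      pose proof (fresh_gt f (n := bound p) (i := n)); lia.
Qed.

(** A naming function with restricted values controls the free variables. This yields the side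
    condition on [v_1] in the schemas, and [fml2]. *)
Lemma free_named k p : forall f, free k (named f p) -> exists n, k = f n.
Proof.
  induction p; intros f; simpl.
  - intros [H|H]; eauto.
  - intros [H|H]; eauto.
  - auto.
  - intros [H|H]; auto.
  - intros [H1 H2]; destruct (IHp _ H2) as [[|n] Hn]; simpl in Hn; [contradiction | eauto].
Qed.

(* Definability by one formula in all structures. *)
Definition Rf (P : forall N : Type, (N -> N -> Prop) -> (nat -> N) -> Prop) : Prop :=
  exists p, forall N (E : N -> N -> Prop) e, dsat E e p <-> P N E e.

Lemma Rf_mem i j : Rf (fun N E e => E (e i) (e j)).
Proof. exists (DMem i j); simpl; tauto. Qed.

Lemma Rf_eql i j : Rf (fun N E e => e i = e j).
Proof. exists (DEql i j); simpl; tauto. Qed.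

Lemma Rf_neg P : Rf P -> Rf (fun N E e => ~ P N E e).
Proof. intros [p Hp]; exists (DNeg p); simpl; intros; rewrite Hp; tauto. Qed.

Lemma Rf_and P Q : Rf P -> Rf Q -> Rf (fun N E e => P N E e /\ Q N E e).
Proof.
  intros [p Hp] [q Hq]; exists (DAnd p q); simpl; intros; rewrite Hp, Hq; tauto.
Qed.

(** The premise reads the bound variable at [e 0] and shifts the others. This is the de Bruijn
    convention expressed by environments, so that [rf] works on predicates without seeing
    formulas. *)
Lemma Rf_ex (P : forall N : Type, (N -> N -> Prop) -> (nat -> N) -> N -> Prop) :
  Rf (fun N E e => P N E (fun n => e (S n)) (e 0)) ->
  Rf (fun N E e => exists x, P N E e x).
Proof.
  intros [p Hp]; exists (DEx p); simpl; intros; apply ex_iff; intros x.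
  rewrite Hp; reflexivity.
Qed.

Lemma Rf_equiv P Q : Rf P -> (forall N E e, P N E e <-> Q N E e) -> Rf Q.
Proof. intros [p Hp] H; exists p; intros; rewrite Hp; apply H. Qed.

Lemma Rf_or P Q : Rf P -> Rf Q -> Rf (fun N E e => P N E e \/ Q N E e).
Proof.
  intros HP HQ; apply (Rf_equiv (Rf_neg (Rf_and (Rf_neg HP) (Rf_neg HQ)))).
  intros; tauto.
Qed.

Lemma Rf_imp P Q : Rf P -> Rf Q -> Rf (fun N E e => P N E e -> Q N E e).
Proof.
  intros HP HQ; apply (Rf_equiv (Rf_neg (Rf_and HP (Rf_neg HQ)))); intros; tauto.
Qed.

Lemma Rf_iff P Q : Rf P -> Rf Q -> Rf (fun N E e => P N E e <-> Q N E e).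
Proof. intros HP HQ; exact (Rf_and (Rf_imp HP HQ) (Rf_imp HQ HP)). Qed.

Lemma Rf_all (P : forall N : Type, (N -> N -> Prop) -> (nat -> N) -> N -> Prop) :
  Rf (fun N E e => P N E (fun n => e (S n)) (e 0)) ->
  Rf (fun N E e => forall x, P N E e x).
Proof.
  intros H; apply (Rf_equiv (P := fun N E e => ~ exists x, ~ P N E e x)).
  - apply Rf_neg, (Rf_ex (P := fun N E e x => ~ P N E e x)), Rf_neg, H.
  - intros N E e; split; [|firstorder].
    intros Hn x; apply NNPP; firstorder.
Qed.

Lemma Rf_ren P f : Rf P -> Rf (fun N E e => P N E (fun n => e (f n))).
Proof.
  intros [p Hp]; exists (dren f p); intros; rewrite dsat_ren; apply Hp.
Qed.

(* Definability with constants in one structure: [s n = inr c] puts the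
   constant [c] for the variable [n]. *)
Definition env_of {M : Type} (s : nat -> nat + M) (e : nat -> M) (n : nat) : M :=
  match s n with inl k => e k | inr c => c end.

Definition Df {M : Type} (E : M -> M -> Prop) (P : (nat -> M) -> Prop) : Prop :=
  exists p s, forall e, dsat E (env_of s e) p <-> P e.

Definition Tm {M : Type} (t : (nat -> M) -> M) : Prop :=
  (exists k, t = fun e => e k) \/ (exists c, t = fun _ => c).

Lemma Tm_var {M : Type} k : Tm (fun e : nat -> M => e k).
Proof. left; eauto. Qed.

Lemma Tm_cst {M : Type} c : Tm (fun _ : nat -> M => c).
Proof. right; eauto. Qed.

Lemma Tm_shift {M : Type} (t : (nat -> M) -> M) :
  Tm t -> Tm (fun e => t (fun n => e (S n))).
Proof. intros [[k ->]|[c ->]]; [left; exists (S k) | right; exists c]; reflexivity. Qed.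

Lemma Tm_sub {M : Type} (t : (nat -> M) -> M) :
  Tm t -> exists s : nat + M, forall e, t e = match s with inl k => e k | inr c => c end.
Proof. intros [[k ->]|[c ->]]; [exists (inl k) | exists (inr c)]; reflexivity. Qed.

Section Df.
Context {M : Type} (E : M -> M -> Prop).

Lemma Df_of_Rf P (T : nat -> (nat -> M) -> M) :
  Rf P -> (forall n, Tm (T n)) -> Df E (fun e => P M E (fun n => T n e)).
Proof.
  intros [p Hp] HT.
  pose (s n := proj1_sig (constructive_indefinite_description _ (Tm_sub (HT n)))).
  exists p, s; intros e; rewrite Hp.
  replace (env_of s e) with (fun n => T n e); [tauto|].
  extensionality n; unfold env_of, s.
  destruct (constructive_indefinite_description _ _) as [u Hu]; simpl; apply Hu.
Qed.

Lemma Df_equiv P Q : Df E P -> (forall e, P e <-> Q e) -> Df E Q.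
Proof. intros [p [s Hp]] H; exists p, s; intros; rewrite Hp; apply H. Qed.

Lemma Df_neg P : Df E P -> Df E (fun e => ~ P e).
Proof. intros [p [s Hp]]; exists (DNeg p), s; simpl; intros; rewrite Hp; tauto. Qed.

Lemma Df_and P Q : Df E P -> Df E Q -> Df E (fun e => P e /\ Q e).
Proof.
  intros [p [s Hp]] [q [t Hq]].
  (* Each conjunct has its own table of constants: even indices serve the first, odd indices the
     second. *)
  exists (DAnd (dren (fun n => 2 * n) p) (dren (fun n => 2 * n + 1) q)).
  exists (fun n => if Nat.even n then s (Nat.div2 n) else t (Nat.div2 n)).
  intros e; simpl; rewrite !dsat_ren, <- Hp, <- Hq.
  match goal with |- ?A /\ ?B <-> ?C /\ ?D => enough (A = C /\ B = D) as [-> ->] by tauto end.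
  split; f_equal; extensionality n; unfold env_of.
  - change (n + (n + 0)) with (2 * n).
    rewrite Nat.even_mul, Nat.div2_double; reflexivity.
  - change (n + (n + 0)) with (2 * n).
    rewrite Nat.even_add, Nat.even_mul; simpl Nat.even; simpl orb; simpl Bool.eqb.
    replace (2 * n + 1) with (S (2 * n)) by lia.
    rewrite Nat.div2_succ_double; reflexivity.
Qed.

Lemma Df_ex (P : (nat -> M) -> M -> Prop) :
  Df E (fun e => P (fun n => e (S n)) (e 0)) -> Df E (fun e => exists x, P e x).
Proof.
  intros [p [s Hp]].
  (* All indices that stand for variable 0 are merged into the bound variable and the others move
     past it. In the new table the entry [inl 0] is a filler that is never looked up. *)
  exists (DEx (dren (fun n => match s n with inl 0 => 0 | _ => S n end) p)).
  exists (fun n => match s n with inl (S k) => inl k | inl 0 => inl 0 | inr c => inr c end).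
  intros e; simpl; apply ex_iff; intros x.
  specialize (Hp (scons x e)); simpl in Hp.
  replace (fun n => e n) with e in Hp by reflexivity; rewrite <- Hp, dsat_ren.
  match goal with |- dsat _ ?a _ <-> dsat _ ?b _ => replace a with b; [tauto|] end.
  extensionality n; unfold env_of.
  destruct (s n) as [[|k]|c] eqn:Hs; simpl; rewrite ?Hs; reflexivity.
Qed.

Lemma Df_subst P (T : nat -> (nat -> M) -> M) :
  Df E P -> (forall n, Tm (T n)) -> Df E (fun e => P (fun n => T n e)).
Proof.
  intros [p [s Hp]] HT.
  pose (t n := proj1_sig (constructive_indefinite_description _ (Tm_sub (HT n)))).
  exists p, (fun n => match s n with inl k => t k | inr c => inr c end).
  intros e; rewrite <- Hp.
  match goal with |- dsat _ ?a _ <-> dsat _ ?b _ => replace a with b; [tauto|] end.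
  extensionality n; unfold env_of; destruct (s n) as [k|c]; [|reflexivity].
  unfold t; destruct (constructive_indefinite_description _ _) as [u Hu]; simpl; apply Hu.
Qed.

Lemma Df_app2 (Q : M -> M -> Prop) t u :
  Df E (fun e => Q (e 0) (e 1)) -> Tm t -> Tm u -> Df E (fun e => Q (t e) (u e)).
Proof.
  intros HQ Ht Hu; refine (Df_subst (T := scons t (fun _ => u)) HQ _).
  intros [|n]; assumption.
Qed.

Lemma Df_or P Q : Df E P -> Df E Q -> Df E (fun e => P e \/ Q e).
Proof.
  intros HP HQ; apply (Df_equiv (Df_neg (Df_and (Df_neg HP) (Df_neg HQ)))).
  intros; tauto.
Qed.

Lemma Df_imp P Q : Df E P -> Df E Q -> Df E (fun e => P e -> Q e).
Proof.
  intros HP HQ; apply (Df_equiv (Df_neg (Df_and HP (Df_neg HQ)))); intros; tauto.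
Qed.

Lemma Df_iff P Q : Df E P -> Df E Q -> Df E (fun e => P e <-> Q e).
Proof. intros HP HQ; exact (Df_and (Df_imp HP HQ) (Df_imp HQ HP)). Qed.

Lemma Df_all (P : (nat -> M) -> M -> Prop) :
  Df E (fun e => P (fun n => e (S n)) (e 0)) -> Df E (fun e => forall x, P e x).
Proof.
  intros H; apply (Df_equiv (P := fun e => ~ exists x, ~ P e x)).
  - apply Df_neg, (Df_ex (P := fun e x => ~ P e x)), Df_neg, H.
  - intros e; split; [|firstorder].
    intros Hn x; apply NNPP; firstorder.
Qed.

Lemma Df_of_Rf1 (Q : forall N : Type, (N -> N -> Prop) -> N -> Prop) t :
  (forall i, Rf (fun N E e => Q N E (e i))) -> Tm t -> Df E (fun e => Q M E (t e)).
Proof.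
  intros HQ Ht; exact (Df_of_Rf (T := fun _ => t) (HQ 0) (fun _ => Ht)).
Qed.

Lemma Df_of_Rf2 (Q : forall N : Type, (N -> N -> Prop) -> N -> N -> Prop) t u :
  (forall i j, Rf (fun N E e => Q N E (e i) (e j))) -> Tm t -> Tm u ->
  Df E (fun e => Q M E (t e) (u e)).
Proof.
  intros HQ Ht Hu; refine (Df_of_Rf (T := scons t (fun _ => u)) (HQ 0 1) _).
  intros [|n]; assumption.
Qed.

Lemma Df_of_Rf3 (Q : forall N : Type, (N -> N -> Prop) -> N -> N -> N -> Prop) t u v :
  (forall i j k, Rf (fun N E e => Q N E (e i) (e j) (e k))) -> Tm t -> Tm u -> Tm v ->
  Df E (fun e => Q M E (t e) (u e) (v e)).
Proof.
  intros HQ Ht Hu Hv; refine (Df_of_Rf (T := scons t (scons u (fun _ => v))) (HQ 0 1 2) _).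
  intros [|[|n]]; assumption.
Qed.

Lemma Df_of_Rf4 (Q : forall N : Type, (N -> N -> Prop) -> N -> N -> N -> N -> Prop) t u v w :
  (forall i j k l, Rf (fun N E e => Q N E (e i) (e j) (e k) (e l))) ->
  Tm t -> Tm u -> Tm v -> Tm w ->
  Df E (fun e => Q M E (t e) (u e) (v e) (w e)).
Proof.
  intros HQ Ht Hu Hv Hw.
  refine (Df_of_Rf (T := scons t (scons u (scons v (fun _ => w)))) (HQ 0 1 2 3) _).
  intros [|[|[|n]]]; assumption.
Qed.

Lemma Df_mem t u : Tm t -> Tm u -> Df E (fun e => E (t e) (u e)).
Proof. apply (Df_of_Rf2 (Q := fun N E x y => E x y) Rf_mem). Qed.

Lemma Df_eql t u : Tm t -> Tm u -> Df E (fun e => t e = u e).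
Proof. apply (Df_of_Rf2 (Q := fun N E x y => x = y) Rf_eql). Qed.

(** [P] belongs to the metatheory and need not be expressible, but classically it is equivalent to a
    true or to a false formula. *)
Lemma Df_cst (P : Prop) : Df E (fun _ => P).
Proof.
  destruct (classic P) as [H|H].
  - apply (Df_equiv (Df_eql (Tm_var 0) (Tm_var 0))); intuition.
  - apply (Df_equiv (Df_neg (Df_eql (Tm_var 0) (Tm_var 0)))); intuition.
Qed.

End Df.

(* Automation of definability proofs *)
Create HintDb rf.

Ltac rf_step :=
  cbv beta;
  lazymatch goal with
  | |- Rf (fun N E e => _ /\ _) => apply Rf_and
  | |- Rf (fun N E e => _ \/ _) => apply Rf_or
  | |- Rf (fun N E e => ~ _) => apply Rf_neg
  | |- Rf (fun N E e => _ <-> _) => apply Rf_iff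
  | |- Rf (fun N E e => exists x, _) => apply Rf_ex
  | |- Rf (fun N E e => forall x : N, _) => apply Rf_all
  | |- Rf (fun N E e => _ -> _) => apply Rf_imp
  | |- Rf (fun N E e => _ = _) => apply Rf_eql
  | |- Rf (fun N E e => E _ _) => apply Rf_mem
  | |- Rf _ => solve [eauto 2 with rf nocore]
  end.
Ltac rf := unfold unique; repeat rf_step.

Ltac tm :=
  cbv beta;
  first [ exact (Tm_cst _) | exact (Tm_var _) | assumption | apply Tm_shift; tm ].

Ltac rf_hyp := intros; solve [eauto 2 with rf nocore].

(** A predicate applied to the structure is matched by its number of arguments and reduced to its
    [Rf] lemma in the hint base, so that each notion is treated once, for variables and constants
    alike. *)
Ltac df_step :=
  cbv beta;
  lazymatch goal with
  | |- Df _ (fun e => _ /\ _) => apply Df_and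
  | |- Df _ (fun e => _ \/ _) => apply Df_or
  | |- Df _ (fun e => ~ _) => apply Df_neg
  | |- Df _ (fun e => _ <-> _) => apply Df_iff
  | |- Df _ (fun e => exists x, _) => apply Df_ex
  | |- Df _ (fun e => _ = _) => apply Df_eql; tm
  | |- Df ?E (fun e => ?E _ _) => apply Df_mem; tm
  | |- @Df ?M _ (fun e => forall x : ?M, _) => apply Df_all
  | |- Df _ (fun e => _ -> _) => apply Df_imp
  | |- Df _ (fun e => is_numeral _ _ _) => solve [eauto 3 with rf nocore]
  | |- @Df ?M ?E (fun e => ?R ?M ?E (@?t e)) =>
      refine (@Df_of_Rf1 M E (fun N E' => R N E') t _ _); [rf_hyp | tm]
  | |- @Df ?M ?E (fun e => ?R ?M ?E (@?t e) (@?u e)) =>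
      refine (@Df_of_Rf2 M E (fun N E' => R N E') t u _ _ _); [rf_hyp | tm ..]
  | |- @Df ?M ?E (fun e => ?R ?M ?E (@?t e) (@?u e) (@?v e)) =>
      refine (@Df_of_Rf3 M E (fun N E' => R N E') t u v _ _ _ _); [rf_hyp | tm ..]
  | |- @Df ?M ?E (fun e => ?R ?M ?E (@?t e) (@?u e) (@?v e) (@?w e)) =>
      refine (@Df_of_Rf4 M E (fun N E' => R N E') t u v w _ _ _ _ _); [rf_hyp | tm ..]
  | |- Df _ _ => solve [eauto 3 with rf nocore]
  end.
Ltac df := unfold unique; repeat df_step.

(** * Definability of the notions of set theory *)

Lemma Rf_subset i j : Rf (fun N E e => subset E (e i) (e j)).
Proof. unfold subset; rf. Qed.
Lemma Rf_empty i : Rf (fun N E e => empty E (e i)).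
Proof. unfold empty; rf. Qed.
Lemma Rf_is_inter i j k : Rf (fun N E e => is_inter E (e i) (e j) (e k)).
Proof. unfold is_inter; rf. Qed.
Lemma Rf_is_succ i j : Rf (fun N E e => is_succ E (e i) (e j)).
Proof. unfold is_succ; rf. Qed.
Lemma Rf_is_upair i j k : Rf (fun N E e => is_upair E (e i) (e j) (e k)).
Proof. unfold is_upair; rf. Qed.
#[local] Hint Resolve Rf_subset Rf_empty Rf_is_inter Rf_is_succ Rf_is_upair : rf.
Lemma Rf_is_pair i j k : Rf (fun N E e => is_pair E (e i) (e j) (e k)).
Proof. unfold is_pair; rf. Qed.
#[local] Hint Resolve Rf_is_pair : rf.
Lemma Rf_has_pair i j k : Rf (fun N E e => has_pair E (e i) (e j) (e k)).
Proof. unfold has_pair; rf. Qed.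
#[local] Hint Resolve Rf_has_pair : rf.
Lemma Rf_function_on i j : Rf (fun N E e => function_on E (e i) (e j)).
Proof. unfold function_on; rf. Qed.
#[local] Hint Resolve Rf_function_on : rf.
Lemma Rf_function_into i j k : Rf (fun N E e => function_into E (e i) (e j) (e k)).
Proof. unfold function_into; rf. Qed.
#[local] Hint Resolve Rf_function_into : rf.
Lemma Rf_bijection i j k : Rf (fun N E e => bijection E (e i) (e j) (e k)).
Proof. unfold bijection; rf. Qed.
Lemma Rf_transitive i : Rf (fun N E e => transitive E (e i)).
Proof. unfold transitive; rf. Qed.
#[local] Hint Resolve Rf_bijection Rf_transitive : rf.
Lemma Rf_ordinal i : Rf (fun N E e => ordinal E (e i)).
Proof. unfold ordinal; rf. Qed.
Lemma Rf_is_numeral n : forall i, Rf (fun N E e => is_numeral E n (e i)).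
Proof. induction n; intros i; cbn [is_numeral]; rf. Qed.
Lemma Rf_inductive i : Rf (fun N E e => inductive E (e i)).
Proof. unfold inductive; rf. Qed.
#[local] Hint Resolve Rf_ordinal Rf_is_numeral Rf_inductive : rf.
Lemma Rf_is_omega i : Rf (fun N E e => is_omega E (e i)).
Proof. unfold is_omega; rf. Qed.
#[local] Hint Resolve Rf_is_omega : rf.
Lemma Rf_is_nat i : Rf (fun N E e => is_nat E (e i)).
Proof. unfold is_nat; rf. Qed.
Lemma Rf_is_V i j : Rf (fun N E e => is_V E (e i) (e j)).
Proof. unfold is_V; rf. Qed.
#[local] Hint Resolve Rf_is_nat Rf_is_V : rf.
Lemma Rf_tagged n i j : Rf (fun N E e => tagged E n (e i) (e j)).
Proof. unfold tagged; rf. Qed.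
#[local] Hint Resolve Rf_tagged : rf.
Lemma Rf_tagged2 n i j k : Rf (fun N E e => tagged2 E n (e i) (e j) (e k)).
Proof. unfold tagged2; rf. Qed.
#[local] Hint Resolve Rf_tagged2 : rf.
Lemma Rf_code_mem i j k : Rf (fun N E e => code_mem E (e i) (e j) (e k)).
Proof. unfold code_mem; rf. Qed.
Lemma Rf_code_eql i j k : Rf (fun N E e => code_eql E (e i) (e j) (e k)).
Proof. unfold code_eql; rf. Qed.
Lemma Rf_code_neg i j : Rf (fun N E e => code_neg E (e i) (e j)).
Proof. unfold code_neg; rf. Qed.
Lemma Rf_code_and i j k : Rf (fun N E e => code_and E (e i) (e j) (e k)).
Proof. unfold code_and; rf. Qed.
Lemma Rf_code_ex i j k : Rf (fun N E e => code_ex E (e i) (e j) (e k)).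
Proof. unfold code_ex; rf. Qed.
#[local] Hint Resolve Rf_code_mem Rf_code_eql Rf_code_neg Rf_code_and Rf_code_ex : rf.
Lemma Rf_form_closed i : Rf (fun N E e => form_closed E (e i)).
Proof. unfold form_closed; rf. Qed.
#[local] Hint Resolve Rf_form_closed : rf.
Lemma Rf_is_form i : Rf (fun N E e => is_form E (e i)).
Proof. unfold is_form; rf. Qed.
Lemma Rf_assignment i j : Rf (fun N E e => assignment E (e i) (e j)).
Proof. unfold assignment; rf. Qed.
Lemma Rf_is_update i j k l : Rf (fun N E e => is_update E (e i) (e j) (e k) (e l)).
Proof. unfold is_update; rf. Qed.
#[local] Hint Resolve Rf_is_form Rf_assignment Rf_is_update : rf.
Lemma Rf_sat_relation i j : Rf (fun N E e => sat_relation E (e i) (e j)).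
Proof. unfold sat_relation; rf. Qed.
#[local] Hint Resolve Rf_sat_relation : rf.
Lemma Rf_Sat i j k : Rf (fun N E e => Sat E (e i) (e j) (e k)).
Proof. unfold Sat; rf. Qed.
#[local] Hint Resolve Rf_Sat : rf.
Lemma Rf_OD i : Rf (fun N E e => OD E (e i)).
Proof. unfold OD; rf. Qed.
#[local] Hint Resolve Rf_OD : rf.
Lemma Rf_HOD i : Rf (fun N E e => HOD E (e i)).
Proof. unfold HOD; rf. Qed.
#[local] Hint Resolve Rf_HOD : rf.

Lemma Df_is_numeral M (E : M -> M -> Prop) n t : Tm t -> Df E (fun e => is_numeral E n (t e)).
Proof.
  apply (Df_of_Rf1 E (Q := fun N E x => is_numeral E n x)); exact (Rf_is_numeral n).
Qed.
#[local] Hint Resolve Df_is_numeral Tm_var Tm_cst : rf.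

(** * Elementary set theory in a model *)

(** [point] supplies default values: in the environments of closed axioms, and where functions such
    as [V] and [ap] have no meaningful value. *)
Class model {M : Type} (E : M -> M -> Prop) := {
  model_ZFC : models_ZFC E;
  point : M
}.

Section SetTheory.
Context {M : Type} {E : M -> M -> Prop} {Z : model E}.
Local Notation "x ∈ y" := (E x y) (at level 70, no associativity).

(** The primitive connectives bury the axioms under negations. [means] carries their readable form
    along, so that an axiom can be applied like a lemma. *)
Definition means (p : fml) (P : (nat -> M) -> Prop) : Prop :=
  forall e, sat E e p <-> P e.

Lemma means_self p : means p (fun e => sat E e p).
Proof. intros e; reflexivity. Qed.

Lemma means_Mem i j : means (Mem i j) (fun e => e i ∈ e j).
Proof. intros e; reflexivity. Qed.

Lemma means_Eql i j : means (Eql i j) (fun e => e i = e j).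
Proof. intros e; reflexivity. Qed.

Lemma means_Neg p P : means p P -> means (Neg p) (fun e => ~ P e).
Proof. intros H e; rewrite <- (H e); reflexivity. Qed.

Lemma means_And p q P Q : means p P -> means q Q -> means (And p q) (fun e => P e /\ Q e).
Proof. intros H K e; rewrite <- (H e), <- (K e); reflexivity. Qed.

Lemma means_Ex i p P : means p P -> means (Ex i p) (fun e => exists x, P (update e i x)).
Proof. intros H e; apply ex_iff; intros x; apply H. Qed.

Lemma means_Or p q P Q : means p P -> means q Q -> means (Or p q) (fun e => P e \/ Q e).
Proof. intros H K e; rewrite <- (H e), <- (K e); cbn; tauto. Qed.

Lemma means_Imp p q P Q : means p P -> means q Q -> means (Imp p q) (fun e => P e -> Q e).
Proof. intros H K e; rewrite <- (H e), <- (K e); cbn; tauto. Qed.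

Lemma means_Iff p q P Q : means p P -> means q Q -> means (Iff p q) (fun e => P e <-> Q e).
Proof. intros H K e; rewrite <- (H e), <- (K e); cbn; tauto. Qed.

Lemma means_All i p P : means p P -> means (All i p) (fun e => forall x, P (update e i x)).
Proof.
  intros H e; cbn; split; [|intros K [x Hx]; apply Hx, H, K].
  intros K x; apply H, NNPP; intros Hx; apply K; eauto.
Qed.

Ltac means_tac :=
  lazymatch goal with
  | |- means (Mem _ _) _ => apply means_Mem
  | |- means (Eql _ _) _ => apply means_Eql
  | |- means (Neg _) _ => eapply means_Neg; means_tac
  | |- means (And _ _) _ => eapply means_And; means_tac
  | |- means (Or _ _) _ => eapply means_Or; means_tac
  | |- means (Imp _ _) _ => eapply means_Imp; means_tac
  | |- means (Iff _ _) _ => eapply means_Iff; means_tac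
  | |- means (Ex _ _) _ => eapply means_Ex; means_tac
  | |- means (All _ _) _ => eapply means_All; means_tac
  | |- means _ _ => apply means_self
  end.

Lemma axiom_means p P : In p ZFC_finite_part -> means p P -> P (fun _ => point).
Proof. intros H K; apply K, model_ZFC; left; exact H. Qed.

Ltac axiom p H :=
  let P := fresh in
  evar (P : (nat -> M) -> Prop);
  assert (H : P (fun _ => point));
  [ subst P; apply (@axiom_means p);
    [ repeat (first [left; reflexivity | right])
    | unfold ax_extensionality, ax_foundation, ax_pairing, ax_union,
        ax_powerset, ax_infinity; means_tac ]
  | subst P; cbn in H ].

Lemma ext x y : (forall z, z ∈ x <-> z ∈ y) -> x = y.
Proof. axiom (@ax_extensionality fml _) H; auto. Qed.

Lemma foundation x : (exists y, y ∈ x) ->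
  exists y, y ∈ x /\ forall z, z ∈ y -> ~ z ∈ x.
Proof.
  axiom (@ax_foundation fml _) H; intros Hx; destruct (H x Hx) as [y [Hy Hn]].
  exists y; split; [exact Hy | intros z H1 H2; apply Hn; eauto].
Qed.

Lemma pairing x y : exists p, forall z, z ∈ p <-> z = x \/ z = y.
Proof. axiom (@ax_pairing fml _) H; auto. Qed.

Lemma union x : exists u, forall z, z ∈ u <-> exists y, y ∈ x /\ z ∈ y.
Proof. axiom (@ax_union fml _) H; auto. Qed.

Lemma powerset x : exists u, forall z, z ∈ u <-> subset E z x.
Proof. axiom (@ax_powerset fml _) H; apply H. Qed.

Lemma infinity : exists x, inductive E x.
Proof.
  axiom (@ax_infinity fml _) H; destruct H as [x [[z [H1 H2]] H]].
  exists x; split; [exists z; split; auto|].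
  intros y Hy; destruct (H y Hy) as [s [H3 H4]]; exists s; split; auto.
Qed.

(** The schemas reserve [v_0] to [v_3]. The two arguments of the relation become [v_2] and [v_3],
    and each constant gets a variable from [v_4] on, whose value [schema_env] supplies; [a] is the
    default value. *)
Definition schema_name (s : nat -> nat + M) (n : nat) : nat :=
  match s n with inl 0 => 2 | inl 1 => 3 | _ => n + 4 end.

Definition schema_env (s : nat -> nat + M) (a : M) (k : nat) : M :=
  match k with
  | S (S (S (S n))) => match s n with inr c => c | _ => a end
  | _ => a
  end.

Lemma sat_schema s p a x0 x1 z y :
  sat E (update (update (update (update (schema_env s a) 0 x0) 1 x1) 2 z) 3 y)
      (named (schema_name s) p) <->
  dsat E (env_of s (scons z (scons y (fun _ => a)))) p.
Proof.
  rewrite sat_named.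
  match goal with |- dsat _ ?e _ <-> dsat _ ?e' _ => replace e with e'; [tauto|] end.
  extensionality n; unfold env_of, schema_name, update.
  destruct (s n) as [[|[|k]]|c] eqn:Hs; try reflexivity;
  rewrite Nat.add_comm; cbn; rewrite Hs; reflexivity.
Qed.

Lemma not_free_schema s p : ~ free 1 (named (schema_name s) p).
Proof.
  intros H; apply free_named in H as [n Hn]; unfold schema_name in Hn.
  destruct (s n) as [[|[|k]]|c]; lia.
Qed.

Lemma separation (Q : M -> Prop) : Df E (fun e => Q (e 0)) ->
  forall a, exists b, forall z, z ∈ b <-> z ∈ a /\ Q z.
Proof.
  intros [p [s Hp]] a.
  pose (q := named (schema_name s) p).
  assert (H : ZFC (ax_separation q)).
  { right; exists q; split; [apply not_free_schema | left; reflexivity]. }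
  specialize (model_ZFC H (schema_env s a)) as H1.
  eassert (H2 : means (ax_separation q) _) by (unfold ax_separation; means_tac).
  pose proof (proj1 (H2 _) H1) as H3; clear H1; rename H3 into H1; cbn in H1.
  destruct (H1 a) as [b Hb]; exists b; intros z; specialize (Hb z); cbn in Hb.
  rewrite Hb.
  (* [v_3] already has the default value [a], so the fourth update in [sat_schema] changes
     nothing. *)
  assert (Hq := sat_schema s p a a b z a); rewrite Hp in Hq; cbn in Hq.
  rewrite <- Hq; unfold q.
  match goal with |- _ /\ sat _ ?e _ <-> _ /\ sat _ ?e' _ =>
    enough (He : e' = e) by (rewrite He; tauto) end.
  extensionality k; unfold update, schema_env.
  destruct k as [|[|[|[|k]]]]; reflexivity.
Qed.

Lemma replacement (Q : M -> M -> Prop) : Df E (fun e => Q (e 0) (e 1)) ->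
  forall a, (forall x y y', x ∈ a -> Q x y -> Q x y' -> y = y') ->
  exists b, forall y, y ∈ b <-> exists x, x ∈ a /\ Q x y.
Proof.
  intros HQ a0 Hfun0.
  (* [ax_replacement] asks for a value at every element, so the set is first cut down to the domain
     of [Q]. *)
  assert (exists a, forall z, z ∈ a <-> z ∈ a0 /\ exists y, Q z y) as [a Ha].
  { apply separation, (Df_ex (P := fun e y => Q (e 0) y)).
    exact (Df_app2 HQ (Tm_var 1) (Tm_var 0)). }
  destruct HQ as [p [s Hp]].
  pose (q := named (schema_name s) p).
  assert (H : ZFC (ax_replacement q)).
  { right; exists q; split; [apply not_free_schema | right; reflexivity]. }
  specialize (model_ZFC H (schema_env s a)) as H1.
  eassert (H2 : means (ax_replacement q) _) by (unfold ax_replacement; means_tac).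
  pose proof (proj1 (H2 _) H1) as H3; clear H1; rename H3 into H1; cbn in H1.
  assert (Hq : forall x0 x1 z y e,
    e 0 = x0 -> e 1 = x1 -> e 2 = z -> e 3 = y ->
    (forall n, e (S (S (S (S n)))) = schema_env s a (S (S (S (S n))))) ->
    sat E e q <-> Q z y).
  { intros x0 x1 z y e K0 K1 K2 K3 K4.
    rewrite <- (Hp (scons z (scons y (fun _ => a)))), <- (sat_schema s p a x0 x1 z y).
    unfold q.
    match goal with |- sat _ ?e _ <-> sat _ ?e' _ =>
      enough (He : e = e') by (rewrite He; tauto) end.
    extensionality k; unfold update.
    destruct k as [|[|[|[|k]]]]; cbn; auto. }
  destruct (H1 a) as [b Hb].
  - intros z Hz; cbn in Hz; apply Ha in Hz as [Hz [y Hy]].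
    exists y; intros y'.
    rewrite (Hq a y z y') by reflexivity; cbn.
    split; [intros Hy'; exact (Hfun0 _ _ _ Hz Hy' Hy) | intros ->; exact Hy].
  - exists b; intros y; specialize (Hb y); rewrite Hb.
    split.
    + intros [z Hz]; rewrite (Hq a b z y) in Hz by reflexivity; cbn in Hz.
      exists z; split; [apply Ha|]; tauto.
    + intros [z [Hz Hy]]; exists z; rewrite (Hq a b z y) by reflexivity; cbn.
      split; [apply Ha; eauto | exact Hy].
Qed.

End SetTheory.

Section Sets.
Context {M : Type} {E : M -> M -> Prop} {Z : model E}.
Local Notation "x ∈ y" := (E x y) (at level 70, no associativity).
Local Notation cid := constructive_indefinite_description.

(** Chosen witnesses turn the set operations into functions and the predicates of the theory into
    equations. The predicates stay in use wherever definability is required, since a chosen function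
    is not a formula. *)
Definition upr (x y : M) : M := proj1_sig (cid _ (pairing x y)).
Definition un (x : M) : M := proj1_sig (cid _ (union x)).
Definition pw (x : M) : M := proj1_sig (cid _ (powerset x)).

Lemma emptyset : exists x, empty E x.
Proof.
  destruct (@separation _ _ Z (fun _ => False) (Df_cst E False) point) as [x Hx].
  exists x; intros z Hz; apply Hx in Hz; tauto.
Qed.

Definition emp : M := proj1_sig (cid _ emptyset).
Definition cup (x y : M) : M := un (upr x y).
Definition pr (x y : M) : M := upr (upr x x) (upr x y).
Definition suc (x : M) : M := cup x (upr x x).

Lemma in_upr x y z : z ∈ upr x y <-> z = x \/ z = y.
Proof. unfold upr; destruct (cid _ _); auto. Qed.

Lemma in_un x z : z ∈ un x <-> exists y, y ∈ x /\ z ∈ y.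
Proof. unfold un; destruct (cid _ _); auto. Qed.

Lemma in_pw x z : z ∈ pw x <-> subset E z x.
Proof. unfold pw; destruct (cid _ _); auto. Qed.

Lemma in_emp z : ~ z ∈ emp.
Proof. unfold emp; destruct (cid _ _) as [x Hx]; apply Hx. Qed.

Lemma in_cup x y z : z ∈ cup x y <-> z ∈ x \/ z ∈ y.
Proof.
  unfold cup; rewrite in_un; split.
  - intros [u [Hu Hz]]; apply in_upr in Hu as [->| ->]; auto.
  - intros [H|H]; [exists x | exists y]; rewrite in_upr; auto.
Qed.

Lemma in_suc x z : z ∈ suc x <-> z ∈ x \/ z = x.
Proof. unfold suc; rewrite in_cup, in_upr; tauto. Qed.

Lemma suc_self x : x ∈ suc x.
Proof. apply in_suc; auto. Qed.

Lemma empty_eq x : empty E x <-> x = emp.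
Proof.
  split; [|intros ->; exact in_emp].
  intros H; apply ext; intros z; split; intros Hz; [destruct (H z Hz) | destruct (in_emp Hz)].
Qed.

Lemma is_upair_eq p x y : is_upair E p x y <-> p = upr x y.
Proof.
  split; [|intros ->; intros z; apply in_upr].
  intros H; apply ext; intros z; rewrite (H z), in_upr; tauto.
Qed.

Lemma is_succ_eq y x : is_succ E y x <-> y = suc x.
Proof.
  split; [|intros ->; intros z; apply in_suc].
  intros H; apply ext; intros z; rewrite (H z), in_suc; tauto.
Qed.

Lemma is_pair_eq p x y : is_pair E p x y <-> p = pr x y.
Proof.
  unfold is_pair, pr; split.
  - intros [s [t [Hs [Ht Hp]]]]; rewrite is_upair_eq in *; subst; reflexivity.
  - intros ->; exists (upr x x), (upr x y); rewrite !is_upair_eq; auto.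
Qed.

Lemma has_pair_eq f x y : has_pair E f x y <-> pr x y ∈ f.
Proof.
  unfold has_pair; split.
  - intros [p [Hp H]]; apply is_pair_eq in Hp; subst; exact H.
  - intros H; exists (pr x y); rewrite is_pair_eq; auto.
Qed.

Lemma upr_inj x y y' : upr x y = upr x y' -> y = y'.
Proof.
  intros H.
  assert (H1 : y ∈ upr x y') by (rewrite <- H; apply in_upr; auto).
  assert (H2 : y' ∈ upr x y) by (rewrite H; apply in_upr; auto).
  apply in_upr in H1, H2; intuition congruence.
Qed.

Lemma pr_inj x y x' y' : pr x y = pr x' y' -> x = x' /\ y = y'.
Proof.
  unfold pr; intros H.
  assert (Hx : x = x').
  { assert (H1 : upr x x ∈ upr (upr x' x') (upr x' y')) by (rewrite <- H; apply in_upr; auto).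
    assert (H2 : x' ∈ upr x x).
    { apply in_upr in H1 as [-> | ->]; apply in_upr; auto. }
    apply in_upr in H2; intuition. }
  subst x'; split; [reflexivity|]; apply upr_inj, upr_inj in H; exact H.
Qed.

Lemma subset_antisym x y : subset E x y -> subset E y x -> x = y.
Proof. intros H1 H2; apply ext; split; auto. Qed.

Lemma mem_irrefl x : ~ x ∈ x.
Proof.
  intros H; destruct (foundation (x := upr x x)) as [y [Hy Hn]].
  - exists x; apply in_upr; auto.
  - apply in_upr in Hy; assert (y = x) as -> by tauto; apply (Hn x H), in_upr; auto.
Qed.

Lemma mem_asym3 x y z : x ∈ y -> y ∈ z -> ~ z ∈ x.
Proof.
  intros H1 H2 H3; destruct (foundation (x := cup (upr x y) (upr z z))) as [u [Hu Hn]].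
  - exists x; rewrite in_cup, in_upr; auto.
  - rewrite in_cup, !in_upr in Hu.
    assert (u = x \/ u = y \/ u = z) as [->|[->| ->]] by tauto;
      [apply (Hn z H3) | apply (Hn x H1) | apply (Hn y H2)];
      rewrite in_cup, !in_upr; tauto.
Qed.

Lemma mem_asym x y : x ∈ y -> ~ y ∈ x.
Proof.
  intros H1 H2; destruct (foundation (x := upr x y)) as [u [Hu Hn]].
  - exists x; rewrite in_upr; auto.
  - rewrite in_upr in Hu.
    destruct Hu as [-> | ->]; [apply (Hn y H2) | apply (Hn x H1)]; rewrite in_upr; tauto.
Qed.

Lemma suc_inj x y : suc x = suc y -> x = y.
Proof.
  intros H.
  assert (H1 : x ∈ suc y) by (rewrite <- H; apply suc_self).
  assert (H2 : y ∈ suc x) by (rewrite H; apply suc_self).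
  apply in_suc in H1, H2; destruct H1, H2; auto.
  destruct (mem_asym H0 H1).
Qed.

(** ** Natural numbers *)

Lemma inductive_iff x : inductive E x <-> emp ∈ x /\ forall y, y ∈ x -> suc y ∈ x.
Proof.
  unfold inductive; split.
  - intros [[z [Hz Hx]] H]; apply empty_eq in Hz; subst; split; [exact Hx|].
    intros y Hy; destruct (H y Hy) as [s [Hs Hs']]; apply is_succ_eq in Hs; subst; exact Hs'.
  - intros [H1 H2]; split; [exists emp; rewrite empty_eq; auto|].
    intros y Hy; exists (suc y); rewrite is_succ_eq; auto.
Qed.

Lemma omega_exists : exists w, is_omega E w.
Proof.
  destruct (@infinity _ _ Z) as [i Hi].
  destruct (@separation _ _ Z (fun x => forall j, inductive E j -> x ∈ j)) with (a := i)
    as [w Hw]; [df|].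
  exists w; split; [|intros x Hx z Hz; apply Hw in Hz as [_ Hz]; auto].
  apply inductive_iff; split.
  - apply Hw; split; [|intros j Hj]; apply inductive_iff; auto.
  - intros y Hy; apply Hw in Hy as [Hy Hy']; apply Hw; split.
    + apply inductive_iff in Hi; apply Hi, Hy.
    + intros j Hj; specialize (Hy' j Hj); apply inductive_iff in Hj; apply Hj, Hy'.
Qed.

Definition om : M := proj1_sig (cid _ omega_exists).

Lemma om_omega : is_omega E om.
Proof. unfold om; destruct (cid _ _); auto. Qed.

Lemma is_omega_eq w : is_omega E w <-> w = om.
Proof.
  pose proof om_omega; split; [|intros ->; auto].
  intros [H1 H2]; destruct H; apply subset_antisym; auto.
Qed.

Lemma is_nat_eq n : is_nat E n <-> n ∈ om.
Proof.
  unfold is_nat; split.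
  - intros [w [Hw Hn]]; apply is_omega_eq in Hw; subst; exact Hn.
  - intros H; exists om; rewrite is_omega_eq; auto.
Qed.

Lemma om_emp : emp ∈ om.
Proof. apply inductive_iff, om_omega. Qed.

Lemma om_suc n : n ∈ om -> suc n ∈ om.
Proof. apply inductive_iff, om_omega. Qed.

(** [om] may have nonstandard elements, so induction over it is restricted to definable
    properties. *)
Lemma om_ind (P : M -> Prop) : Df E (fun e => P (e 0)) ->
  P emp -> (forall n, n ∈ om -> P n -> P (suc n)) -> forall n, n ∈ om -> P n.
Proof.
  intros HP H0 HS n Hn; destruct (separation HP om) as [w Hw].
  apply Hw; refine (proj2 om_omega w _ n Hn).
  apply inductive_iff; split; [apply Hw; split; [apply om_emp|auto]|].
  intros y Hy; apply Hw in Hy as [Hy Hy']; apply Hw; split; [apply om_suc|]; auto.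
Qed.

Fixpoint num (n : nat) : M := match n with 0 => emp | S n => suc (num n) end.

Lemma is_numeral_eq n : forall x, is_numeral E n x <-> x = num n.
Proof.
  induction n; intros x; simpl; [apply empty_eq|]; split.
  - intros [y [Hy Hx]]; apply IHn in Hy; apply is_succ_eq in Hx; subst; reflexivity.
  - intros ->; exists (num n); rewrite IHn, is_succ_eq; auto.
Qed.

Lemma num_om n : num n ∈ om.
Proof. induction n; simpl; [apply om_emp | apply om_suc; assumption]. Qed.

Lemma suc_neq_emp x : suc x <> emp.
Proof. intros H; apply (@in_emp x); rewrite <- H; apply suc_self. Qed.

Lemma num_inj m : forall n, num m = num n -> m = n.
Proof.
  induction m; intros [|n] H; simpl in *; auto.
  - symmetry in H; destruct (suc_neq_emp H).
  - destruct (suc_neq_emp H).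
  - apply suc_inj in H; auto.
Qed.

(** ** Ordinals *)

Lemma ord_trans a b c : ordinal E a -> b ∈ a -> c ∈ b -> c ∈ a.
Proof. intros [H _] Hb Hc; exact (H b Hb c Hc). Qed.

Lemma ord_mem a b : ordinal E a -> b ∈ a -> ordinal E b.
Proof.
  intros Ha Hb; pose proof Ha as [H1 [H2 H3]]; split; [|split].
  - intros y Hy z Hz.
    destruct (H2 z b) as [H|[H|H]]; auto.
    + apply (H1 y); auto; apply (H1 b); auto.
    + subst z; destruct (mem_asym Hy Hz).
    + destruct (mem_asym3 Hz Hy H).
  - intros x y Hx Hy; apply H2; apply (H1 b); auto.
  - intros u Hu; apply H3; intros z Hz; apply (H1 b); auto.
Qed.

Lemma ord_ind (P : M -> Prop) : Df E (fun e => P (e 0)) ->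
  (forall a, ordinal E a -> (forall b, b ∈ a -> P b) -> P a) ->
  forall a, ordinal E a -> P a.
Proof.
  intros HP H a Ha; apply NNPP; intros Hn.
  (* Foundation applies to sets, so the counterexamples are collected only up to [a]. *)
  destruct (separation (Q := fun x => ~ P x) (Df_neg HP) (suc a)) as [s Hs].
  destruct (foundation (x := s)) as [m [Hm Hmin]].
  - exists a; apply Hs; split; [apply suc_self | auto].
  - apply Hs in Hm as [Hm Hm'].
    assert (Hma : subset E m a).
    { apply in_suc in Hm as [Hm| ->]; [exact (proj1 Ha m Hm) | intros z; auto]. }
    apply Hm', H.
    + apply in_suc in Hm as [Hm| ->]; [exact (ord_mem Ha Hm) | exact Ha].
    + intros b Hb; apply NNPP; intros Hb'; apply (Hmin b Hb), Hs; split; [|exact Hb'].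
      apply in_suc; left; exact (Hma b Hb).
Qed.

Lemma ord_least (P : M -> Prop) : Df E (fun e => P (e 0)) ->
  forall a, ordinal E a -> P a ->
  exists m, ordinal E m /\ P m /\ forall b, b ∈ m -> ~ P b.
Proof.
  intros HP a Ha HPa; apply NNPP; intros Hn.
  refine (@ord_ind (fun a => ~ P a) (Df_neg HP) _ a Ha HPa).
  intros b Hb Hb' HPb; apply Hn; eauto.
Qed.

Lemma ord_trichotomy a b : ordinal E a -> ordinal E b -> a ∈ b \/ a = b \/ b ∈ a.
Proof.
  intros Ha; revert b.
  apply (@ord_ind (fun a => forall b, ordinal E b -> a ∈ b \/ a = b \/ b ∈ a)); [df| |exact Ha].
  clear a Ha; intros a Ha IHa.
  apply (@ord_ind (fun b => a ∈ b \/ a = b \/ b ∈ a)); [df|].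
  intros b Hb IHb; apply NNPP; intros Hn.
  enough (a = b) by tauto.
  apply subset_antisym; intros c Hc.
  - destruct (IHa c Hc b Hb) as [H|[->|H]]; [exact H | tauto |].
    destruct Hn; right; right; exact (ord_trans Ha Hc H).
  - destruct (IHb c Hc) as [H|[->|H]]; [|tauto | exact H].
    destruct Hn; left; exact (ord_trans Hb Hc H).
Qed.

(** Trichotomy gives the linearity, and foundation the well-foundedness. *)
Lemma ord_of_trans a :
  transitive E a -> (forall b, b ∈ a -> ordinal E b) -> ordinal E a.
Proof.
  intros H1 H2; split; [exact H1 | split].
  - intros x y Hx Hy; apply ord_trichotomy; auto.
  - intros u Hu Hne; destruct (foundation (x := u)) as [m [Hm Hmin]].
    + apply NNPP; intros Hn; apply Hne; intros z Hz; eauto.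
    + exists m; split; [exact Hm|]; intros x Hx Hxm; exact (Hmin x Hxm Hx).
Qed.

Lemma ord_emp : ordinal E emp.
Proof. apply ord_of_trans; intros x Hx; destruct (in_emp Hx). Qed.

Lemma ord_suc a : ordinal E a -> ordinal E (suc a).
Proof.
  intros Ha; apply ord_of_trans.
  - intros x Hx y Hy; apply in_suc; left.
    apply in_suc in Hx as [Hx| ->]; [exact (ord_trans Ha Hx Hy) | exact Hy].
  - intros x Hx; apply in_suc in Hx as [Hx| ->]; [exact (ord_mem Ha Hx) | exact Ha].
Qed.

Lemma ord_nat n : n ∈ om -> ordinal E n.
Proof.
  apply (@om_ind (ordinal E)); [df | exact ord_emp | intros m _; apply ord_suc].
Qed.

Lemma om_trans : transitive E om.
Proof.
  intros n Hn; revert n Hn; apply (@om_ind (fun n => subset E n om)); [df| |].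
  - intros x Hx; destruct (in_emp Hx).
  - intros n Hn IH x Hx; apply in_suc in Hx as [Hx| ->]; auto.
Qed.

Lemma ord_om : ordinal E om.
Proof. apply ord_of_trans; [exact om_trans | exact ord_nat]. Qed.

Lemma ord_subset a b : ordinal E a -> ordinal E b -> subset E a b -> a ∈ b \/ a = b.
Proof.
  intros Ha Hb H; destruct (ord_trichotomy Ha Hb) as [|[|H1]]; auto.
  destruct (mem_irrefl (H b H1)).
Qed.

Lemma ord_not_mem a b : ordinal E a -> ordinal E b -> ~ a ∈ b -> subset E b a.
Proof.
  intros Ha Hb H; destruct (ord_trichotomy Ha Hb) as [|[->|H1]]; [tauto | intros z; auto |].
  exact (proj1 Ha b H1).
Qed.

Lemma ord_cup a b : ordinal E a -> ordinal E b -> cup a b = a \/ cup a b = b.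
Proof.
  intros Ha Hb; destruct (classic (a ∈ b)) as [H|H]; [right | left];
    apply ext; intros z; rewrite in_cup; split; auto; intros [Hz|Hz]; auto.
  - exact (ord_trans Hb H Hz).
  - exact (ord_not_mem Ha Hb H Hz).
Qed.

Lemma ord_un x : (forall a, a ∈ x -> ordinal E a) -> ordinal E (un x).
Proof.
  intros H; apply ord_of_trans.
  - intros y Hy z Hz; apply in_un in Hy as [a [Ha Hy]]; apply in_un.
    exists a; split; [exact Ha | exact (ord_trans (H a Ha) Hy Hz)].
  - intros y Hy; apply in_un in Hy as [a [Ha Hy]]; exact (ord_mem (H a Ha) Hy).
Qed.

End Sets.

(** ** The cumulative hierarchy *)

Section Recursion.
Context {M : Type} {E : M -> M -> Prop} {Z : model E}.
Local Notation "x ∈ y" := (E x y) (at level 70, no associativity).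

(* The recursion [F(a) = {z | T (F c) z for some c < a}]: the hierarchy [V]
   for [T u z := z ⊆ u], and a transitive closure for a suitable other [T]. *)
Variable T : M -> M -> Prop.
Hypothesis T_df : Df E (fun e => T (e 0) (e 1)).
Hypothesis T_set : forall u, exists s, forall z, z ∈ s <-> T u z.

Definition recursive (f : M) : Prop :=
  forall b w, has_pair E f b w ->
    forall z, z ∈ w <-> exists c u, c ∈ b /\ has_pair E f c u /\ T u z.

Definition stage (a v : M) : Prop :=
  ordinal E a /\
  exists f d, is_succ E d a /\ function_on E f d /\ recursive f /\ has_pair E f a v.

Lemma T_app t u : Tm t -> Tm u -> Df E (fun e => T (t e) (u e)).
Proof. apply Df_app2, T_df. Qed.

#[local] Hint Extern 1 (Df E (fun e => T _ _)) => apply T_app; tm : rf.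

Lemma recursive_agree f f' d d' :
  function_on E f d -> function_on E f' d' -> recursive f -> recursive f' ->
  ordinal E d -> ordinal E d' ->
  forall b, ordinal E b -> b ∈ d -> b ∈ d' -> forall w w',
  has_pair E f b w -> has_pair E f' b w' -> w = w'.
Proof.
  intros Hf Hf' Hr Hr' Hd Hd'.
  apply (@ord_ind _ _ _ (fun b => b ∈ d -> b ∈ d' -> forall w w',
    has_pair E f b w -> has_pair E f' b w' -> w = w')); [df|].
  intros b Hb IH Hbd Hbd' w w' Hw Hw'; apply ext; intros z.
  rewrite (Hr _ _ Hw z), (Hr' _ _ Hw' z).
  split; intros [c [u [Hc [Hu Hz]]]]; exists c.
  - destruct (proj2 Hf' c (ord_trans Hd' Hbd' Hc)) as [u' [Hu' _]].
    assert (u = u') as <- by (apply (IH c Hc (ord_trans Hd Hbd Hc) (ord_trans Hd' Hbd' Hc)); auto).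
    exists u; auto.
  - destruct (proj2 Hf c (ord_trans Hd Hbd Hc)) as [u' [Hu' _]].
    assert (u' = u) as -> by (apply (IH c Hc (ord_trans Hd Hbd Hc) (ord_trans Hd' Hbd' Hc)); auto).
    exists u; auto.
Qed.

Lemma stage_unique a v v' : stage a v -> stage a v' -> v = v'.
Proof.
  intros [Ha [f [d [Hd [Hf [Hr Hv]]]]]] [_ [f' [d' [Hd' [Hf' [Hr' Hv']]]]]].
  apply is_succ_eq in Hd, Hd'; subst.
  exact (recursive_agree Hf Hf' Hr Hr' (ord_suc Ha) (ord_suc Ha) Ha
    (suc_self a) (suc_self a) Hv Hv').
Qed.

Lemma stage_value f d b w :
  ordinal E d -> function_on E f d -> recursive f -> has_pair E f b w -> stage b w.
Proof.
  intros Hd Hf Hr Hw.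
  assert (Hb : b ∈ d).
  { apply has_pair_eq in Hw; destruct (proj1 Hf _ Hw) as [x [y [Hx Hy]]].
    apply is_pair_eq, pr_inj in Hy as [-> _]; exact Hx. }
  split; [exact (ord_mem Hd Hb)|].
  (* [g] is the restriction of [f] to [suc b], the domain that [stage b] prescribes. *)
  destruct (@separation _ _ Z (fun p => exists x y, x ∈ suc b /\ is_pair E p x y))
    with (a := f) as [g Hg]; [df|].
  assert (Hg' : forall x y, has_pair E g x y <-> x ∈ suc b /\ has_pair E f x y).
  { intros x y; rewrite !has_pair_eq, Hg; split.
    - intros [H [x' [y' [H1 H2]]]]; apply is_pair_eq, pr_inj in H2 as [-> ->]; auto.
    - intros [H1 H2]; split; [exact H2|]; exists x, y; rewrite is_pair_eq; auto. }
  assert (Hbd : forall x, x ∈ suc b -> x ∈ d).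
  { intros x Hx; apply in_suc in Hx as [Hx| ->]; [exact (ord_trans Hd Hb Hx) | exact Hb]. }
  exists g, (suc b); rewrite is_succ_eq; split; [reflexivity | split; [split | split]].
  - intros p Hp; apply Hg in Hp; apply Hp.
  - intros x Hx; destruct (proj2 Hf x (Hbd x Hx)) as [y [Hy Hu]].
    exists y; split; [apply Hg'; auto|]; intros y' H; apply Hu, Hg', H.
  - intros x y Hxy z; apply Hg' in Hxy as [Hx Hxy]; rewrite (Hr _ _ Hxy z).
    split; intros [c [u [Hc [Hu Hz]]]]; exists c, u; repeat split; auto.
    + apply Hg'; split; [|exact Hu].
      exact (ord_trans (ord_suc (ord_mem Hd Hb)) Hx Hc).
    + apply Hg' in Hu; apply Hu.
  - apply Hg'; split; [apply suc_self | exact Hw].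
Qed.

Lemma stage_spec a v : stage a v ->
  forall z, z ∈ v <-> exists c u, c ∈ a /\ stage c u /\ T u z.
Proof.
  intros Hs; pose proof Hs as [Ha [f [d [Hd [Hf [Hr Hv]]]]]].
  apply is_succ_eq in Hd; subst d; intros z; rewrite (Hr _ _ Hv z).
  assert (Hda := ord_suc Ha).
  split; intros [c [u [Hc [Hu Hz]]]]; exists c.
  - exists u; repeat split; auto; apply (stage_value Hda Hf Hr Hu).
  - destruct (proj2 Hf c) as [u' [Hu' _]]; [apply in_suc; auto|].
    exists u'; rewrite (stage_unique (stage_value Hda Hf Hr Hu') Hu) at 2.
    auto.
Qed.

Lemma stage_df t u : Tm t -> Tm u -> Df E (fun e => stage (t e) (u e)).
Proof.
  apply (@Df_app2 _ E stage); unfold stage, recursive; df.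
Qed.
#[local] Hint Extern 1 (Df E (fun e => stage _ _)) => apply stage_df; tm : rf.

Lemma stage_exists a : ordinal E a -> exists v, stage a v.
Proof.
  apply (@ord_ind _ _ _ (fun a => exists v, stage a v)); [df|].
  clear a; intros a Ha IH.
  (* [r] collects the contributions of the earlier stages, so that its union [v] is the value at
     [a]; [g] is the graph of the earlier stages, and one more pair completes it to [f]. *)
  destruct (@replacement _ _ Z (fun c s => exists u, stage c u /\ forall z, z ∈ s <-> T u z))
    with (a := a) as [r Hr]; [df | |].
  { intros c s s' Hc [u [Hu Hs]] [u' [Hu' Hs']]; apply ext; intros z.
    rewrite Hs, Hs', (stage_unique Hu Hu'); tauto. }
  destruct (@replacement _ _ Z (fun c p => exists u, stage c u /\ is_pair E p c u))
    with (a := a) as [g Hg]; [df | |].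
  { intros c s s' Hc [u [Hu Hs]] [u' [Hu' Hs']]; apply is_pair_eq in Hs, Hs'.
    rewrite Hs, Hs', (stage_unique Hu Hu'); reflexivity. }
  pose (v := un r); pose (f := cup g (upr (pr a v) (pr a v))).
  assert (Hv : forall z, z ∈ v <-> exists c u, c ∈ a /\ stage c u /\ T u z).
  { intros z; unfold v; rewrite in_un; split.
    - intros [s [Hs Hz]]; apply Hr in Hs as [c [Hc [u [Hu Hs]]]].
      exists c, u; split; [exact Hc | split; [exact Hu | apply Hs, Hz]].
    - intros [c [u [Hc [Hu Hz]]]]; destruct (T_set u) as [s Hs].
      exists s; split; [apply Hr | apply Hs, Hz]; eauto. }
  assert (Hf : forall x y, has_pair E f x y <-> x ∈ a /\ stage x y \/ x = a /\ y = v).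
  { intros x y; unfold f; rewrite has_pair_eq, in_cup, in_upr, Hg; split.
    - intros [[c [Hc [u [Hu Hp]]]]|H].
      + apply is_pair_eq, pr_inj in Hp as [-> ->]; auto.
      + right; apply pr_inj; tauto.
    - intros [[Hx Hy]|[-> ->]]; auto.
      left; exists x; split; [exact Hx|]; exists y; rewrite is_pair_eq; auto. }
  exists v; split; [exact Ha|].
  exists f, (suc a); rewrite is_succ_eq, Hf; split; [reflexivity | split; [split | split]].
  - intros p Hp; unfold f in Hp; rewrite in_cup, in_upr, Hg in Hp.
    destruct Hp as [[c [Hc [u [Hu Hp]]]]|Hp].
    + exists c, u; split; [apply in_suc|]; auto.
    + exists a, v; rewrite is_pair_eq; split; [apply suc_self | tauto].
  - intros x Hx; apply in_suc in Hx as [Hx| ->].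
    + destruct (IH x Hx) as [u Hu]; exists u; split; [apply Hf; auto|].
      intros y Hy; apply Hf in Hy as [[_ Hy]|[-> _]]; [exact (stage_unique Hu Hy)|].
      destruct (mem_irrefl Hx).
    + exists v; split; [apply Hf; auto|].
      intros y Hy; apply Hf in Hy as [[H _]|[_ Hy]]; [destruct (mem_irrefl H) | auto].
  - intros b w Hb z; apply Hf in Hb as [[Hb Hw]|[-> ->]].
    + rewrite (stage_spec Hw z); apply ex_iff; intros c; apply ex_iff; intros u.
      rewrite Hf; split; [|intros [Hc [[[_ Hu]|[-> _]] Hz]]]; [| tauto |].
      * intros [Hc [Hu Hz]]; pose proof (ord_trans Ha Hb Hc); tauto.
      * destruct (mem_asym Hb Hc).
    + rewrite Hv; apply ex_iff; intros c; apply ex_iff; intros u.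
      rewrite Hf; split; [tauto|intros [Hc [[[_ Hu]|[-> _]] Hz]]]; [tauto |].
      destruct (mem_irrefl Hc).
  - right; auto.
Qed.

End Recursion.

Section Hierarchy.
Context {M : Type} {E : M -> M -> Prop} {Z : model E}.
Local Notation "x ∈ y" := (E x y) (at level 70, no associativity).
Local Notation cid := constructive_indefinite_description.

Lemma is_V_df : Df E (fun e => subset E (e 1) (e 0)).
Proof. df. Qed.

Lemma is_V_set u : exists s, forall z, z ∈ s <-> subset E z u.
Proof. exists (pw u); apply in_pw. Qed.

(** [is_V] unfolds to [stage] for the relation [subset E z u], so the results on [stage] apply by
    conversion. *)
Lemma is_V_unique a v v' : is_V E a v -> is_V E a v' -> v = v'.
Proof. exact (stage_unique (a := a) (v := v) (v' := v')). Qed.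

Lemma V_exists a : exists v, ordinal E a -> is_V E a v.
Proof.
  destruct (classic (ordinal E a)) as [Ha|Ha]; [|exists point; tauto].
  destruct (stage_exists is_V_df is_V_set Ha) as [v Hv]; exists v; intros _; exact Hv.
Qed.

(* Meaningful for ordinals only. *)
Definition V (a : M) : M := proj1_sig (cid _ (V_exists a)).

Lemma V_is_V a : ordinal E a -> is_V E a (V a).
Proof. unfold V; destruct (cid _ _); auto. Qed.

Lemma is_V_eq a v : is_V E a v <-> ordinal E a /\ v = V a.
Proof.
  split; [|intros [H ->]; exact (V_is_V H)].
  intros H; pose proof (proj1 H) as Ha; split; [exact Ha|].
  exact (is_V_unique H (V_is_V Ha)).
Qed.

Lemma in_V a z : ordinal E a -> z ∈ V a <-> exists c, c ∈ a /\ subset E z (V c).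
Proof.
  intros Ha; rewrite (stage_spec (V_is_V Ha) z); split.
  - intros [c [u [Hc [Hu Hz]]]]; exists c; split; [exact Hc|].
    apply is_V_eq in Hu as [_ ->]; exact Hz.
  - intros [c [Hc Hz]]; exists c, (V c); split; [exact Hc | split; [|exact Hz]].
    exact (V_is_V (ord_mem Ha Hc)).
Qed.

Lemma V_mono a c : ordinal E a -> c ∈ a -> subset E (V c) (V a).
Proof.
  intros Ha Hc z Hz; apply in_V in Hz as [b [Hb Hz]]; [|exact (ord_mem Ha Hc)].
  apply in_V; [exact Ha|]; exists b; split; [exact (ord_trans Ha Hc Hb) | exact Hz].
Qed.

Lemma V_trans a : ordinal E a -> transitive E (V a).
Proof.
  intros Ha y Hy z Hz; apply in_V in Hy as [c [Hc Hy]]; auto.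
  exact (V_mono Ha Hc (Hy z Hz)).
Qed.

Lemma V_subset a y z : ordinal E a -> y ∈ V a -> subset E z y -> z ∈ V a.
Proof.
  intros Ha Hy Hz; apply in_V in Hy as [c [Hc Hy]]; auto.
  apply in_V; [exact Ha|]; exists c; split; [exact Hc | intros w Hw; auto].
Qed.

Lemma V_ord a b : ordinal E a -> b ∈ a -> b ∈ V a.
Proof.
  intros Ha Hb; apply in_V; [exact Ha|]; exists b; split; [exact Hb|].
  (* The induction is phrased with [is_V] because it needs a definable property, and the function
     [V] is not given by a formula. *)
  assert (H : forall v, is_V E b v -> subset E b v).
  { generalize (ord_mem Ha Hb).
    apply (@ord_ind _ _ _ (fun b => forall v, is_V E b v -> subset E b v)); [df|].
    clear b Hb; intros b Hb IH v Hv c Hc; apply is_V_eq in Hv as [_ ->].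
    apply in_V; [exact Hb|]; exists c; split; [exact Hc|].
    apply (IH c Hc), V_is_V, (ord_mem Hb Hc). }
  apply H, V_is_V, (ord_mem Ha Hb).
Qed.

Lemma not_mem_V a : ordinal E a -> ~ a ∈ V a.
Proof.
  intros Ha.
  assert (H : forall v, is_V E a v -> ~ a ∈ v).
  { revert a Ha.
    apply (@ord_ind _ _ _ (fun a => forall v, is_V E a v -> ~ a ∈ v)); [df|].
    intros a Ha IH v Hv Hav; apply is_V_eq in Hv as [_ ->].
    apply in_V in Hav as [c [Hc Hav]]; [|exact Ha].
    exact (IH c Hc (V c) (V_is_V (ord_mem Ha Hc)) (Hav c Hc)). }
  exact (H (V a) (V_is_V Ha)).
Qed.

Lemma V_ord_iff a b : ordinal E a -> ordinal E b -> b ∈ V a <-> b ∈ a.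
Proof.
  intros Ha Hb; split; [|exact (V_ord Ha)].
  intros H; destruct (ord_trichotomy Ha Hb) as [H1|[->|H1]]; [| |exact H1].
  - destruct (not_mem_V Ha (V_trans Ha H H1)).
  - destruct (not_mem_V Hb H).
Qed.

Lemma transitive_closure x : exists t, transitive E t /\ x ∈ t.
Proof.
  (* With this step the stage at a number [n] holds what is reached from [x] in fewer than [n]
     descents along membership, and the stage at [om] holds all of it. *)
  pose (T u z := z = x \/ exists y, y ∈ u /\ z ∈ y).
  assert (T_df : Df E (fun e => T (e 0) (e 1))) by (unfold T; df).
  assert (T_set : forall u, exists s, forall z, z ∈ s <-> T u z).
  { intros u; exists (cup (upr x x) (un u)); intros z.
    rewrite in_cup, in_upr, in_un; unfold T; tauto. }
  destruct (stage_exists T_df T_set ord_om) as [t Ht].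
  exists t; split.
  - intros y Hy z Hz; apply (stage_spec Ht) in Hy as [c [u [Hc [Hu Hy]]]].
    destruct (stage_exists T_df T_set (ord_nat (om_suc Hc))) as [u' Hu'].
    apply (stage_spec Ht); exists (suc c), u'; split; [exact (om_suc Hc) | split; [exact Hu'|]].
    right; exists y; split; [|exact Hz].
    apply (stage_spec Hu'); exists c, u; split; [apply suc_self | auto].
  - destruct (stage_exists T_df T_set ord_emp) as [u Hu].
    apply (stage_spec Ht); exists emp, u; split; [exact om_emp | split; [exact Hu|]].
    left; reflexivity.
Qed.

Lemma all_in_V x : exists a, ordinal E a /\ x ∈ V a.
Proof.
  pose (ranked y := exists a v, is_V E a v /\ y ∈ v).
  assert (Hr : forall y, ranked y -> exists a, ordinal E a /\ y ∈ V a).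
  { intros y [a [v [Hv Hy]]]; apply is_V_eq in Hv as [Ha ->]; eauto. }
  apply Hr, NNPP; intros Hx.
  destruct (transitive_closure x) as [t [Ht Hxt]].
  (* A minimal unranked element [y] of the transitive closure has only ranked elements. *)
  destruct (@separation _ _ Z (fun y => ~ ranked y)) with (a := t) as [s Hs];
    [unfold ranked; df|].
  destruct (foundation (x := s)) as [y [Hy Hmin]]; [exists x; rewrite Hs; auto|].
  apply Hs in Hy as [Hyt Hy].
  assert (Hz : forall z, z ∈ y -> exists a, ordinal E a /\ z ∈ V a).
  { intros z Hz; apply Hr, NNPP; intros Hn.
    apply (Hmin z Hz), Hs; split; [exact (Ht y Hyt z Hz) | exact Hn]. }
  (* Replacement needs a single value, hence the least level that contains [z]. *)
  pose (at_least z a := exists v, is_V E a v /\ z ∈ v).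
  destruct (@replacement _ _ Z (fun z a => at_least z a /\ forall b, b ∈ a -> ~ at_least z b))
    with (a := y) as [r Hrr]; [unfold at_least; df | |].
  { intros z a b _ [Ha Ha'] [Hb Hb'].
    pose proof Ha as [v [Hv _]]; apply proj1 in Hv.
    pose proof Hb as [w [Hw _]]; apply proj1 in Hw.
    destruct (ord_trichotomy Hv Hw) as [H|[H|H]]; [|exact H|].
    - destruct (Hb' a H Ha).
    - destruct (Ha' b H Hb). }
  assert (Hru : ordinal E (un r)).
  { apply ord_un; intros a Ha; apply Hrr in Ha as [z [_ [[v [Hv _]] _]]].
    apply is_V_eq in Hv; tauto. }
  assert (Hu := ord_suc Hru).
  (* The collected ordinals are at most [un r], hence below its successor; so [y] is a subset of
     that level and an element of the next one. *)
  apply Hy; exists (suc (suc (un r))), (V (suc (suc (un r)))).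
  split; [apply V_is_V, ord_suc, Hu|].
  apply in_V; [apply ord_suc, Hu|]; exists (suc (un r)); split; [apply suc_self|].
  intros z Hzy; destruct (Hz z Hzy) as [a [Ha Hza]].
  destruct (@ord_least _ _ _ (at_least z)) with (a := a) as [m [Hm [Hm1 Hm2]]];
    [unfold at_least; df | exact Ha | exists (V a); auto using V_is_V |].
  assert (Hmr : m ∈ r) by (apply Hrr; eauto).
  destruct Hm1 as [v [Hv Hzv]]; apply is_V_eq in Hv as [_ ->].
  assert (Hle : m ∈ suc (un r)).
  { apply in_suc, ord_subset; auto; intros w Hw; apply in_un; eauto. }
  exact (V_mono Hu Hle Hzv).
Qed.

End Hierarchy.

(** * Levels at limit ordinals, products and least fixed points *)

Section Limits.
Context {M : Type} {E : M -> M -> Prop} {Z : model E}.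
Local Notation "x ∈ y" := (E x y) (at level 70, no associativity).

Definition limit (b : M) : Prop :=
  ordinal E b /\ emp ∈ b /\ forall c, c ∈ b -> suc c ∈ b.

Lemma limit_om : limit om.
Proof. split; [exact ord_om | split; [exact om_emp | exact om_suc]]. Qed.

Lemma limit_common b x y : limit b -> x ∈ V b -> y ∈ V b ->
  exists c, c ∈ b /\ x ∈ V c /\ y ∈ V c.
Proof.
  intros [Hb [_ Hs]] Hx Hy.
  apply in_V in Hx as [c [Hc Hx]]; [|exact Hb].
  apply in_V in Hy as [d [Hd Hy]]; [|exact Hb].
  assert (H : forall m, m ∈ b -> subset E c m -> subset E d m ->
    exists c, c ∈ b /\ x ∈ V c /\ y ∈ V c).
  { intros m Hm Hcm Hdm; pose proof (ord_mem Hb Hm) as Hmo.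
    assert (Hsub : forall k, ordinal E k -> subset E k m -> subset E (V k) (V m)).
    { intros k Hk Hkm; destruct (ord_subset Hk Hmo Hkm) as [H| ->]; [exact (V_mono Hmo H) | intros z; auto]. }
    exists (suc m); split; [exact (Hs m Hm)|].
    split; apply in_V; try apply (ord_suc Hmo); exists m; (split; [apply suc_self|]);
      intros z Hz;
      [apply (Hsub c (ord_mem Hb Hc)) | apply (Hsub d (ord_mem Hb Hd))]; auto. }
  destruct (classic (c ∈ d)) as [Hcd|Hcd].
  - apply (H d Hd); [exact (proj1 (ord_mem Hb Hd) c Hcd) | intros z; auto].
  - apply (H c Hc); [intros z; auto | exact (ord_not_mem (ord_mem Hb Hc) (ord_mem Hb Hd) Hcd)].
Qed.

Lemma limit_sub b x c : limit b -> c ∈ b -> subset E x (V c) -> x ∈ V b.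
Proof. intros [Hb _] Hc Hx; apply in_V; eauto. Qed.

Lemma V_upr c x y : ordinal E c -> x ∈ V c -> y ∈ V c -> upr x y ∈ V (suc c).
Proof.
  intros Hc Hx Hy; apply in_V; [exact (ord_suc Hc)|]; exists c; split; [apply suc_self|].
  intros z Hz; apply in_upr in Hz as [-> | ->]; assumption.
Qed.

Lemma V_pr c x y : ordinal E c -> x ∈ V c -> y ∈ V c -> pr x y ∈ V (suc (suc c)).
Proof. intros Hc Hx Hy; apply V_upr; auto using V_upr, ord_suc. Qed.

Lemma limit_pr b x y : limit b -> x ∈ V b -> y ∈ V b -> pr x y ∈ V b.
Proof.
  intros Hb Hx Hy; destruct (limit_common Hb Hx Hy) as [c [Hc [Hxc Hyc]]].
  destruct Hb as [Hb [_ Hs]].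
  exact (V_mono Hb (Hs _ (Hs _ Hc)) (V_pr (ord_mem Hb Hc) Hxc Hyc)).
Qed.

(** Any set of such pairs is covered, not just the product: recursion functions, assignments and
    satisfaction relations enter [V b] in this way. *)
Lemma limit_cart b A B X : limit b -> A ∈ V b -> B ∈ V b ->
  (forall p, p ∈ X -> exists x y, x ∈ A /\ y ∈ B /\ p = pr x y) -> X ∈ V b.
Proof.
  intros Hb HA HB HX; destruct (limit_common Hb HA HB) as [c [Hc [HAc HBc]]].
  pose proof (ord_mem (proj1 Hb) Hc) as Hco.
  apply (limit_sub Hb (c := suc (suc c))); [apply Hb, Hb, Hc|].
  intros p Hp; destruct (HX p Hp) as [x [y [Hx [Hy ->]]]].
  apply V_pr; auto; [exact (V_trans Hco HAc Hx) | exact (V_trans Hco HBc Hy)].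
Qed.

Lemma limit_pw b x : limit b -> x ∈ V b -> pw x ∈ V b.
Proof.
  intros Hb Hx; destruct (limit_common Hb Hx Hx) as [c [Hc [Hxc _]]].
  apply (limit_sub Hb Hc); intros y Hy; apply in_pw in Hy.
  exact (V_subset (ord_mem (proj1 Hb) Hc) Hxc Hy).
Qed.

Lemma product A B : exists C, forall p, p ∈ C <-> exists x y, x ∈ A /\ y ∈ B /\ p = pr x y.
Proof.
  destruct (@separation _ _ Z (fun p => exists x y, x ∈ A /\ y ∈ B /\ is_pair E p x y))
    with (a := pw (pw (cup A B))) as [C HC]; [df|].
  exists C; intros p; rewrite HC; split.
  - intros [_ [x [y [Hx [Hy Hp]]]]]; exists x, y; rewrite is_pair_eq in Hp; auto.
  - intros [x [y [Hx [Hy ->]]]]; split; [|exists x, y; rewrite is_pair_eq; auto].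
    apply in_pw; intros z Hz; apply in_pw; intros w Hw; apply in_cup.
    apply in_upr in Hz as [-> | ->]; apply in_upr in Hw as [-> | ->]; auto.
Qed.

Definition cart (A B : M) : M := proj1_sig (constructive_indefinite_description _ (product A B)).

Lemma in_cart A B p : p ∈ cart A B <-> exists x y, x ∈ A /\ y ∈ B /\ p = pr x y.
Proof. unfold cart; destruct (constructive_indefinite_description _ _); auto. Qed.

Lemma pr_cart A B x y : pr x y ∈ cart A B <-> x ∈ A /\ y ∈ B.
Proof.
  rewrite in_cart; split.
  - intros [x' [y' [Hx [Hy Hp]]]]; apply pr_inj in Hp as [-> ->]; auto.
  - intros [Hx Hy]; exists x, y; auto.
Qed.

(* Knaster-Tarski below the set [U]. *)
Lemma least_fixed_point (U : M) (G : M -> M -> Prop) :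
  Df E (fun e => G (e 0) (e 1)) ->
  (forall X Y p, subset E X Y -> G X p -> G Y p) ->
  exists I, (forall p, p ∈ I <-> p ∈ U /\ G I p) /\
    forall X, (forall p, p ∈ U -> G X p -> p ∈ X) -> subset E I X.
Proof.
  intros HG Hmono.
  assert (HG' : forall t u, Tm t -> Tm u -> Df E (fun e => G (t e) (u e)))
    by (intros; apply Df_app2; assumption).
  destruct (@separation _ _ Z (fun p => forall X, (forall q, q ∈ U -> G X q -> q ∈ X) -> p ∈ X))
    with (a := U) as [I HI]; [df; apply HG'; tm|].
  assert (Hcl : forall p, p ∈ U -> G I p -> p ∈ I).
  { intros p Hp HGp; apply HI; split; [exact Hp|]; intros X HX; apply HX; [exact Hp|].
    apply (Hmono I); [|exact HGp]; intros q Hq; apply HI in Hq; apply Hq, HX. }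
  exists I; split; [|intros X HX p Hp; apply HI in Hp; apply Hp, HX].
  intros p; split; [|intros [Hp HGp]; auto].
  destruct (@separation _ _ Z (fun p => G I p)) with (a := U) as [J HJ]; [apply HG'; tm|].
  intros Hp; apply HJ; apply HI in Hp as [_ Hp]; apply Hp.
  intros q Hq HGq; apply HJ; split; [exact Hq|]; apply (Hmono J); [|exact HGq].
  intros r Hr; apply HJ in Hr; apply Hcl; apply Hr.
Qed.

End Limits.

(** * Codes of formulas *)

Section Codes.
Context {M : Type} {E : M -> M -> Prop} {Z : model E}.
Local Notation "x ∈ y" := (E x y) (at level 70, no associativity).

Definition cmem (i j : M) : M := pr (num 0) (pr i j).
Definition ceql (i j : M) : M := pr (num 1) (pr i j).
Definition cneg (x : M) : M := pr (num 2) x.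
Definition cand (x y : M) : M := pr (num 3) (pr x y).
Definition cex (i x : M) : M := pr (num 4) (pr i x).

Lemma tagged_eq n c x : tagged E n c x <-> c = pr (num n) x.
Proof.
  unfold tagged; split.
  - intros [t [Ht Hc]]; apply is_numeral_eq in Ht; apply is_pair_eq in Hc; subst; reflexivity.
  - intros ->; exists (num n); rewrite is_numeral_eq, is_pair_eq; auto.
Qed.

Lemma tagged2_eq n c x y : tagged2 E n c x y <-> c = pr (num n) (pr x y).
Proof.
  unfold tagged2; split.
  - intros [p [Hp Hc]]; apply is_pair_eq in Hp; apply tagged_eq in Hc; subst; reflexivity.
  - intros ->; exists (pr x y); rewrite tagged_eq, is_pair_eq; auto.
Qed.

Lemma code_mem_eq c i j : code_mem E c i j <-> c = cmem i j.
Proof. apply tagged2_eq. Qed.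
Lemma code_eql_eq c i j : code_eql E c i j <-> c = ceql i j.
Proof. apply tagged2_eq. Qed.
Lemma code_neg_eq c x : code_neg E c x <-> c = cneg x.
Proof. apply tagged_eq. Qed.
Lemma code_and_eq c x y : code_and E c x y <-> c = cand x y.
Proof. apply tagged2_eq. Qed.
Lemma code_ex_eq c i x : code_ex E c i x <-> c = cex i x.
Proof. apply tagged2_eq. Qed.

Lemma tag_inj m n x y : pr (num m) x = pr (num n) y -> m = n /\ x = y.
Proof. intros H; apply pr_inj in H as [H1 H2]; apply num_inj in H1; auto. Qed.

Lemma form_closed_iff X : form_closed E X <->
  (forall i j, i ∈ om -> j ∈ om -> cmem i j ∈ X /\ ceql i j ∈ X) /\
  (forall x, x ∈ X -> cneg x ∈ X) /\
  (forall x y, x ∈ X -> y ∈ X -> cand x y ∈ X) /\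
  (forall i x, i ∈ om -> x ∈ X -> cex i x ∈ X).
Proof.
  unfold form_closed.
  setoid_rewrite code_mem_eq; setoid_rewrite code_eql_eq; setoid_rewrite code_neg_eq;
  setoid_rewrite code_and_eq; setoid_rewrite code_ex_eq; setoid_rewrite is_nat_eq.
  split.
  - intros H; split; [|split; [|split]].
    + intros i j Hi Hj; split; apply H; left; exists i, j; auto.
    + intros x Hx; apply H; right; left; eauto.
    + intros x y Hx Hy; apply H; right; right; left; exists x, y; auto.
    + intros i x Hi Hx; apply H; right; right; right; exists i, x; auto.
  - intros [H1 [H2 [H3 H4]]] c
      [[i [j [Hi [Hj [-> | ->]]]]]|[[x [Hx ->]]|[[x [y [Hx [Hy ->]]]]|[i [x [Hi [Hx ->]]]]]]];
      try apply H1; auto.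
Qed.

Lemma limit_nat b i : limit b -> i ∈ om -> i ∈ b.
Proof.
  intros [Hb [H0 HS]]; apply (@om_ind _ _ _ (fun i => i ∈ b)); [df | exact H0 | auto].
Qed.

(** [is_form] quantifies over all closed sets, so it says nothing until one is found. Taken at [om],
    this one makes the codes a set. *)
Lemma form_closed_limit b : limit b -> form_closed E (V b).
Proof.
  intros Hb.
  assert (Hom : forall i, i ∈ om -> i ∈ V b)
    by (intros i Hi; apply (V_ord (proj1 Hb)), (limit_nat Hb Hi)).
  assert (Hn := fun n => Hom (num n) (num_om n)).
  apply form_closed_iff; unfold cmem, ceql, cneg, cand, cex.
  repeat split; intros; repeat (apply (limit_pr Hb)); auto.
Qed.

Lemma is_form_V c : is_form E c -> c ∈ V om.
Proof. intros H; apply H, form_closed_limit, limit_om. Qed.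

Lemma form_set : exists F, forall c, c ∈ F <-> is_form E c.
Proof.
  destruct (@separation _ _ Z (is_form E)) with (a := V om) as [F HF]; [df|].
  exists F; intros c; rewrite HF; split; [tauto|]; intros H; split; [apply is_form_V|]; exact H.
Qed.

Definition Form : M := proj1_sig (constructive_indefinite_description _ form_set).

Lemma in_Form c : c ∈ Form <-> is_form E c.
Proof. unfold Form; destruct (constructive_indefinite_description _ _); auto. Qed.

Lemma Form_closed : form_closed E Form.
Proof.
  intros c H; apply in_Form; intros X HX; apply HX.
  assert (HFX : forall x, x ∈ Form -> x ∈ X) by (intros x Hx; apply in_Form in Hx; auto).
  destruct H as [[i [j H]]|[[x [Hx H]]|[[x [y [Hx [Hy H]]]]|[i [x [Hi [Hx H]]]]]]].
  - left; exists i, j; exact H.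
  - right; left; exists x; auto.
  - right; right; left; exists x, y; auto.
  - right; right; right; exists i, x; auto.
Qed.

Lemma form_mem i j : i ∈ om -> j ∈ om -> is_form E (cmem i j).
Proof. intros Hi Hj; apply in_Form, (proj1 (proj1 (form_closed_iff _) Form_closed)); auto. Qed.

Lemma form_eql i j : i ∈ om -> j ∈ om -> is_form E (ceql i j).
Proof. intros Hi Hj; apply in_Form, (proj1 (proj1 (form_closed_iff _) Form_closed)); auto. Qed.

Lemma form_neg x : is_form E x -> is_form E (cneg x).
Proof. rewrite <- !in_Form; apply (proj1 (form_closed_iff _) Form_closed). Qed.

Lemma form_and x y : is_form E x -> is_form E y -> is_form E (cand x y).
Proof. rewrite <- !in_Form; apply (proj1 (form_closed_iff _) Form_closed). Qed.

Lemma form_ex i x : i ∈ om -> is_form E x -> is_form E (cex i x).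
Proof. rewrite <- !in_Form; apply (proj1 (form_closed_iff _) Form_closed). Qed.

Lemma form_ind (P : M -> Prop) : Df E (fun e => P (e 0)) ->
  (forall i j, i ∈ om -> j ∈ om -> P (cmem i j)) ->
  (forall i j, i ∈ om -> j ∈ om -> P (ceql i j)) ->
  (forall x, is_form E x -> P x -> P (cneg x)) ->
  (forall x y, is_form E x -> is_form E y -> P x -> P y -> P (cand x y)) ->
  (forall i x, i ∈ om -> is_form E x -> P x -> P (cex i x)) ->
  forall c, is_form E c -> P c.
Proof.
  intros HP H1 H2 H3 H4 H5 c Hc; destruct (separation HP Form) as [X HX].
  apply HX, Hc, form_closed_iff.
  assert (HX' : forall x, x ∈ X <-> is_form E x /\ P x)
    by (intros x; rewrite HX, in_Form; tauto).
  setoid_rewrite HX'.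
  split; [|split; [|split]]; intros.
  - auto using form_mem, form_eql.
  - intuition auto using form_neg.
  - intuition auto using form_and.
  - intuition auto using form_ex.
Qed.

(** ** Free variables *)

Definition free_clause (X i c : M) : Prop :=
  (exists j, c = cmem i j \/ c = cmem j i \/ c = ceql i j \/ c = ceql j i) \/
  (exists x, c = cneg x /\ pr i x ∈ X) \/
  (exists x y, c = cand x y /\ (pr i x ∈ X \/ pr i y ∈ X)) \/
  (exists j x, c = cex j x /\ i <> j /\ pr i x ∈ X).

Lemma free_closed_iff X : free_closed E X <->
  forall i c, is_form E c -> free_clause X i c -> pr i c ∈ X.
Proof.
  unfold free_closed, free_clause.
  setoid_rewrite code_mem_eq; setoid_rewrite code_eql_eq; setoid_rewrite code_neg_eq;
  setoid_rewrite code_and_eq; setoid_rewrite code_ex_eq; setoid_rewrite has_pair_eq.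
  tauto.
Qed.

Lemma free_clause_mono X Y i c : subset E X Y -> free_clause X i c -> free_clause Y i c.
Proof.
  intros H [H1|[[x [Hc Hx]]|[[x [y [Hc Hx]]]|[j [x [Hc [Hi Hx]]]]]]].
  - left; exact H1.
  - right; left; exists x; auto.
  - right; right; left; exists x, y; intuition.
  - right; right; right; exists j, x; auto.
Qed.

Lemma pr_V a x y : ordinal E a -> pr x y ∈ V a -> x ∈ V a /\ y ∈ V a.
Proof.
  intros Ha H.
  assert (H1 : upr x y ∈ V a) by (apply (V_trans Ha H), in_upr; auto).
  split; apply (V_trans Ha H1), in_upr; auto.
Qed.

Lemma is_free_spec i c : is_free E i c <-> is_form E c /\
  ((exists j, c = cmem i j \/ c = cmem j i \/ c = ceql i j \/ c = ceql j i) \/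
   (exists x, c = cneg x /\ is_free E i x) \/
   (exists x y, c = cand x y /\ (is_free E i x \/ is_free E i y)) \/
   (exists j x, c = cex j x /\ i <> j /\ is_free E i x)).
Proof.
  (* [is_free] does not ask [i] to be a number. [V om] is a sufficient range because a free [i] is a
     component of a code; [Hpr] shows that the restriction loses nothing. *)
  destruct (@least_fixed_point _ _ Z (cart (V om) Form) (fun X p => exists i c, is_pair E p i c /\
    ((exists j, code_mem E c i j \/ code_mem E c j i \/ code_eql E c i j \/ code_eql E c j i) \/
     (exists x, code_neg E c x /\ has_pair E X i x) \/
     (exists x y, code_and E c x y /\ (has_pair E X i x \/ has_pair E X i y)) \/
     (exists j x, code_ex E c j x /\ i <> j /\ has_pair E X i x)))) as [I [HI Hmin]];
    [df | |].
  { intros X Y p HXY [k [d [Hp H]]]; exists k, d; split; [exact Hp|].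
    revert H; setoid_rewrite has_pair_eq; fold (free_clause X k d).
    setoid_rewrite code_mem_eq; setoid_rewrite code_eql_eq; setoid_rewrite code_neg_eq;
    setoid_rewrite code_and_eq; setoid_rewrite code_ex_eq.
    exact (free_clause_mono HXY). }
  assert (HI' : forall k d, pr k d ∈ I <-> pr k d ∈ cart (V om) Form /\ free_clause I k d).
  { intros k d; rewrite HI; unfold free_clause.
    setoid_rewrite has_pair_eq; setoid_rewrite is_pair_eq;
    setoid_rewrite code_mem_eq; setoid_rewrite code_eql_eq; setoid_rewrite code_neg_eq;
    setoid_rewrite code_and_eq; setoid_rewrite code_ex_eq.
    split; intros [H H']; split; auto.
    - destruct H' as [k' [d' [Hp H']]]; apply pr_inj in Hp as [-> ->]; exact H'.
    - exists k, d; auto. }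
  assert (Hpr : forall k d, is_form E d -> free_clause I k d -> k ∈ V om).
  { intros k d Hd H.
    assert (Hproj : forall x, pr k x ∈ I -> k ∈ V om)
      by (intros x Hx; apply HI' in Hx as [Hx _]; apply pr_cart in Hx; tauto).
    apply is_form_V in Hd.
    destruct H as [[j H]|[[x [_ H]]|[[x [y [_ [H|H]]]]|[j [x [_ [_ H]]]]]]]; eauto.
    unfold cmem, ceql in H; destruct H as [H|[H|[H|H]]]; subst d;
      apply (pr_V ord_om) in Hd as [_ Hd]; apply (pr_V ord_om) in Hd; tauto. }
  assert (HIf : forall k d, pr k d ∈ I <-> is_free E k d).
  { intros k d; split.
    - intros H; split; [apply HI' in H as [H _]; apply pr_cart in H; apply in_Form; tauto|].
      intros X HX; apply has_pair_eq; revert H; apply Hmin.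
      intros p Hp [k' [d' [Hp' H]]]; apply is_pair_eq in Hp'; subst p.
      apply has_pair_eq, HX; [apply pr_cart in Hp; apply in_Form; tauto | exact H].
    - intros [Hd H]; apply has_pair_eq, H, free_closed_iff.
      intros k' d' Hd' H'; apply HI'; split; [|exact H'].
      apply pr_cart; split; [exact (Hpr k' d' Hd' H') | apply in_Form, Hd']. }
  setoid_rewrite <- HIf; rewrite HI', pr_cart, in_Form; fold (free_clause I i c).
  split; [tauto|]; intros [Hc H]; pose proof (Hpr i c Hc H); tauto.
Qed.

End Codes.

(** * Satisfaction *)

Section Satisfaction.
Context {M : Type} {E : M -> M -> Prop} {Z : model E}.
Local Notation "x ∈ y" := (E x y) (at level 70, no associativity).
Local Notation cid := constructive_indefinite_description.

Lemma assignment_iff A e : assignment E A e <->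
  (forall p, p ∈ e -> exists i x, i ∈ om /\ p = pr i x) /\
  (forall i, i ∈ om -> exists! x, pr i x ∈ e) /\
  (forall i x, pr i x ∈ e -> x ∈ A).
Proof.
  unfold assignment, function_into, function_on, unique.
  setoid_rewrite is_omega_eq; setoid_rewrite is_pair_eq; setoid_rewrite has_pair_eq.
  split; [intros [w [-> H]]; tauto | intros H; exists om; tauto].
Qed.

Lemma assignment_mono A B e : subset E A B -> assignment E A e -> assignment E B e.
Proof. intros HAB; rewrite !assignment_iff; intuition; eauto. Qed.

Lemma value_exists e i : exists x, (exists! y, pr i y ∈ e) -> pr i x ∈ e.
Proof.
  destruct (classic (exists! y, pr i y ∈ e)) as [[y [Hy _]]|H]; [exists y; auto | exists point; tauto].
Qed.

Definition ap (e i : M) : M := proj1_sig (cid _ (value_exists e i)).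

Lemma ap_iff A e i x : assignment E A e -> i ∈ om -> pr i x ∈ e <-> x = ap e i.
Proof.
  rewrite assignment_iff; intros [_ [H _]] Hi; specialize (H i Hi).
  unfold ap; destruct (cid _ _) as [y Hy]; simpl; specialize (Hy H).
  destruct H as [z [Hz Hu]]; rewrite <- (Hu y Hy).
  split; [intros Hx; symmetry; auto | intros ->; exact Hz].
Qed.

Lemma ap_in A e i : assignment E A e -> i ∈ om -> ap e i ∈ A.
Proof.
  intros He Hi; pose proof (proj2 (ap_iff (ap e i) He Hi) eq_refl) as H.
  apply assignment_iff in He; apply (proj2 (proj2 He) _ _ H).
Qed.

Lemma assignment_ext A B e f : assignment E A e -> assignment E B f ->
  (forall i, i ∈ om -> ap e i = ap f i) -> e = f.
Proof.
  intros He Hf H; apply ext; intros p; split; intros Hp.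
  - pose proof (proj1 (assignment_iff A e) He) as [H1 _].
    destruct (H1 _ Hp) as [i [x [Hi ->]]].
    apply (ap_iff x He Hi) in Hp; apply (ap_iff x Hf Hi); rewrite <- H; assumption.
  - pose proof (proj1 (assignment_iff B f) Hf) as [H1 _].
    destruct (H1 _ Hp) as [i [x [Hi ->]]].
    apply (ap_iff x Hf Hi) in Hp; apply (ap_iff x He Hi); rewrite H; assumption.
Qed.

Lemma update_exists e i x : exists f, forall p,
  p ∈ f <-> p = pr i x \/ p ∈ e /\ forall y, p <> pr i y.
Proof.
  destruct (@separation _ _ Z (fun p => forall y, ~ is_pair E p i y)) with (a := e)
    as [g Hg]; [df|].
  exists (cup g (upr (pr i x) (pr i x))); intros p; rewrite in_cup, in_upr, Hg.
  setoid_rewrite is_pair_eq; tauto.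
Qed.

Definition upd (e i x : M) : M := proj1_sig (cid _ (update_exists e i x)).

Lemma upd_pair e i x j y : pr j y ∈ upd e i x <-> j = i /\ y = x \/ j <> i /\ pr j y ∈ e.
Proof.
  unfold upd; destruct (cid _ _) as [f Hf]; simpl; rewrite Hf; split.
  - intros [H|[H H']]; [apply pr_inj in H; tauto|].
    right; split; [|exact H]; intros ->; apply (H' y); reflexivity.
  - intros [[-> ->]|[H H']]; [auto|right; split; [exact H'|]].
    intros z Hz; apply pr_inj in Hz; tauto.
Qed.

Lemma upd_is_update e i x : is_update E (upd e i x) e i x.
Proof. intros j y; rewrite !has_pair_eq; apply upd_pair. Qed.

Lemma upd_assignment A e i x :
  assignment E A e -> i ∈ om -> x ∈ A -> assignment E A (upd e i x).
Proof.
  intros He Hi Hx; pose proof (proj1 (assignment_iff A e) He) as [H1 [H2 H3]].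
  apply assignment_iff; split; [|split].
  - intros p; unfold upd; destruct (cid _ _) as [f Hf]; simpl; rewrite Hf.
    intros [->|[Hp _]]; [exists i, x; auto | exact (H1 p Hp)].
  - intros j Hj; destruct (classic (j = i)) as [->|Hji].
    + exists x; split; [apply upd_pair; auto|]; intros y Hy; apply upd_pair in Hy.
      intuition congruence.
    + destruct (H2 j Hj) as [y [Hy Hu]]; exists y; split; [apply upd_pair; auto|].
      intros z Hz; apply upd_pair in Hz; apply Hu; tauto.
  - intros j y Hy; apply upd_pair in Hy as [[_ ->]|[_ Hy]]; eauto.
Qed.

Lemma ap_upd_eq A e i x : assignment E A e -> i ∈ om -> x ∈ A -> ap (upd e i x) i = x.
Proof.
  intros He Hi Hx; symmetry; apply (ap_iff x (upd_assignment He Hi Hx) Hi), upd_pair; auto.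
Qed.

Lemma ap_upd_neq A e i x j : assignment E A e -> i ∈ om -> x ∈ A -> j ∈ om -> j <> i ->
  ap (upd e i x) j = ap e j.
Proof.
  intros He Hi Hx Hj Hji; symmetry; apply (ap_iff _ (upd_assignment He Hi Hx) Hj), upd_pair.
  right; split; [exact Hji | apply (ap_iff _ He Hj); reflexivity].
Qed.

Lemma is_update_eq A B e e' i x : assignment E A e -> assignment E B e' -> i ∈ om -> x ∈ A ->
  is_update E e' e i x <-> e' = upd e i x.
Proof.
  intros He He' Hi Hx; split; [|intros ->; apply upd_is_update].
  intros H; apply (assignment_ext He' (upd_assignment He Hi Hx)); intros j Hj.
  apply (ap_iff _ (upd_assignment He Hi Hx) Hj), upd_pair.
  specialize (H j (ap e' j)); rewrite !has_pair_eq in H; apply H.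
  apply (ap_iff _ He' Hj); reflexivity.
Qed.

Lemma constant_assignment A x : x ∈ A ->
  exists e, assignment E A e /\ forall i y, pr i y ∈ e -> y = x.
Proof.
  intros Hx; exists (cart om (upr x x)); split.
  2: { intros i y Hy; apply pr_cart in Hy as [_ Hy]; apply in_upr in Hy; tauto. }
  apply assignment_iff; split; [|split].
  - intros p Hp; apply in_cart in Hp as [i [y [Hi [_ ->]]]]; eauto.
  - intros i Hi; exists x; split; [apply pr_cart; rewrite in_upr; auto|].
    intros y Hy; apply pr_cart in Hy; rewrite in_upr in Hy; intuition.
  - intros i y Hy; apply pr_cart in Hy as [_ Hy]; apply in_upr in Hy as [-> | ->]; exact Hx.
Qed.

Lemma assignment_set A : exists W, forall e, e ∈ W <-> assignment E A e.
Proof.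
  destruct (@separation _ _ Z (assignment E A)) with (a := pw (cart om A)) as [W HW]; [df|].
  exists W; intros e; rewrite HW; split; [tauto|]; intros He; split; [|exact He].
  apply in_pw; intros p Hp; pose proof (proj1 (assignment_iff A e) He) as [H1 [_ H2]].
  destruct (H1 p Hp) as [i [x [Hi ->]]]; apply pr_cart; eauto.
Qed.

Ltac code_eqs :=
  unfold cmem, ceql, cneg, cand, cex, code_mem, code_eql, code_neg, code_and, code_ex in *;
  repeat match goal with
  | H : tagged E _ _ _ |- _ => apply tagged_eq in H
  | H : tagged2 E _ _ _ _ |- _ => apply tagged2_eq in H
  | H : pr (num _) _ = pr (num _) _ |- _ =>
      let H' := fresh in apply tag_inj in H as [H' H]; try discriminate H'; clear H'
  | H : pr _ _ = pr _ _ |- _ => apply pr_inj in H as [? H]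
  end; subst.

(** Negation makes the Tarski clauses nonmonotone in the set of true pairs of a code and an
    assignment. Pairing each code with the set of all assignments that satisfy it makes every clause
    positive in [X], so that the least fixed point exists. *)
Definition truth_step (A W X p : M) : Prop :=
  exists c t, is_pair E p c t /\
   ((exists i j, code_mem E c i j /\ forall e, e ∈ t <-> e ∈ W /\
        exists x y, has_pair E e i x /\ has_pair E e j y /\ x ∈ y) \/
    (exists i j, code_eql E c i j /\ forall e, e ∈ t <-> e ∈ W /\
        exists x, has_pair E e i x /\ has_pair E e j x) \/
    (exists x u, code_neg E c x /\ has_pair E X x u /\ forall e, e ∈ t <-> e ∈ W /\ ~ e ∈ u) \/
    (exists x y u v, code_and E c x y /\ has_pair E X x u /\ has_pair E X y v /\
       forall e, e ∈ t <-> e ∈ W /\ e ∈ u /\ e ∈ v) \/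
    (exists i x u, code_ex E c i x /\ has_pair E X x u /\
       forall e, e ∈ t <-> e ∈ W /\
         exists y e', y ∈ A /\ e' ∈ W /\ is_update E e' e i y /\ e' ∈ u)).

Lemma truth_step_mono A W X Y p :
  subset E X Y -> truth_step A W X p -> truth_step A W Y p.
Proof.
  assert (Hhp : forall x u, subset E X Y -> has_pair E X x u -> has_pair E Y x u)
    by (intros x u H; rewrite !has_pair_eq; auto).
  intros HXY [c [t [Hp H]]]; exists c, t; split; [exact Hp|].
  destruct H as [H|[H|[[x [u H]]|[[x [y [u [v H]]]]|[i [x [u H]]]]]]].
  - left; exact H.
  - right; left; exact H.
  - right; right; left; exists x, u; intuition.
  - right; right; right; left; exists x, y, u, v; intuition.
  - right; right; right; right; exists i, x, u; intuition.
Qed.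

(** The tags of codes are distinct numerals, so a code with a given head matches a single clause of
    [truth_step]. *)
Ltac step_inversion :=
  split;
  [ intros [c [t' [Hp H]]]; apply is_pair_eq in Hp; apply pr_inj in Hp as [<- <-];
    destruct H as [[k [l [H K]]]|[[k [l [H K]]]|[[k [u [H K]]]|[[k [l [u [v [H K]]]]]|[k [l [u [H K]]]]]]]];
    code_eqs; eauto
  | intros H; eexists _, _; split; [apply is_pair_eq; reflexivity|] ].

Lemma truth_step_mem A W X i j t : truth_step A W X (pr (cmem i j) t) <->
  forall e, e ∈ t <-> e ∈ W /\ exists x y, has_pair E e i x /\ has_pair E e j y /\ x ∈ y.
Proof. step_inversion.  left; exists i, j; rewrite code_mem_eq; auto. Qed.

Lemma truth_step_eql A W X i j t : truth_step A W X (pr (ceql i j) t) <->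
  forall e, e ∈ t <-> e ∈ W /\ exists x, has_pair E e i x /\ has_pair E e j x.
Proof. step_inversion. right; left; exists i, j; rewrite code_eql_eq; auto. Qed.

Lemma truth_step_neg A W X x t : truth_step A W X (pr (cneg x) t) <->
  exists u, has_pair E X x u /\ forall e, e ∈ t <-> e ∈ W /\ ~ e ∈ u.
Proof.
  step_inversion.
  destruct H as [u H]; right; right; left; exists x, u; rewrite code_neg_eq; auto.
Qed.

Lemma truth_step_and A W X x y t : truth_step A W X (pr (cand x y) t) <->
  exists u v, has_pair E X x u /\ has_pair E X y v /\ forall e, e ∈ t <-> e ∈ W /\ e ∈ u /\ e ∈ v.
Proof.
  step_inversion.
  destruct H as [u [v H]]; right; right; right; left; exists x, y, u, v; rewrite code_and_eq; auto.
Qed.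

Lemma truth_step_ex A W X i x t : truth_step A W X (pr (cex i x) t) <->
  exists u, has_pair E X x u /\ forall e, e ∈ t <-> e ∈ W /\
    exists y e', y ∈ A /\ e' ∈ W /\ is_update E e' e i y /\ e' ∈ u.
Proof.
  step_inversion.
  destruct H as [u H]; right; right; right; right; exists i, x, u; rewrite code_ex_eq; auto.
Qed.

Lemma truth_set A : exists W T, (forall e, e ∈ W <-> assignment E A e) /\
  (forall c t, pr c t ∈ T -> is_form E c /\ truth_step A W T (pr c t)) /\
  (forall c, is_form E c -> exists t, has_pair E T c t /\ forall t', has_pair E T c t' -> t = t').
Proof.
  destruct (assignment_set A) as [W HW].
  destruct (@least_fixed_point _ _ Z (cart Form (pw W)) (truth_step A W)) as [T [HT _]];
    [unfold truth_step; df | apply truth_step_mono |].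
  exists W, T; split; [exact HW|].
  assert (Hinv : forall c t, pr c t ∈ T -> is_form E c /\ truth_step A W T (pr c t)).
  { intros c t H; apply HT in H as [H1 H2]; apply pr_cart in H1 as [H1 _].
    split; [apply in_Form|]; assumption. }
  split; [exact Hinv|].
  (* Once the clause for [c] fixes the elements of its truth set, existence and uniqueness follow at
     the same time; the induction on codes needs both together. *)
  assert (Hunique : forall c (P : M -> Prop), Df E (fun e => P (e 0)) -> is_form E c ->
    (forall t, truth_step A W T (pr c t) <-> forall e, e ∈ t <-> e ∈ W /\ P e) ->
    exists t, has_pair E T c t /\ forall t', has_pair E T c t' -> t = t').
  { intros c P HP Hc H; destruct (separation HP W) as [t Ht]; exists t.
    setoid_rewrite has_pair_eq; split.
    - apply HT; split; [|exact (proj2 (H t) Ht)]; apply pr_cart; split; [apply in_Form, Hc|].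
      apply in_pw; intros e He; apply Ht in He; tauto.
    - intros t' Ht'; apply Hinv in Ht' as [_ Ht'].
      pose proof (proj1 (H t') Ht') as Ht''.
      apply ext; intros e; rewrite Ht, Ht''; tauto. }
  apply (@form_ind _ _ _ (fun c => exists t, has_pair E T c t /\
        forall t', has_pair E T c t' -> t = t')); [df| | | | |].
  - intros i j Hi Hj; eapply Hunique;
      [| exact (form_mem Hi Hj) | intros t; apply truth_step_mem]; df.
  - intros i j Hi Hj; eapply Hunique;
      [| exact (form_eql Hi Hj) | intros t; apply truth_step_eql]; df.
  - intros x Hx [u [Hu Hu']].
    apply (@Hunique (cneg x) (fun e => ~ e ∈ u)); [df | exact (form_neg Hx) |].
    intros t; rewrite truth_step_neg; split; [|intros H; exists u; auto].
    intros [u' [H1 H2]]; rewrite (Hu' u' H1); exact H2.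
  - intros x y Hx Hy [u [Hu Hu']] [v [Hv Hv']].
    apply (@Hunique (cand x y) (fun e => e ∈ u /\ e ∈ v)); [df | exact (form_and Hx Hy) |].
    intros t; rewrite truth_step_and; split; [|intros H; exists u, v; auto].
    intros [u' [v' [H1 [H2 H3]]]]; rewrite (Hu' u' H1), (Hv' v' H2); exact H3.
  - intros i x Hi Hx [u [Hu Hu']].
    apply (@Hunique (cex i x) (fun e => exists y e', y ∈ A /\ e' ∈ W /\ is_update E e' e i y /\ e' ∈ u));
      [df | exact (form_ex Hi Hx) |].
    intros t; rewrite truth_step_ex; split; [|intros H; exists u; auto].
    intros [u' [H1 H2]]; rewrite (Hu' u' H1); exact H2.
Qed.

(** The bound on the elements of [S] serves later to place [S] inside [V b]. *)
Lemma sat_relation_exists A : exists S, sat_relation E A S /\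
  forall p, p ∈ S -> exists c e, is_form E c /\ assignment E A e /\ p = pr c e.
Proof.
  destruct (truth_set A) as [W [T [HW [Hinv HT]]]].
  destruct (@separation _ _ Z (fun p => exists c e t, is_pair E p c e /\ has_pair E T c t /\ e ∈ t))
    with (a := cart Form W) as [S HS]; [df|].
  assert (HS' : forall c e, is_form E c -> assignment E A e -> has_pair E S c e <->
    exists t, has_pair E T c t /\ e ∈ t).
  { intros c e Hc He; rewrite has_pair_eq, HS; split.
    - intros [_ [c' [e' [t [Hp H]]]]]; apply is_pair_eq, pr_inj in Hp as [<- <-]; eauto.
    - intros [t H]; split; [apply pr_cart; rewrite in_Form, HW; auto|].
      exists c, e, t; rewrite is_pair_eq; auto. }
  assert (Hv : forall c t e, is_form E c -> assignment E A e -> has_pair E T c t ->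
    has_pair E S c e <-> e ∈ t).
  { intros c t e Hc He Ht; rewrite (HS' c e Hc He); split; [|eauto].
    intros [t' [Ht' H]]; destruct (HT c Hc) as [t0 [_ H0]].
    rewrite <- (H0 t Ht), (H0 t' Ht'); exact H. }
  assert (Hf : forall c t, has_pair E T c t -> is_form E c)
    by (intros c t H; apply has_pair_eq in H; apply (Hinv _ _ H)).
  exists S; split; cycle 1.
  { intros p Hp; apply HS in Hp as [Hp _]; apply in_cart in Hp as [c [e [Hc [He ->]]]].
    exists c, e; rewrite <- HW, <- in_Form; auto. }
  intros c e Hc He; destruct (HT c Hc) as [t [Ht _]].
  pose proof (proj2 (Hinv c t (proj1 (has_pair_eq _ _ _) Ht))) as Hst.
  assert (HeW := proj2 (HW e) He).
  pose proof (Hv c t e Hc He Ht) as Hce; setoid_rewrite Hce; clear Hce; split; [|split; [|split; [|split]]].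
  - intros i j H; apply code_mem_eq in H; subst c.
    rewrite (proj1 (truth_step_mem _ _ _ _ _ _) Hst e); tauto.
  - intros i j H; apply code_eql_eq in H; subst c.
    rewrite (proj1 (truth_step_eql _ _ _ _ _ _) Hst e); tauto.
  - intros x H; apply code_neg_eq in H; subst c.
    apply truth_step_neg in Hst as [u [Hu Hst]].
    rewrite Hst, (Hv x u e (Hf x u Hu) He Hu); tauto.
  - intros x y H; apply code_and_eq in H; subst c.
    apply truth_step_and in Hst as [u [v [Hu [Hv' Hst]]]].
    rewrite Hst, (Hv x u e (Hf x u Hu) He Hu), (Hv y v e (Hf y v Hv') He Hv'); tauto.
  - intros i x H; apply code_ex_eq in H; subst c.
    apply truth_step_ex in Hst as [u [Hu Hst]].
    rewrite Hst; split; [intros [_ H] | intros H; split; [exact HeW|]];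
      destruct H as [y [e' [Hy [He' [Hup H]]]]]; exists y, e'.
    + apply HW in He'; rewrite (Hv x u e' (Hf x u Hu) He' Hu); auto.
    + rewrite (Hv x u e' (Hf x u Hu) He' Hu) in H; rewrite HW; auto.
Qed.

(** Makes [Sat] independent of the relation that witnesses it, so that the Tarski clauses pass to
    [Sat]. *)
Lemma sat_relation_unique A S S' : sat_relation E A S -> sat_relation E A S' ->
  forall c, is_form E c -> forall e, assignment E A e -> has_pair E S c e <-> has_pair E S' c e.
Proof.
  intros HS HS'.
  apply (@form_ind _ _ _ (fun c => forall e, assignment E A e ->
    has_pair E S c e <-> has_pair E S' c e)); [df| | | | |].
  - intros i j Hi Hj e He.
    rewrite (proj1 (HS _ e (form_mem Hi Hj) He) i j) by (apply code_mem_eq; reflexivity).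
    rewrite (proj1 (HS' _ e (form_mem Hi Hj) He) i j) by (apply code_mem_eq; reflexivity).
    tauto.
  - intros i j Hi Hj e He.
    destruct (HS _ e (form_eql Hi Hj) He) as [_ [H _]].
    destruct (HS' _ e (form_eql Hi Hj) He) as [_ [H' _]].
    rewrite (H i j), (H' i j) by (apply code_eql_eq; reflexivity); tauto.
  - intros x Hx IH e He.
    destruct (HS _ e (form_neg Hx) He) as [_ [_ [H _]]].
    destruct (HS' _ e (form_neg Hx) He) as [_ [_ [H' _]]].
    rewrite (H x), (H' x) by (apply code_neg_eq; reflexivity); rewrite IH; tauto.
  - intros x y Hx Hy IHx IHy e He.
    destruct (HS _ e (form_and Hx Hy) He) as [_ [_ [_ [H _]]]].
    destruct (HS' _ e (form_and Hx Hy) He) as [_ [_ [_ [H' _]]]].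
    rewrite (H x y), (H' x y) by (apply code_and_eq; reflexivity); rewrite IHx, IHy; tauto.
  - intros i x Hi Hx IH e He.
    destruct (HS _ e (form_ex Hi Hx) He) as [_ [_ [_ [_ H]]]].
    destruct (HS' _ e (form_ex Hi Hx) He) as [_ [_ [_ [_ H']]]].
    rewrite (H i x), (H' i x) by (apply code_ex_eq; reflexivity).
    apply ex_iff; intros y; apply ex_iff; intros e'.
    split; intros [H1 [H2 [H3 H4]]]; rewrite IH in *; auto.
Qed.

Lemma Sat_relation A S c e : sat_relation E A S -> is_form E c -> assignment E A e ->
  Sat E A c e <-> has_pair E S c e.
Proof.
  intros HS Hc He; split; [|exists S; auto].
  intros [S' [HS' H]]; apply (sat_relation_unique HS HS' Hc He), H.
Qed.

Lemma Sat_mem A i j e : assignment E A e -> i ∈ om -> j ∈ om ->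
  Sat E A (cmem i j) e <-> ap e i ∈ ap e j.
Proof.
  intros He Hi Hj; destruct (sat_relation_exists A) as [S [HS _]].
  rewrite (Sat_relation HS (form_mem Hi Hj) He).
  rewrite (proj1 (HS _ e (form_mem Hi Hj) He) i j) by (apply code_mem_eq; reflexivity).
  assert (Hap := fun i x Hi => ap_iff (i := i) x He Hi); setoid_rewrite has_pair_eq; split.
  - intros [x [y [Hx [Hy H]]]]; rewrite Hap in Hx, Hy by assumption; subst; exact H.
  - intros H; exists (ap e i), (ap e j); rewrite !Hap by assumption; auto.
Qed.

Lemma Sat_eql A i j e : assignment E A e -> i ∈ om -> j ∈ om ->
  Sat E A (ceql i j) e <-> ap e i = ap e j.
Proof.
  intros He Hi Hj; destruct (sat_relation_exists A) as [S [HS _]].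
  rewrite (Sat_relation HS (form_eql Hi Hj) He).
  destruct (HS _ e (form_eql Hi Hj) He) as [_ [H _]].
  rewrite (H i j) by (apply code_eql_eq; reflexivity).
  assert (Hap := fun i x Hi => ap_iff (i := i) x He Hi); setoid_rewrite has_pair_eq; split.
  - intros [x [Hx Hy]]; rewrite Hap in Hx, Hy by assumption; congruence.
  - intros H'; exists (ap e i); rewrite !Hap by assumption; auto.
Qed.

Lemma Sat_neg A x e : assignment E A e -> is_form E x ->
  Sat E A (cneg x) e <-> ~ Sat E A x e.
Proof.
  intros He Hx; destruct (sat_relation_exists A) as [S [HS _]].
  rewrite (Sat_relation HS (form_neg Hx) He), (Sat_relation HS Hx He).
  destruct (HS _ e (form_neg Hx) He) as [_ [_ [H _]]].
  apply H, code_neg_eq; reflexivity.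
Qed.

Lemma Sat_and A x y e : assignment E A e -> is_form E x -> is_form E y ->
  Sat E A (cand x y) e <-> Sat E A x e /\ Sat E A y e.
Proof.
  intros He Hx Hy; destruct (sat_relation_exists A) as [S [HS _]].
  rewrite (Sat_relation HS (form_and Hx Hy) He), (Sat_relation HS Hx He), (Sat_relation HS Hy He).
  destruct (HS _ e (form_and Hx Hy) He) as [_ [_ [_ [H _]]]].
  apply H, code_and_eq; reflexivity.
Qed.

Lemma Sat_ex A i x e : assignment E A e -> i ∈ om -> is_form E x ->
  Sat E A (cex i x) e <-> exists y, y ∈ A /\ Sat E A x (upd e i y).
Proof.
  intros He Hi Hx; destruct (sat_relation_exists A) as [S [HS _]].
  rewrite (Sat_relation HS (form_ex Hi Hx) He).
  destruct (HS _ e (form_ex Hi Hx) He) as [_ [_ [_ [_ H]]]].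
  rewrite (H i x) by (apply code_ex_eq; reflexivity).
  apply ex_iff; intros y; split.
  - intros [e' [Hy [He' [Hup Hs]]]]; split; [exact Hy|].
    apply (is_update_eq He He' Hi Hy) in Hup; subst e'.
    apply (Sat_relation HS Hx He'), Hs.
  - intros [Hy Hs]; pose proof (upd_assignment He Hi Hy) as He'.
    exists (upd e i y); rewrite (Sat_relation HS Hx He') in Hs.
    auto using upd_is_update.
Qed.

End Satisfaction.

(** ** Dependence on the variables *)

Definition agree {M : Type} (E : M -> M -> Prop) (n e e' : M) : Prop :=
  forall i, E i n -> forall x, has_pair E e i x <-> has_pair E e' i x.

Lemma Rf_agree i j k : Rf (fun N E e => agree E (e i) (e j) (e k)).
Proof. unfold agree; rf. Qed.

Lemma Rf_is_free i j : Rf (fun N E e => is_free E (e i) (e j)).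
Proof. unfold is_free, free_closed; rf. Qed.
#[local] Hint Resolve Rf_agree Rf_is_free : rf.

Section Support.
Context {M : Type} {E : M -> M -> Prop} {Z : model E}.
Local Notation "x ∈ y" := (E x y) (at level 70, no associativity).

Lemma om_max m n : m ∈ om -> n ∈ om ->
  exists k, k ∈ om /\ subset E m k /\ subset E n k.
Proof.
  intros Hm Hn; exists (cup m n); split.
  - destruct (ord_cup (ord_nat Hm) (ord_nat Hn)) as [-> | ->]; assumption.
  - split; intros z Hz; apply in_cup; auto.
Qed.

Lemma agree_ap A n e e' i : assignment E A e -> assignment E A e' -> agree E n e e' ->
  i ∈ om -> i ∈ n -> ap e i = ap e' i.
Proof.
  intros He He' H Hi Hin; apply (ap_iff _ He' Hi), has_pair_eq, (H i Hin), has_pair_eq.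
  apply (ap_iff _ He Hi); reflexivity.
Qed.

Lemma agree_sym n e e' : agree E n e e' -> agree E n e' e.
Proof. intros H i Hi x; symmetry; apply H, Hi. Qed.

Lemma agree_sub m n e e' : subset E m n -> agree E n e e' -> agree E m e e'.
Proof. intros Hmn H i Hi; apply H, Hmn, Hi. Qed.

Lemma agree_upd n e e' i x : agree E n e e' -> agree E n (upd e i x) (upd e' i x).
Proof.
  intros H j Hj y; specialize (H j Hj y); rewrite !has_pair_eq in *; rewrite !upd_pair, H; tauto.
Qed.

(** The bound [n] is a number of the model, found by induction inside it, so nonstandard formulas
    are covered. It allows an assignment to be replaced by a part that is an element of [V_k], and
    it makes lexicographic minima possible. *)
Lemma finite_support c : is_form E c -> exists n, n ∈ om /\
  forall A e e', assignment E A e -> assignment E A e' -> agree E n e e' ->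
  Sat E A c e <-> Sat E A c e'.
Proof.
  setoid_rewrite <- is_nat_eq.
  assert (Hatom : forall i j, i ∈ om -> j ∈ om -> exists n, is_nat E n /\
    forall A e e', assignment E A e -> assignment E A e' -> agree E n e e' ->
    ap e i = ap e' i /\ ap e j = ap e' j).
  { intros i j Hi Hj; destruct (om_max (om_suc Hi) (om_suc Hj)) as [n [Hn [Hin Hjn]]].
    exists n; rewrite is_nat_eq; split; [exact Hn|].
    intros A e e' He He' H; split.
    - exact (agree_ap He He' H Hi (Hin _ (suc_self i))).
    - exact (agree_ap He He' H Hj (Hjn _ (suc_self j))). }
  apply (@form_ind _ _ _ (fun c => exists n, is_nat E n /\
  forall A e e', assignment E A e -> assignment E A e' -> agree E n e e' ->
  Sat E A c e <-> Sat E A c e')); [df| | | | |].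
  - intros i j Hi Hj; destruct (Hatom i j Hi Hj) as [n [Hn H]]; exists n; split; [exact Hn|].
    intros A e e' He He' Hag; destruct (H A e e' He He' Hag) as [H1 H2].
    rewrite (Sat_mem He Hi Hj), (Sat_mem He' Hi Hj), H1, H2; tauto.
  - intros i j Hi Hj; destruct (Hatom i j Hi Hj) as [n [Hn H]]; exists n; split; [exact Hn|].
    intros A e e' He He' Hag; destruct (H A e e' He He' Hag) as [H1 H2].
    rewrite (Sat_eql He Hi Hj), (Sat_eql He' Hi Hj), H1, H2; tauto.
  - intros x Hx [n [Hn IH]]; exists n; split; [exact Hn|].
    intros A e e' He He' Hag.
    rewrite (Sat_neg He Hx), (Sat_neg He' Hx), (IH A e e' He He' Hag); tauto.
  - intros x y Hx Hy [m [Hm IHx]] [n [Hn IHy]]; rewrite is_nat_eq in Hm, Hn.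
    destruct (om_max Hm Hn) as [k [Hk [Hmk Hnk]]].
    exists k; rewrite is_nat_eq; split; [exact Hk|].
    intros A e e' He He' Hag.
    rewrite (Sat_and He Hx Hy), (Sat_and He' Hx Hy).
    rewrite (IHx A e e' He He' (agree_sub Hmk Hag)), (IHy A e e' He He' (agree_sub Hnk Hag)).
    tauto.
  - intros i x Hi Hx [n [Hn IH]]; exists n; split; [exact Hn|].
    intros A e e' He He' Hag.
    rewrite (Sat_ex He Hi Hx), (Sat_ex He' Hi Hx); apply ex_iff; intros y.
    split; intros [Hy H]; (split; [exact Hy|]); revert H;
      apply IH; auto using upd_assignment, agree_upd, agree_sym.
Qed.

Lemma Sat_not_free A i c : is_form E c -> i ∈ om -> ~ is_free E i c ->
  forall e e', assignment E A e -> assignment E A e' ->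
  (forall j x, j <> i -> has_pair E e j x <-> has_pair E e' j x) ->
  Sat E A c e <-> Sat E A c e'.
Proof.
  intros Hc Hi; revert c Hc.
  apply (@form_ind _ _ _ (fun c => ~ is_free E i c ->
    forall e e', assignment E A e -> assignment E A e' ->
    (forall j x, j <> i -> has_pair E e j x <-> has_pair E e' j x) ->
    Sat E A c e <-> Sat E A c e')); [df| | | | |].
  - intros j k Hj Hk Hf e e' He He' H.
    assert (Hap : forall l, l ∈ om -> l = j \/ l = k -> ap e l = ap e' l).
    { intros l Hl Hlj; apply (ap_iff _ He' Hl), has_pair_eq, H, has_pair_eq, (ap_iff _ He Hl);
        [|reflexivity].
      intros ->; apply Hf, is_free_spec; split; [exact (form_mem Hj Hk)|].
      left; destruct Hlj as [-> | ->]; eauto. }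
    rewrite (Sat_mem He Hj Hk), (Sat_mem He' Hj Hk), (Hap j), (Hap k); tauto.
  - intros j k Hj Hk Hf e e' He He' H.
    assert (Hap : forall l, l ∈ om -> l = j \/ l = k -> ap e l = ap e' l).
    { intros l Hl Hlj; apply (ap_iff _ He' Hl), has_pair_eq, H, has_pair_eq, (ap_iff _ He Hl);
        [|reflexivity].
      intros ->; apply Hf, is_free_spec; split; [exact (form_eql Hj Hk)|].
      left; destruct Hlj as [-> | ->]; [exists k | exists j]; auto. }
    rewrite (Sat_eql He Hj Hk), (Sat_eql He' Hj Hk), (Hap j), (Hap k); tauto.
  - intros x Hx IH Hf e e' He He' H.
    rewrite (Sat_neg He Hx), (Sat_neg He' Hx), (IH) with (e' := e'); auto; try tauto.
    intros Hfx; apply Hf, is_free_spec; split; [exact (form_neg Hx)|]; eauto.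
  - intros x y Hx Hy IHx IHy Hf e e' He He' H.
    rewrite (Sat_and He Hx Hy), (Sat_and He' Hx Hy), IHx with (e' := e'), IHy with (e' := e');
      auto; try tauto; intros Hfx; apply Hf, is_free_spec;
      (split; [exact (form_and Hx Hy)|]); right; right; left; exists x, y; auto.
  - intros j x Hj Hx IH Hf e e' He He' H.
    rewrite (Sat_ex He Hj Hx), (Sat_ex He' Hj Hx); apply ex_iff; intros y.
    destruct (classic (j = i)) as [->|Hji].
    (* The quantifier overwrites the only variable at which the two assignments can differ. *)
    + enough (Hup : y ∈ A -> upd e i y = upd e' i y)
        by (split; intros [Hy HS]; rewrite Hup in *; auto).
      intros Hy; apply ext; intros p; split; intros Hp.
      * pose proof (proj1 (assignment_iff A _) (upd_assignment He Hi Hy)) as [H1 _].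
        destruct (H1 p Hp) as [k [z [Hk ->]]]; apply upd_pair in Hp; apply upd_pair.
        specialize (H k z); rewrite !has_pair_eq in H; tauto.
      * pose proof (proj1 (assignment_iff A _) (upd_assignment He' Hi Hy)) as [H1 _].
        destruct (H1 p Hp) as [k [z [Hk ->]]]; apply upd_pair in Hp; apply upd_pair.
        specialize (H k z); rewrite !has_pair_eq in H; tauto.
    + assert (Hfx : ~ is_free E i x).
      { intros Hfx; apply Hf, is_free_spec; split; [exact (form_ex Hj Hx)|].
        right; right; right; exists j, x; auto. }
      enough (y ∈ A -> Sat E A x (upd e j y) <-> Sat E A x (upd e' j y)) by tauto.
      intros Hy; apply (IH Hfx); auto using upd_assignment.
      intros k z Hk; specialize (H k z Hk); rewrite !has_pair_eq in *; rewrite !upd_pair; tauto.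
Qed.

End Support.

(** ** Standard formulas *)

(* Truth in the substructure [D] without dependent pairs. *)
Fixpoint rsat {M : Type} (E : M -> M -> Prop) (D : M -> Prop) (e : nat -> M) (p : fml) : Prop :=
  match p with
  | FMem i j => E (e i) (e j)
  | FEql i j => e i = e j
  | FNeg p => ~ rsat E D e p
  | FAnd p q => rsat E D e p /\ rsat E D e q
  | FEx i p => exists x, D x /\ rsat E D (update e i x) p
  end.

Fixpoint fbound (p : fml) : nat :=
  match p with
  | FMem i j | FEql i j => S (i + j)
  | FNeg p => fbound p
  | FAnd p q => fbound p + fbound q
  | FEx i p => fbound p
  end.

Section Standard.
Context {M : Type} {E : M -> M -> Prop}.
Local Notation "x ∈ y" := (E x y) (at level 70, no associativity).

Lemma rsat_ext (D : M -> Prop) p : forall e e',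
  (forall n, free n p -> e n = e' n) -> rsat E D e p <-> rsat E D e' p.
Proof.
  induction p; intros e e' H; simpl in *.
  - rewrite !H by auto; tauto.
  - rewrite !H by auto; tauto.
  - rewrite (IHp e e'); [tauto | auto].
  - rewrite (IHp1 e e'), (IHp2 e e'); [tauto | |]; auto.
  - apply ex_iff; intros x; rewrite (IHp (update e i x) (update e' i x)); [tauto|].
    intros n Hn; unfold update; destruct (Nat.eqb_spec n i); auto.
Qed.

Lemma free_fbound p n : free n p -> n < fbound p.
Proof.
  induction p; simpl; intros H; try lia; auto.
  - destruct H as [H|H]; [apply IHp1 in H | apply IHp2 in H]; lia.
  - apply IHp, H.
Qed.

Lemma sat_restr (D : M -> Prop) p : forall e : nat -> {x | D x},
  sat (restr E D) e p <-> rsat E D (fun i => proj1_sig (e i)) p.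
Proof.
  induction p; intros e; simpl.
  - reflexivity.
  - split; [intros ->; reflexivity|]; intros H; apply eq_sig_hprop; [|exact H].
    intros; apply proof_irrelevance.
  - rewrite IHp; tauto.
  - rewrite IHp1, IHp2; tauto.
  - assert (Hup : forall x, (fun k => proj1_sig (update e i x k)) =
      update (fun k => proj1_sig (e k)) i (proj1_sig x)).
    { intros x; extensionality k; unfold update; destruct (Nat.eqb k i); reflexivity. }
    split.
    + intros [x Hx]; exists (proj1_sig x); split; [apply proj2_sig|].
      rewrite <- Hup; apply IHp, Hx.
    + intros [x [Hx H]]; exists (exist _ x Hx); apply IHp; rewrite Hup; exact H.
Qed.

Context {Z : model E}.

Fixpoint code (p : fml) : M :=
  match p with
  | FMem i j => cmem (num i) (num j)
  | FEql i j => ceql (num i) (num j)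
  | FNeg p => cneg (code p)
  | FAnd p q => cand (code p) (code q)
  | FEx i p => cex (num i) (code p)
  end.

Lemma code_form p : is_form E (code p).
Proof.
  induction p; simpl.
  - exact (form_mem (num_om i) (num_om j)).
  - exact (form_eql (num_om i) (num_om j)).
  - exact (form_neg IHp).
  - exact (form_and IHp1 IHp2).
  - exact (form_ex (num_om i) IHp).
Qed.

Lemma code_free p : forall i, is_free E i (code p) -> exists k, free k p /\ i = num k.
Proof.
  induction p; intros k H; apply is_free_spec in H as [_ H]; simpl in *;
    destruct H as [[l H]|[[x [H H']]|[[x [y [H H']]]|[l [x [H [Hl H']]]]]]];
    try (destruct H as [H|[H|[H|H]]]); unfold cmem, ceql, cneg, cand, cex in H;
    apply tag_inj in H as [Hn H]; try discriminate Hn.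
  - apply pr_inj in H as [<- _]; eauto.
  - apply pr_inj in H as [_ <-]; eauto.
  - apply pr_inj in H as [<- _]; eauto.
  - apply pr_inj in H as [_ <-]; eauto.
  - subst x; auto.
  - apply pr_inj in H as [<- <-]; destruct H' as [H'|H'];
      [destruct (IHp1 _ H') as [m [Hm ->]] | destruct (IHp2 _ H') as [m [Hm ->]]]; eauto.
  - apply pr_inj in H as [<- <-]; destruct (IHp _ H') as [m [Hm ->]].
    exists m; split; [split; [|exact Hm]|reflexivity]; congruence.
Qed.

Lemma code_form2 p : fml2 p -> is_form2 E (code p).
Proof.
  intros Hp; split; [apply code_form|]; intros i Hi.
  destruct (code_free Hi) as [k [Hk ->]]; rewrite !is_numeral_eq.
  destruct (Hp k Hk) as [-> | ->]; auto.
Qed.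

Lemma ap_upd_num A e i x : assignment E A e -> x ∈ A ->
  (fun k => ap (upd e (num i) x) (num k)) = update (fun k => ap e (num k)) i x.
Proof.
  intros He Hx; extensionality k; unfold update; destruct (Nat.eqb_spec k i) as [->|Hk].
  - exact (ap_upd_eq He (num_om i) Hx).
  - apply (ap_upd_neq He (num_om i) Hx (num_om k)); intros H; exact (Hk (num_inj H)).
Qed.

Lemma Sat_code A p : forall e, assignment E A e ->
  Sat E A (code p) e <-> rsat E (fun x => x ∈ A) (fun k => ap e (num k)) p.
Proof.
  induction p; intros e He; simpl.
  - apply (Sat_mem He (num_om i) (num_om j)).
  - apply (Sat_eql He (num_om i) (num_om j)).
  - rewrite (Sat_neg He (code_form p)), IHp; [tauto | exact He].
  - rewrite (Sat_and He (code_form p1) (code_form p2)), IHp1, IHp2; [tauto | exact He | exact He].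
  - rewrite (Sat_ex He (num_om i) (code_form p)); apply ex_iff; intros x.
    split; intros [Hx H]; (split; [exact Hx|]).
    + rewrite <- (ap_upd_num i He Hx); exact (proj1 (IHp _ (upd_assignment He (num_om i) Hx)) H).
    + apply (IHp _ (upd_assignment He (num_om i) Hx)).
      rewrite (ap_upd_num i He Hx); exact H.
Qed.

(** A sequence indexed by the numbers of the metatheory need not be a set of the model, so only
    finitely many values are matched. *)
Lemma internal_assignment A (a : nat -> M) n : (forall k, a k ∈ A) ->
  exists e, assignment E A e /\ forall k, k < n -> ap e (num k) = a k.
Proof.
  intros Ha; induction n as [|n [e [He IH]]].
  - destruct (constant_assignment (Ha 0)) as [e [He _]]; exists e; split; [exact He | lia].
  - exists (upd e (num n) (a n)); split; [exact (upd_assignment He (num_om n) (Ha n))|].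
    intros k Hk; pose proof (f_equal (fun f => f k) (ap_upd_num n He (Ha n))) as H.
    cbv beta in H; rewrite H; unfold update; destruct (Nat.eqb_spec k n) as [->|Hkn]; [reflexivity|].
    apply IH; lia.
Qed.

Lemma Sat2_code A p x y : fml2 p -> x ∈ A -> y ∈ A ->
  Sat2 E A (code p) x y <->
  rsat E (fun z => z ∈ A) (fun k => match k with 0 => x | _ => y end) p.
Proof.
  intros Hp Hx Hy.
  pose (a := fun k => match k with 0 => x | _ => y end); fold a.
  assert (HaA : forall k, a k ∈ A) by (intros [|k]; assumption).
  assert (Hext : forall e, ap e (num 0) = x -> ap e (num 1) = y ->
    rsat E (fun z => z ∈ A) (fun k => ap e (num k)) p <-> rsat E (fun z => z ∈ A) a p).
  { intros e H0 H1; apply rsat_ext; intros k Hk; destruct (Hp k Hk) as [-> | ->]; assumption. }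
  unfold Sat2; setoid_rewrite is_numeral_eq; setoid_rewrite has_pair_eq; split.
  - intros [e [z [o [He [-> [-> [H0 [H1 H]]]]]]]]; apply (Sat_code p He) in H.
    apply (ap_iff _ He (num_om _)) in H0, H1; apply (Hext e); auto.
  - intros H; destruct (internal_assignment 2 HaA) as [e [He Hea]].
    exists e, (num 0), (num 1); rewrite !(ap_iff _ He (num_om _)), !Hea by lia.
    repeat split; auto; apply (Sat_code p He), Hext; auto; apply (Hea 0) || apply (Hea 1); lia.
Qed.

End Standard.

(** * Absoluteness *)

Definition transitive_class {M : Type} (E : M -> M -> Prop) (D : M -> Prop) : Prop :=
  forall x y, D x -> E y x -> D y.
Existing Class transitive_class.

Section TransitiveClass.
Context {M : Type} {E : M -> M -> Prop} {Z : model E}.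
Local Notation "x ∈ y" := (E x y) (at level 70, no associativity).
Local Notation "$ x" := (proj1_sig x) (at level 1, format "$ x").

Context {D : M -> Prop} {HD : transitive_class E D}.
Local Notation N := {x : M | D x}.
Local Notation E' := (restr E D).

Lemma down (x : N) z : z ∈ $x -> exists z' : N, $z' = z.
Proof. intros H; exists (exist _ z (HD (proj2_sig x) H)); reflexivity. Qed.

Lemma lift z : D z -> exists z' : N, $z' = z.
Proof. intros H; exists (exist _ z H); reflexivity. Qed.

Lemma proj_inj (x y : N) : $x = $y -> x = y.
Proof. apply eq_sig_hprop; intros; apply proof_irrelevance. Qed.

Lemma abs_subset (x y : N) : subset E' x y <-> subset E $x $y.
Proof.
  split; intros H z Hz; [destruct (down Hz) as [z' <-]; apply (H z' Hz) | apply (H $z Hz)].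
Qed.

Lemma abs_empty (x : N) : empty E' x <-> $x = emp.
Proof.
  rewrite <- empty_eq.
  split; intros H z Hz; [destruct (down Hz) as [z' <-]; apply (H z' Hz) | apply (H $z Hz)].
Qed.

Lemma abs_upair (p x y : N) : is_upair E' p x y <-> $p = upr $x $y.
Proof.
  rewrite <- is_upair_eq; split; intros H z.
  - split.
    + intros Hz; destruct (down Hz) as [z' <-]; apply H in Hz as [-> | ->]; auto.
    + intros [-> | ->]; apply H; auto.
  - unfold restr at 1; rewrite (H $z); split; intros [Hz|Hz]; subst; auto using proj_inj.
Qed.

Lemma abs_succ (y x : N) : is_succ E' y x <-> $y = suc $x.
Proof.
  rewrite <- is_succ_eq; split; intros H z.
  - split.
    + intros Hz; destruct (down Hz) as [z' <-]; apply H in Hz as [Hz| ->]; auto.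
    + intros [Hz| ->]; [destruct (down Hz) as [z' <-]|]; apply H; auto.
  - unfold restr; rewrite (H $z); split; intros [Hz|Hz]; subst; auto using proj_inj.
Qed.

Lemma abs_pair (p x y : N) : is_pair E' p x y <-> $p = pr $x $y.
Proof.
  unfold is_pair; setoid_rewrite abs_upair; split.
  - intros [s [t [Hs [Ht Hp]]]]; unfold pr; congruence.
  - intros Hp.
    assert (Hs : upr $x $x ∈ $p) by (rewrite Hp; apply in_upr; auto).
    assert (Ht : upr $x $y ∈ $p) by (rewrite Hp; apply in_upr; auto).
    destruct (down Hs) as [s Hs'], (down Ht) as [t Ht']; exists s, t.
    rewrite Hs', Ht'; auto.
Qed.

Lemma abs_has_pair (f x y : N) : has_pair E' f x y <-> pr $x $y ∈ $f.
Proof.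
  unfold has_pair; setoid_rewrite abs_pair; split.
  - intros [p [Hp H]]; rewrite <- Hp; exact H.
  - intros H; destruct (down H) as [p Hp]; exists p; split; [exact Hp|].
    unfold restr; rewrite Hp; exact H.
Qed.

Lemma pair_down (f : N) x y : pr x y ∈ $f -> exists x' y' : N, $x' = x /\ $y' = y.
Proof.
  intros H; destruct (down H) as [p Hp].
  assert (Hxy : upr x y ∈ $p) by (rewrite Hp; apply in_upr; auto).
  destruct (down Hxy) as [q Hq].
  assert (Hx : x ∈ $q) by (rewrite Hq; apply in_upr; auto).
  assert (Hy : y ∈ $q) by (rewrite Hq; apply in_upr; auto).
  destruct (down Hx) as [x' Hx'], (down Hy) as [y' Hy']; eauto.
Qed.

Lemma abs_function_on (f a : N) : function_on E' f a <-> function_on E $f $a.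
Proof.
  unfold function_on, unique.
  setoid_rewrite abs_has_pair; setoid_rewrite abs_pair;
    setoid_rewrite has_pair_eq; setoid_rewrite is_pair_eq.
  split; intros [H1 H2]; split.
  - intros p Hp; destruct (down Hp) as [p' <-]; destruct (H1 p' Hp) as [x [y [Hx Hy]]]; eauto.
  - intros x Hx; destruct (down Hx) as [x' <-]; destruct (H2 x' Hx) as [y [Hy Hu]].
    exists $y; split; [exact Hy|]; intros z Hz; destruct (pair_down Hz) as [_ [z' [_ <-]]].
    rewrite (Hu z' Hz); reflexivity.
  - intros p Hp; destruct (H1 $p Hp) as [x [y [Hx Hy]]].
    unfold restr in Hp; rewrite Hy in Hp; destruct (pair_down Hp) as [x' [y' [<- <-]]].
    exists x', y'; auto.
  - intros x Hx; destruct (H2 $x Hx) as [y [Hy Hu]].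
    destruct (pair_down Hy) as [_ [y' [_ <-]]]; exists y'; split; [exact Hy|].
    intros z Hz; apply proj_inj, Hu, Hz.
Qed.

Lemma abs_numeral n : forall x : N, is_numeral E' n x <-> $x = num n.
Proof.
  induction n as [|n IHn]; intros x; cbn [is_numeral num]; [apply abs_empty|].
  setoid_rewrite IHn; setoid_rewrite abs_succ; split.
  - intros [y [<- Hx]]; exact Hx.
  - intros Hx; assert (H : num n ∈ $x) by (rewrite Hx; apply suc_self).
    destruct (down H) as [y Hy]; exists y; rewrite Hy; auto.
Qed.

Lemma abs_inductive (x : N) : inductive E' x <-> inductive E $x.
Proof.
  unfold inductive.
  setoid_rewrite abs_empty; setoid_rewrite abs_succ;
    setoid_rewrite empty_eq; setoid_rewrite is_succ_eq.
  split; intros [[z [Hz H1]] H2]; (split; [|intros y Hy]).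
  - exists $z; auto.
  - destruct (down Hy) as [y' <-]; destruct (H2 y' Hy) as [s [Hs Hs']]; eauto.
  - destruct (down H1) as [z' <-]; eauto.
  - destruct (H2 $y Hy) as [s [Hs Hs']]; destruct (down Hs') as [s' <-]; eauto.
Qed.

Lemma abs_ordinal (a : N) : ordinal E' a <-> ordinal E $a.
Proof.
  split; intros [H1 [H2 H3]].
  - assert (Htr : transitive E $a).
    { intros y Hy z Hz; destruct (down Hy) as [y' <-], (down Hz) as [z' <-].
      exact (H1 y' Hy z' Hz). }
    split; [exact Htr | split].
    + intros x y Hx Hy; destruct (down Hx) as [x' <-], (down Hy) as [y' <-].
      destruct (H2 x' y' Hx Hy) as [H|[-> |H]]; auto.
    (* [u] need not belong to [D], so this clause comes from foundation in the universe. *)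
    + intros u Hu Hne; destruct (foundation (x := u)) as [m [Hm Hmin]].
      * apply NNPP; intros Hn; apply Hne; intros z Hz; eauto.
      * exists m; split; [exact Hm|]; intros x Hx Hxm; exact (Hmin x Hxm Hx).
  - split; [|split].
    + intros y Hy z Hz; exact (H1 $y Hy $z Hz).
    + intros x y Hx Hy; destruct (H2 $x $y Hx Hy) as [H|[H|H]]; auto using proj_inj.
    + intros u Hu Hne; destruct (H3 $u) as [m [Hm Hmin]].
      * apply abs_subset, Hu.
      * rewrite empty_eq, <- abs_empty; exact Hne.
      * destruct (down Hm) as [m' <-]; exists m'; split; [exact Hm|].
        intros x Hx; exact (Hmin $x Hx).
Qed.

Lemma abs_bijection (f a k : N) : bijection E' f a k -> bijection E $f $a $k.
Proof.
  unfold bijection, function_into; setoid_rewrite abs_has_pair; setoid_rewrite has_pair_eq.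
  intros [[H1 H2] [H3 H4]]; split; [split|split].
  - apply abs_function_on, H1.
  - intros x y H; destruct (pair_down H) as [x' [y' [<- <-]]]; exact (H2 x' y' H).
  - intros x x' y Hx Hx'; destruct (pair_down Hx) as [u [v [<- <-]]].
    destruct (pair_down Hx') as [u' [_ [<- _]]]; rewrite (H3 u u' v Hx Hx'); reflexivity.
  - intros y Hy; destruct (down Hy) as [y' <-]; destruct (H4 y' Hy) as [x Hx]; eauto.
Qed.

End TransitiveClass.

(** * Absoluteness for a level [V b] with [b] a limit above omega *)

Section Absoluteness.
Context {M : Type} {E : M -> M -> Prop} {Z : model E}.
Local Notation "x ∈ y" := (E x y) (at level 70, no associativity).

Lemma V_transitive_class b : ordinal E b -> transitive_class E (fun x => x ∈ V b).
Proof. intros Hb x y Hx Hy; exact (V_trans Hb Hx Hy). Qed.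

Lemma lift_V b z : z ∈ V b -> exists z' : {x | x ∈ V b}, proj1_sig z' = z.
Proof. exact (@lift M (fun x => x ∈ V b) z). Qed.

Variable b : M.
Hypothesis Hb : ordinal E b.
Hypothesis b_limit : limit b.
Hypothesis om_b : om ∈ b.

Local Notation N := {x : M | x ∈ V b}.
Local Notation E' := (restr E (fun x => x ∈ V b)).
Local Notation "$ x" := (proj1_sig x) (at level 1, format "$ x").
#[local] Instance V_b_transitive : transitive_class E (fun x => x ∈ V b) := V_transitive_class Hb.

Lemma om_N : exists w : N, $w = om.
Proof. apply lift_V, (V_ord Hb om_b). Qed.

Lemma abs_omega (w : N) : is_omega E' w <-> $w = om.
Proof.
  unfold is_omega; setoid_rewrite abs_inductive; setoid_rewrite abs_subset.
  destruct om_N as [o Ho]; split.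
  - intros [H1 H2]; apply subset_antisym; [|exact (proj2 om_omega _ H1)].
    rewrite <- Ho; apply H2; rewrite Ho; apply om_omega.
  - intros ->; split; [apply om_omega|]; intros x; apply om_omega.
Qed.

Lemma abs_nat (n : N) : is_nat E' n <-> $n ∈ om.
Proof.
  unfold is_nat; setoid_rewrite abs_omega; split.
  - intros [w [Hw Hn]]; rewrite <- Hw; exact Hn.
  - intros H; destruct om_N as [o Ho]; exists o; split; [exact Ho|].
    unfold restr; rewrite Ho; exact H.
Qed.

Lemma om_V i : i ∈ om -> i ∈ V b.
Proof. intros Hi; exact (V_ord Hb (limit_nat b_limit Hi)). Qed.

Lemma abs_tagged n (c x : N) : tagged E' n c x <-> $c = pr (num n) $x.
Proof.
  unfold tagged; setoid_rewrite abs_numeral; setoid_rewrite abs_pair; split.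
  - intros [t [<- Hc]]; exact Hc.
  - intros Hc; destruct (lift_V (om_V (num_om n))) as [t Ht]; exists t; rewrite Ht; auto.
Qed.

Lemma abs_tagged2 n (c x y : N) : tagged2 E' n c x y <-> $c = pr (num n) (pr $x $y).
Proof.
  unfold tagged2; setoid_rewrite abs_tagged; setoid_rewrite abs_pair; split.
  - intros [t [<- Hc]]; exact Hc.
  - intros Hc.
    destruct (lift_V (limit_pr b_limit (proj2_sig x) (proj2_sig y))) as [t Ht].
    exists t; rewrite Ht; auto.
Qed.

Lemma abs_code_mem (c i j : N) : code_mem E' c i j <-> $c = cmem $i $j.
Proof. apply abs_tagged2. Qed.
Lemma abs_code_eql (c i j : N) : code_eql E' c i j <-> $c = ceql $i $j.
Proof. apply abs_tagged2. Qed.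
Lemma abs_code_neg (c x : N) : code_neg E' c x <-> $c = cneg $x.
Proof. apply abs_tagged. Qed.
Lemma abs_code_and (c x y : N) : code_and E' c x y <-> $c = cand $x $y.
Proof. apply abs_tagged2. Qed.
Lemma abs_code_ex (c i x : N) : code_ex E' c i x <-> $c = cex $i $x.
Proof. apply abs_tagged2. Qed.

Lemma abs_form_closed (X : N) : form_closed E' X <-> form_closed E $X.
Proof.
  rewrite form_closed_iff; unfold form_closed.
  setoid_rewrite abs_nat; setoid_rewrite abs_code_mem; setoid_rewrite abs_code_eql;
  setoid_rewrite abs_code_neg; setoid_rewrite abs_code_and; setoid_rewrite abs_code_ex.
  assert (Hpr : forall n x y, x ∈ V b -> y ∈ V b -> exists c : N, $c = pr (num n) (pr x y)).
  { intros n x y Hx Hy; apply lift_V; repeat apply (limit_pr b_limit); auto.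
    exact (om_V (num_om n)). }
  split.
  - intros H; split; [|split; [|split]].
    + intros i j Hi Hj; destruct (lift_V (om_V Hi)) as [i' <-], (lift_V (om_V Hj)) as [j' <-].
      destruct (Hpr 0 _ _ (proj2_sig i') (proj2_sig j')) as [c Hc].
      destruct (Hpr 1 _ _ (proj2_sig i') (proj2_sig j')) as [d Hd].
      unfold cmem, ceql; rewrite <- Hc, <- Hd.
      split; apply H; left; exists i', j'; auto.
    + intros x Hx; destruct (down Hx) as [x' <-].
      destruct (lift_V (limit_pr b_limit (om_V (num_om 2)) (proj2_sig x'))) as [c Hc].
      unfold cneg; rewrite <- Hc; apply H; right; left; exists x'; auto.
    + intros x y Hx Hy; destruct (down Hx) as [x' <-], (down Hy) as [y' <-].
      destruct (Hpr 3 _ _ (proj2_sig x') (proj2_sig y')) as [c Hc].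
      unfold cand; rewrite <- Hc; apply H; right; right; left; exists x', y'; auto.
    + intros i x Hi Hx; destruct (lift_V (om_V Hi)) as [i' <-], (down Hx) as [x' <-].
      destruct (Hpr 4 _ _ (proj2_sig i') (proj2_sig x')) as [c Hc].
      unfold cex; rewrite <- Hc; apply H; right; right; right; exists i', x'; auto.
  - intros [H1 [H2 [H3 H4]]] c H; unfold restr in *.
    destruct H as [[i [j [Hi [Hj [-> | ->]]]]]|[[x [Hx ->]]|
      [[x [y [Hx [Hy ->]]]]|[i [x [Hi [Hx ->]]]]]]]; try apply H1; auto.
Qed.

Lemma Form_V : Form ∈ V b.
Proof.
  apply in_V; [exact Hb|]; exists om; split; [exact om_b|].
  intros c Hc; apply is_form_V, in_Form, Hc.
Qed.

Lemma form_V c : is_form E c -> c ∈ V b.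
Proof. intros Hc; apply in_Form in Hc; exact (V_trans Hb Form_V Hc). Qed.

Lemma abs_form (c : N) : is_form E' c <-> is_form E $c.
Proof.
  unfold is_form at 1; setoid_rewrite abs_form_closed; split.
  - intros H; destruct (lift_V Form_V) as [F HF]; apply in_Form; rewrite <- HF.
    apply H; rewrite HF; apply Form_closed.
  - intros H X HX; exact (H $X HX).
Qed.

Lemma V_V a : a ∈ b -> V a ∈ V b.
Proof. intros Ha; apply in_V; [exact Hb|]; exists a; split; [exact Ha | intros z; auto]. Qed.

Lemma abs_V (a v : N) : is_V E' a v <-> is_V E $a $v.
Proof.
  unfold is_V; rewrite abs_ordinal.
  setoid_rewrite abs_succ; setoid_rewrite abs_function_on;
    setoid_rewrite abs_has_pair; setoid_rewrite abs_subset.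
  setoid_rewrite is_succ_eq; setoid_rewrite has_pair_eq.
  split; intros [Ha [f [d [Hd [Hf [Hr Hv]]]]]]; (split; [exact Ha|]).
  - exists $f, $d; split; [exact Hd | split; [exact Hf | split; [|exact Hv]]].
    intros c w Hcw z; destruct (pair_down Hcw) as [c' [w' [<- <-]]].
    split.
    + intros Hz; destruct (down Hz) as [z' <-]; apply (Hr c' w' Hcw z') in Hz.
      destruct Hz as [x [u [Hx Hu]]]; exists $x, $u; auto.
    + intros [x [u [Hx [Hu Hz]]]]; destruct (pair_down Hu) as [x' [u' [<- <-]]].
      destruct (lift_V (V_subset Hb (proj2_sig u') Hz)) as [z' <-].
      apply (Hr c' w' Hcw z'); exists x', u'; auto.
  - subst d; assert (Hab : $a ∈ b) by (apply (V_ord_iff Hb Ha), (proj2_sig a)).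
    assert (Hsb : suc $a ∈ b) by (apply b_limit, Hab).
    (* The witness has to be found in [V b]. The values of [f] are levels up to [V $a], all of them
       elements of [V (suc $a)], so [f] consists of pairs from two elements of [V b]. *)
    assert (Hfs : forall p, p ∈ f -> exists x y, x ∈ suc $a /\ y ∈ V (suc $a) /\ p = pr x y).
    { intros p Hp; pose proof (proj1 Hf p Hp) as [x [y [Hx Hy]]].
      apply is_pair_eq in Hy; exists x, y; split; [exact Hx | split; [|exact Hy]].
      assert (Hxy : is_V E x y).
      { apply (stage_value (T := fun u z => subset E z u) (ord_suc Ha) Hf).
        - unfold recursive; setoid_rewrite has_pair_eq; exact Hr.
        - apply has_pair_eq; rewrite <- Hy; exact Hp. }
      apply is_V_eq in Hxy as [_ ->]; apply in_V; [exact (ord_suc Ha)|].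
      exists x; split; [exact Hx | intros z; auto]. }
    destruct (lift_V (limit_cart b_limit (V_ord Hb Hsb) (V_V Hsb) Hfs)) as [f' <-].
    destruct (lift_V (V_ord Hb Hsb)) as [d Hd].
    exists f', d; rewrite Hd; split; [reflexivity | split; [exact Hf | split; [|exact Hv]]].
    intros c w Hcw z; unfold restr at 1; rewrite (Hr $c $w Hcw $z); split.
    + intros [x [u [Hx [Hu Hz]]]]; destruct (pair_down Hu) as [x' [u' [<- <-]]].
      exists x', u'; auto.
    + intros [x [u [Hx [Hu Hz]]]]; exists $x, $u; auto.
Qed.

Lemma abs_assignment (A e : N) : assignment E' A e <-> assignment E $A $e.
Proof.
  unfold assignment, function_into.
  setoid_rewrite abs_omega; setoid_rewrite abs_function_on; setoid_rewrite abs_has_pair.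
  setoid_rewrite is_omega_eq; setoid_rewrite has_pair_eq.
  split; intros [w [Hw [Hf H]]].
  - exists om; rewrite <- Hw; split; [reflexivity | split; [exact Hf|]].
    intros x y Hxy; destruct (pair_down Hxy) as [x' [y' [<- <-]]]; exact (H x' y' Hxy).
  - destruct om_N as [o Ho]; exists o; rewrite Ho; split; [reflexivity|].
    subst w; split; [exact Hf|]; intros x y; apply H.
Qed.

Lemma assignment_V A e : A ∈ V b -> assignment E A e -> e ∈ V b.
Proof.
  intros HA He; apply (limit_cart b_limit (V_ord Hb om_b) HA).
  apply assignment_iff in He as [H1 [_ H2]]; intros p Hp.
  destruct (H1 p Hp) as [i [x [Hi ->]]]; exists i, x; eauto.
Qed.

Lemma abs_update (e' e i x : N) : is_update E' e' e i x <-> is_update E $e' $e $i $x.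
Proof.
  unfold is_update; setoid_rewrite abs_has_pair; setoid_rewrite has_pair_eq; split.
  - intros H j y; split.
    + intros Hy; destruct (pair_down Hy) as [j' [y' [<- <-]]].
      apply (H j' y') in Hy as [[-> ->]|[Hj Hy]]; [auto|right].
      split; [intros Hji; apply Hj, proj_inj, Hji | exact Hy].
    + intros [[-> ->]|[Hj Hy]]; [apply H; auto|].
      destruct (pair_down Hy) as [j' [y' [<- <-]]]; apply H; right.
      split; [intros ->; auto | exact Hy].
  - intros H j y; rewrite (H $j $y); split; intros [[H1 H2]|[H1 H2]].
    + left; split; apply proj_inj; assumption.
    + right; split; [intros ->; auto | exact H2].
    + left; subst; auto.
    + right; split; [intros Hji; apply H1, proj_inj, Hji | exact H2].
Qed.

Lemma abs_sat_relation (A S : N) : sat_relation E' A S <-> sat_relation E $A $S.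
Proof.
  unfold sat_relation.
  setoid_rewrite abs_form; setoid_rewrite abs_assignment; setoid_rewrite abs_has_pair;
  setoid_rewrite abs_code_mem; setoid_rewrite abs_code_eql; setoid_rewrite abs_code_neg;
  setoid_rewrite abs_code_and; setoid_rewrite abs_code_ex; setoid_rewrite abs_update;
  setoid_rewrite code_mem_eq; setoid_rewrite code_eql_eq; setoid_rewrite code_neg_eq;
  setoid_rewrite code_and_eq; setoid_rewrite code_ex_eq; setoid_rewrite has_pair_eq.
  assert (Hmem : forall (e : N) i j, (exists x y : N, pr i $x ∈ $e /\ pr j $y ∈ $e /\ E' x y) <->
    (exists x y, pr i x ∈ $e /\ pr j y ∈ $e /\ x ∈ y)).
  { intros e i j; split; intros [x [y [Hx [Hy H]]]]; [exists $x, $y; auto|].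
    destruct (pair_down Hx) as [_ [x' [_ <-]]], (pair_down Hy) as [_ [y' [_ <-]]].
    exists x', y'; auto. }
  assert (Heql : forall (e : N) i j, (exists x : N, pr i $x ∈ $e /\ pr j $x ∈ $e) <->
    (exists x, pr i x ∈ $e /\ pr j x ∈ $e)).
  { intros e i j; split; intros [x [Hx Hy]]; [exists $x; auto|].
    destruct (pair_down Hx) as [_ [x' [_ <-]]]; exists x'; auto. }
  assert (Hex : forall (e i x : N), (exists y e' : N, E' y A /\ assignment E $A $e' /\
      is_update E $e' $e $i $y /\ pr $x $e' ∈ $S) <->
    (exists y e', y ∈ $A /\ assignment E $A e' /\ is_update E e' $e $i y /\ pr $x e' ∈ $S)).
  { intros e i x; split; intros [y [e' [Hy [He' H]]]]; [exists $y, $e'; auto|].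
    destruct (down Hy) as [y' <-], (lift_V (assignment_V (proj2_sig A) He')) as [e'' <-].
    exists y', e''; auto. }
  assert (Hsub : forall n (c : N) x, $c = pr (num n) x -> exists x' : N, $x' = x).
  { intros n c x Hc; apply lift_V; pose proof (proj2_sig c) as H; simpl in H; rewrite Hc in H.
    apply (pr_V Hb H). }
  assert (Hsub2 : forall n (c : N) x y, $c = pr (num n) (pr x y) ->
    exists x' y' : N, $x' = x /\ $y' = y).
  { intros n c x y Hc; destruct (Hsub n c _ Hc) as [p Hp].
    pose proof (proj2_sig p) as H; simpl in H; rewrite Hp in H.
    destruct (pr_V Hb H) as [Hx Hy].
    destruct (lift_V Hx) as [x' Hx'], (lift_V Hy) as [y' Hy']; eauto. }
  split; intros H c e Hc He.
  - destruct (lift_V (form_V Hc)) as [c' <-], (lift_V (assignment_V (proj2_sig A) He)) as [e' <-].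
    destruct (H c' e' Hc He) as [H1 [H2 [H3 [H4 H5]]]]; split; [|split; [|split; [|split]]].
    + intros i j Hij; destruct (Hsub2 _ _ _ _ Hij) as [i' [j' [<- <-]]].
      rewrite <- Hmem; exact (H1 i' j' Hij).
    + intros i j Hij; destruct (Hsub2 _ _ _ _ Hij) as [i' [j' [<- <-]]].
      rewrite <- Heql; exact (H2 i' j' Hij).
    + intros x Hx; destruct (Hsub _ _ _ Hx) as [x' <-]; exact (H3 x' Hx).
    + intros x y Hxy; destruct (Hsub2 _ _ _ _ Hxy) as [x' [y' [<- <-]]]; exact (H4 x' y' Hxy).
    + intros i x Hix; destruct (Hsub2 _ _ _ _ Hix) as [i' [x' [<- <-]]].
      rewrite <- Hex; exact (H5 i' x' Hix).
  - destruct (H $c $e Hc He) as [H1 [H2 [H3 [H4 H5]]]]; split; [|split; [|split; [|split]]].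
    + intros i j Hij; rewrite Hmem; exact (H1 $i $j Hij).
    + intros i j Hij; rewrite Heql; exact (H2 $i $j Hij).
    + intros x Hx; exact (H3 $x Hx).
    + intros x y Hxy; exact (H4 $x $y Hxy).
    + intros i x Hix; rewrite Hex; exact (H5 $i $x Hix).
Qed.

(** Upwards, a witness remains a witness. Downwards, the relation given by [sat_relation_exists] is
    used: it consists of pairs of a code and an assignment, both taken from sets in [V b]. *)
Lemma abs_Sat (A c e : N) : is_form E $c -> assignment E $A $e ->
  Sat E' A c e <-> Sat E $A $c $e.
Proof.
  intros Hc He; unfold Sat at 1.
  setoid_rewrite abs_sat_relation; setoid_rewrite abs_has_pair; split.
  - intros [S [HS H]]; exists $S; rewrite has_pair_eq; auto.
  - intros H; destruct (sat_relation_exists $A) as [S [HS HSp]].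
    apply (Sat_relation HS Hc He), has_pair_eq in H.
    destruct (assignment_set $A) as [W HW].
    assert (HWV : W ∈ V b).
    { apply (V_subset Hb (limit_pw b_limit (limit_cart b_limit (V_ord Hb om_b) (proj2_sig A)
        (fun p => proj1 (in_cart om $A p))))).
      intros f Hf; apply HW, assignment_iff in Hf as [H1 [_ H2]]; apply in_pw; intros p Hp.
      destruct (H1 p Hp) as [i [x [Hi ->]]]; apply pr_cart; eauto. }
    assert (HSV : S ∈ V b).
    { apply (limit_cart b_limit Form_V HWV); intros p Hp.
      destruct (HSp p Hp) as [d [f [Hd [Hf ->]]]]; exists d, f.
      rewrite in_Form, HW; auto. }
    destruct (lift_V HSV) as [S' <-]; exists S'; auto.
Qed.

End Absoluteness.

(** * Reflective cardinals *)

(** A relation given uniformly in all structures can be read as the same formula in [V_l], in [V_m]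
    and in the universe. *)
Definition relation2 := forall N : Type, (N -> N -> Prop) -> N -> N -> Prop.

Definition Rf2 (Q : relation2) : Prop := Rf (fun N E e => Q N E (e 0) (e 1)).

Lemma Rf2_formula Q : Rf2 Q ->
  exists p, fml2 p /\ forall N (E : N -> N -> Prop) e, sat E e p <-> Q N E (e 0) (e 1).
Proof.
  (* All variables after the first are identified with [v_1]; the truth value depends on the first
     two only. *)
  intros [d Hd]; exists (named (fun n => Nat.min n 1) d); split.
  - intros k Hk; apply free_named in Hk as [n ->]; lia.
  - intros N E e; rewrite sat_named, Hd; reflexivity.
Qed.

(* Here [s = (c, e0)]. The assignment [e0] is partial because it has to be an
   element of [V_x], and a total assignment in [V_x] need not be one. *)
Definition satV : relation2 := fun N E x s =>
  exists v c e0 e, is_V E x v /\ is_pair E s c e0 /\ is_form E c /\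
    assignment E v e /\ subset E e0 e /\ Sat E v c e.

Lemma satV_Rf : Rf2 satV.
Proof. unfold Rf2, satV; rf. Qed.

(** For an ordinal [x] this says that some limit ordinal is below [x]. The wording avoids omega and
    successors, so that it can be evaluated in a level before omega is known to be there. *)
Definition limit_below : relation2 := fun N E x _ =>
  exists y, E y x /\ (exists z, E z y) /\ forall z, E z y -> exists w, E w y /\ E z w.

Lemma limit_below_Rf : Rf2 limit_below.
Proof. unfold Rf2, limit_below; rf. Qed.

Section Reflective.
Context {M : Type} {E : M -> M -> Prop} {Z : model E}.
Local Notation "x ∈ y" := (E x y) (at level 70, no associativity).
Local Notation "$ x" := (proj1_sig x) (at level 1, format "$ x").

Lemma ord_suc_le a b : ordinal E a -> ordinal E b -> a ∈ b -> suc a ∈ b \/ suc a = b.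
Proof.
  intros Ha Hb H; apply ord_subset; [exact (ord_suc Ha) | exact Hb |].
  intros z Hz; apply in_suc in Hz as [Hz| ->]; [exact (ord_trans Hb H Hz) | exact H].
Qed.

Lemma abs_satV b (x s : {x | x ∈ V b}) : limit b -> om ∈ b ->
  satV (restr E (fun x => x ∈ V b)) x s <-> satV E $x $s.
Proof.
  intros Hl Hom; pose proof (proj1 Hl) as Hb; unfold satV.
  setoid_rewrite (fun a v => abs_V Hb Hl a v).
  setoid_rewrite (fun p x y => abs_pair (HD := V_transitive_class Hb) p x y).
  setoid_rewrite (fun c => abs_form Hb Hl Hom c).
  setoid_rewrite (fun A e => abs_assignment Hb Hom A e).
  setoid_rewrite (fun x y => abs_subset (HD := V_transitive_class Hb) x y).
  split.
  - intros [v [c [e0 [e [Hv [Hs [Hc [He [H0 H]]]]]]]]].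
    exists $v, $c, $e0, $e; rewrite is_pair_eq.
    rewrite (abs_Sat Hb Hl Hom Hc He) in H; auto 6.
  - intros [v [c [e0 [e [Hv [Hs [Hc [He [H0 H]]]]]]]]]; apply is_pair_eq in Hs.
    assert (HvV : v ∈ V b).
    { apply is_V_eq in Hv as [Hx ->]; apply (V_V Hb), (V_ord_iff Hb Hx), (proj2_sig x). }
    assert (HsV := proj2_sig s); simpl in HsV; rewrite Hs in HsV; apply (pr_V Hb) in HsV.
    destruct HsV as [HcV He0V].
    destruct (lift_V HvV) as [v' <-], (lift_V HcV) as [c' <-], (lift_V He0V) as [e0' <-],
      (lift_V (assignment_V Hb Hl Hom (proj2_sig v') He)) as [e' <-].
    exists v', c', e0', e'.
    rewrite (abs_Sat Hb Hl Hom Hc He); auto 6.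
Qed.

Variable R : M -> Prop.
Hypothesis theory : reflective_theory E R.

Definition reflective (k : M) : Prop := R k /\ emp ∈ k.

Lemma reflective_ord k : reflective k -> ordinal E k.
Proof. intros [H _]; exact (A2 theory H). Qed.

(** Otherwise everything in [R] is an element of [suc (suc a)], where A1 collects it into a set,
    against A4. *)
Lemma reflective_above a : ordinal E a -> exists k, reflective k /\ a ∈ k.
Proof.
  intros Ha; apply NNPP; intros Hn.
  destruct (A1 theory (suc (suc a))) as [y Hy].
  apply (A4 theory); exists y; intros k; rewrite Hy; split; [tauto|].
  intros Hk; split; [|exact Hk]; pose proof (A2 theory Hk) as Hko.
  assert (Hsa := ord_suc Ha).
  destruct (ord_trichotomy Hko (ord_suc Hsa)) as [H|[H|H]]; [exact H| |]; exfalso; apply Hn.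
  - exists k; subst k; split; [split; [exact Hk|]|].
    + destruct (ord_trichotomy ord_emp (ord_suc Hsa)) as [H|[H|H]]; [exact H| |].
      * symmetry in H; destruct (suc_neq_emp H).
      * destruct (in_emp H).
    + apply in_suc; left; apply suc_self.
  - exists k; split; [split; [exact Hk|]|].
    + destruct (ord_trichotomy ord_emp Hko) as [H'|[H'|H']]; [exact H'| |].
      * subst k; destruct (in_emp H).
      * destruct (in_emp H').
    + apply (ord_trans Hko H), in_suc; left; apply suc_self.
Qed.

Lemma Sat2_restr A p Q (x y : {z | z ∈ A}) : fml2 p ->
  (forall N (E : N -> N -> Prop) e, sat E e p <-> Q N E (e 0) (e 1)) ->
  Sat2 E A (code p) $x $y <-> Q _ (restr E (fun z => z ∈ A)) x y.
Proof.
  intros Hp2 Hp; rewrite (Sat2_code Hp2 (proj2_sig x) (proj2_sig y)).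
  pose (e := fun k => match k with 0 => x | _ => y end).
  change (Q _ (restr E (fun z => z ∈ A)) x y)
    with (Q _ (restr E (fun z => z ∈ A)) (e 0) (e 1)).
  rewrite <- Hp, sat_restr.
  replace (fun k => match k with 0 => $x | _ => $y end) with (fun k => $(e k)); [tauto|].
  extensionality k; destruct k; reflexivity.
Qed.

(** A3 from left to right for actual formulas: their codes are standard, so satisfaction in a level
    is truth in the restricted structure. *)
Lemma standard_indiscernible Q a b c (a' s' : {x | x ∈ V b}) (b' s'' : {x | x ∈ V c}) :
  Rf2 Q -> reflective a -> R b -> R c -> a ∈ b -> b ∈ c ->
  $a' = a -> $b' = b -> $s'' = $s' -> $s' ∈ V a ->
  Q _ (restr E (fun x => x ∈ V b)) a' s' <-> Q _ (restr E (fun x => x ∈ V c)) b' s''.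
Proof.
  intros HQ Ha Hb Hc Hab Hbc Ha' Hb' Hs'' Hs.
  destruct (Rf2_formula HQ) as [p [Hp2 Hp]].
  pose proof (reflective_ord Ha) as Hao.
  pose proof (proj1 (A3 theory Hao Hb Hc
    (ex_intro _ emp (conj in_emp (proj2 Ha))) Hab Hbc
    (V_is_V Hao) (V_is_V (A2 theory Hb)) (V_is_V (A2 theory Hc))) (proj1 Ha)
    (code p) $s' (code_form2 Hp2) Hs) as H.
  rewrite <- (Sat2_restr a' s' Hp2 Hp), <- (Sat2_restr b' s'' Hp2 Hp).
  rewrite Ha', Hb', Hs''; exact H.
Qed.

Lemma indiscernible_in_V Q k l m (k' s' : {x | x ∈ V l}) (l' s'' : {x | x ∈ V m}) :
  Rf2 Q -> reflective k -> reflective l -> reflective m -> k ∈ l -> l ∈ m ->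
  $k' = k -> $l' = l -> $s'' = $s' -> $s' ∈ V k ->
  Q _ (restr E (fun x => x ∈ V l)) k' s' <-> Q _ (restr E (fun x => x ∈ V m)) l' s''.
Proof. intros HQ Hk [Hl _] [Hm _]; apply standard_indiscernible; assumption. Qed.

(* If [k = s + 1] then [l = s + 1] as well, by indiscernibility. *)
Lemma reflective_limit k : reflective k -> limit k.
Proof.
  intros Hk; pose proof (reflective_ord Hk) as Hko.
  split; [exact Hko | split; [apply Hk|]].
  intros s Hs; pose proof (ord_mem Hko Hs) as Hso.
  destruct (ord_suc_le Hso Hko Hs) as [H|H]; [exact H|exfalso].
  destruct (reflective_above Hko) as [l [Hl Hkl]].
  destruct (reflective_above (reflective_ord Hl)) as [m [Hm Hlm]].
  pose proof (reflective_ord Hl) as Hlo; pose proof (reflective_ord Hm) as Hmo.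
  destruct (lift_V (V_ord Hlo Hkl)) as [k' Hk'], (lift_V (V_ord Hmo Hlm)) as [l' Hl'].
  destruct (lift_V (V_ord Hlo (ord_trans Hlo Hkl Hs))) as [s' Hs'].
  destruct (lift_V (V_ord Hmo (ord_trans Hmo Hlm (ord_trans Hlo Hkl Hs)))) as [s'' Hs''].
  assert (Hsk : $s' ∈ V k) by (rewrite Hs'; exact (V_ord Hko Hs)).
  pose proof (@indiscernible_in_V (fun N E x y => is_succ E x y) k l m k' s' l' s''
    (Rf_is_succ 0 1) Hk Hl Hm Hkl Hlm Hk' Hl' ltac:(congruence) Hsk) as Hi.
  rewrite (abs_succ (HD := V_transitive_class Hlo)), (abs_succ (HD := V_transitive_class Hmo)) in Hi.
  rewrite Hk', Hl', Hs', Hs'' in Hi.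
  pose proof (proj1 Hi (eq_sym H)) as Hl'eq.
  apply (mem_irrefl (x := k)); rewrite <- H at 2; rewrite <- Hl'eq; exact Hkl.
Qed.

(** [V_m] sees a limit below [l], namely [k] itself. Hence [V_l] sees one below [k], and omega is at
    most that ordinal. *)
Lemma reflective_om k : reflective k -> om ∈ k.
Proof.
  intros Hk; pose proof (reflective_ord Hk) as Hko.
  destruct (reflective_above Hko) as [l [Hl Hkl]].
  destruct (reflective_above (reflective_ord Hl)) as [m [Hm Hlm]].
  pose proof (reflective_ord Hl) as Hlo; pose proof (reflective_ord Hm) as Hmo.
  destruct (lift_V (V_ord Hlo Hkl)) as [k' Hk'], (lift_V (V_ord Hmo Hlm)) as [l' Hl'].
  assert (Hek : emp ∈ V k) by exact (V_ord Hko (proj2 Hk)).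
  destruct (lift_V (V_mono Hlo Hkl Hek)) as [s' Hs'].
  destruct (lift_V (V_mono Hmo Hlm (V_mono Hlo Hkl Hek))) as [s'' Hs''].
  assert (Hsk : $s' ∈ V k) by (rewrite Hs'; exact Hek).
  pose proof (@indiscernible_in_V limit_below k l m k' s' l' s''
    limit_below_Rf Hk Hl Hm Hkl Hlm Hk' Hl' ltac:(congruence) Hsk) as Hi.
  destruct (proj2 Hi) as [y [Hy [[z Hz] Hmax]]].
  { destruct (lift_V (V_mono Hmo Hlm (V_ord Hlo Hkl))) as [y Hy]; exists y.
    unfold restr; rewrite Hy, Hl'; split; [exact Hkl | split].
    - exists s''; rewrite Hs''; apply Hk.
    - intros z Hz; pose proof (proj2 (proj2 (reflective_limit Hk)) $z Hz) as Hsz.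
      destruct (lift_V (V_mono Hmo Hlm (V_mono Hlo Hkl (V_ord Hko Hsz)))) as [w Hw].
      exists w; rewrite Hw; split; [exact Hsz | apply suc_self]. }
  unfold restr in *; rewrite Hk' in Hy.
  pose proof (ord_mem Hko Hy) as Hyo.
  assert (Hly : limit $y).
  { split; [exact Hyo | split].
    - destruct (ord_trichotomy ord_emp Hyo) as [H|[H|H]]; [exact H| |].
      + rewrite <- H in Hz; destruct (in_emp Hz).
      + destruct (in_emp H).
    - intros c Hc; destruct (down (HD := V_transitive_class Hlo) Hc) as [c' <-]; destruct (Hmax c' Hc) as [w [Hw Hcw]].
      destruct (ord_suc_le (ord_mem Hyo Hc) (ord_mem Hyo Hw) Hcw) as [H| ->]; [|exact Hw].
      exact (ord_trans Hyo Hw H). }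
  destruct (ord_subset ord_om Hyo) as [H| ->]; [|exact (ord_trans Hko Hy H)|exact Hy].
  intros i Hi'; exact (limit_nat Hly Hi').
Qed.

Lemma satV_indiscernible k l s : reflective k -> reflective l -> k ∈ l -> s ∈ V k ->
  satV E k s <-> satV E l s.
Proof.
  intros Hk Hl Hkl Hs; destruct (reflective_above (reflective_ord Hl)) as [m [Hm Hlm]].
  pose proof (reflective_ord Hk) as Hko; pose proof (reflective_ord Hl) as Hlo.
  pose proof (reflective_ord Hm) as Hmo.
  destruct (lift_V (V_ord Hlo Hkl)) as [k' Hk'], (lift_V (V_ord Hmo Hlm)) as [l' Hl'].
  destruct (lift_V (V_mono Hlo Hkl Hs)) as [s' Hs'].
  destruct (lift_V (V_mono Hmo Hlm (V_mono Hlo Hkl Hs))) as [s'' Hs''].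
  assert (Hsk : $s' ∈ V k) by (rewrite Hs'; exact Hs).
  pose proof (@indiscernible_in_V satV k l m k' s' l' s''
    satV_Rf Hk Hl Hm Hkl Hlm Hk' Hl' ltac:(congruence) Hsk) as Hi.
  rewrite (abs_satV _ _ (reflective_limit Hl) (reflective_om Hl)) in Hi.
  rewrite (abs_satV _ _ (reflective_limit Hm) (reflective_om Hm)) in Hi.
  rewrite Hk', Hl', Hs', Hs'' in Hi; exact Hi.
Qed.

(** The first [n] values have bounded rank whatever the cofinality of [k], whereas the ranks of all
    values of an assignment may be unbounded in [k]. *)
Lemma bounded_values k e n : limit k -> assignment E (V k) e -> n ∈ om ->
  exists c, c ∈ k /\ forall i x, i ∈ n -> pr i x ∈ e -> x ∈ V c.
Proof.
  intros Hk He Hn; pose proof (proj1 Hk) as Hko.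
  assert (H : exists c v, c ∈ k /\ is_V E c v /\ forall i, i ∈ n -> forall x, has_pair E e i x -> x ∈ v).
  { revert n Hn; apply (@om_ind _ _ _ (fun n => exists c v, c ∈ k /\ is_V E c v /\
      forall i, i ∈ n -> forall x, has_pair E e i x -> x ∈ v)); [df| |].
    - exists emp, (V emp); split; [apply Hk | split; [exact (V_is_V ord_emp)|]].
      intros i Hi; destruct (in_emp Hi).
    - intros n Hn [c [v [Hc [Hv H]]]]; apply is_V_eq in Hv as [Hco ->].
      destruct (limit_common Hk (V_V Hko Hc) (ap_in He Hn)) as [d [Hd [Hcd Hnd]]].
      pose proof (ord_mem Hko Hd) as Hdo.
      exists d, (V d); split; [exact Hd | split; [exact (V_is_V Hdo)|]].
      intros i Hi x Hx; apply in_suc in Hi as [Hi| ->].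
      + exact (V_trans Hdo Hcd (H i Hi x Hx)).
      + apply has_pair_eq, (ap_iff _ He Hn) in Hx; subst x; exact Hnd. }
  destruct H as [c [v [Hc [Hv H]]]]; apply is_V_eq in Hv as [_ ->].
  exists c; split; [exact Hc|]; intros i x Hi Hx; apply (H i Hi), has_pair_eq, Hx.
Qed.

Lemma internal_elementary k l c e : reflective k -> reflective l -> k ∈ l ->
  is_form E c -> assignment E (V k) e -> Sat E (V k) c e <-> Sat E (V l) c e.
Proof.
  intros Hk Hl Hkl Hc He; pose proof (reflective_ord Hk) as Hko; pose proof (reflective_ord Hl) as Hlo.
  pose proof (reflective_limit Hk) as Hlk.
  destruct (finite_support Hc) as [n [Hn Hsupp]].
  (* [e0] is the part of [e] that matters for [c]. It is an element of [V k], and all total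
     extensions of it give [c] the same truth value, which is why [satV] may ask for some
     extension. *)
  destruct (@separation _ _ Z (fun p => exists i x, i ∈ n /\ is_pair E p i x)) with (a := e)
    as [e0 He0]; [df|].
  assert (He0k : e0 ∈ V k).
  { destruct (bounded_values Hlk He Hn) as [d [Hd Hval]].
    apply (limit_cart Hlk (V_ord Hko (reflective_om Hk)) (V_V Hko Hd)).
    intros p Hp; apply He0 in Hp as [Hp [i [x [Hi Hpx]]]]; apply is_pair_eq in Hpx; subst p.
    exists i, x; split; [exact (om_trans Hn Hi) | split; [exact (Hval i x Hi Hp) | reflexivity]]. }
  assert (Hag : forall A e', assignment E A e' -> subset E e0 e' -> agree E n e e').
  { intros A e' He' Hsub i Hi x; pose proof (om_trans Hn Hi) as Hio.
    rewrite !has_pair_eq, (ap_iff x He Hio), (ap_iff x He' Hio).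
    enough (ap e i = ap e' i) as -> by tauto.
    apply (ap_iff _ He' Hio), Hsub, He0; split; [apply (ap_iff _ He Hio); reflexivity|].
    exists i, (ap e i); rewrite is_pair_eq; auto. }
  assert (HeV : forall m, reflective m -> subset E (V k) (V m) ->
    Sat E (V m) c e <-> satV E m (pr c e0)).
  { intros m Hm Hkm; pose proof (assignment_mono Hkm He) as Hem.
    pose proof (V_is_V (reflective_ord Hm)) as HV; split.
    - intros H; exists (V m), c, e0, e; rewrite is_pair_eq.
      split; [exact HV | split; [reflexivity | split; [exact Hc | split; [exact Hem | split; [|exact H]]]]].
      intros p Hp; apply He0, Hp.
    - intros [v [c' [e0' [e' [Hv [Hp [_ [He' [Hsub H]]]]]]]]].
      apply is_pair_eq, pr_inj in Hp as [<- <-].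
      rewrite (is_V_unique Hv HV) in *.
      apply (Hsupp (V m) e e' Hem He' (Hag _ e' He' Hsub)), H. }
  rewrite (HeV k Hk), (HeV l Hl); [|exact (V_mono Hlo Hkl)| intros z; auto].
  apply (satV_indiscernible Hk Hl Hkl), (limit_pr Hlk); [|exact He0k].
  exact (form_V Hko (reflective_om Hk) Hc).
Qed.

Lemma rsat_V_mono k l p a : reflective k -> reflective l -> k ∈ l -> (forall i, a i ∈ V k) ->
  rsat E (fun x => x ∈ V k) a p <-> rsat E (fun x => x ∈ V l) a p.
Proof.
  intros Hk Hl Hkl Ha; destruct (internal_assignment (fbound p) Ha) as [e [He Hea]].
  pose proof (assignment_mono (V_mono (reflective_ord Hl) Hkl) He) as Hel.
  rewrite <- (@rsat_ext _ E (fun x => x ∈ V k) p (fun i => ap e (num i)) a),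
    <- (@rsat_ext _ E (fun x => x ∈ V l) p (fun i => ap e (num i)) a)
    by (intros i Hi; apply Hea, free_fbound, Hi).
  rewrite <- (Sat_code p He), <- (Sat_code p Hel).
  exact (internal_elementary Hk Hl Hkl (code_form p) He).
Qed.

(** Tarski's argument for the union of an elementary chain. The induction keeps [k] general because
    a witness in the universe leads to a larger level. *)
Lemma rsat_V_sat p : forall k a, reflective k -> (forall i, a i ∈ V k) ->
  rsat E (fun x => x ∈ V k) a p <-> sat E a p.
Proof.
  induction p; intros k a Hk Ha; simpl; try tauto.
  - rewrite IHp by assumption; tauto.
  - rewrite IHp1, IHp2 by assumption; tauto.
  - assert (Hup : forall m x, x ∈ V m -> (forall j, a j ∈ V m) -> forall j, update a i x j ∈ V m)
      by (intros m x Hx Ham j; unfold update; destruct (Nat.eqb j i); auto).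
    split.
    + intros [x [Hx H]]; exists x; apply (IHp k); auto.
    + intros [x H]; destruct (all_in_V x) as [r [Hr Hx]].
      pose proof (reflective_ord Hk) as Hko.
      assert (exists l, reflective l /\ k ∈ l /\ r ∈ l) as [l [Hl [Hkl Hrl]]].
      { destruct (reflective_above Hr) as [l [Hl Hrl]].
        destruct (ord_trichotomy Hko (reflective_ord Hl)) as [H'|H'].
        - exists l; auto.
        - destruct (reflective_above Hko) as [l' [Hl' Hkl']]; exists l'.
          split; [exact Hl' | split; [exact Hkl'|]].
          destruct H' as [->|H']; [exact (ord_trans (reflective_ord Hl') Hkl' Hrl)|].
          exact (ord_trans (reflective_ord Hl') (ord_trans (reflective_ord Hl') Hkl' H') Hrl). }
      pose proof (reflective_ord Hl) as Hlo.
      (* The witness lies in [V l], where the induction hypothesis applies; elementarity between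
         levels returns the existential statement to [V k]. *)
      apply (rsat_V_mono (FEx i p) Hk Hl Hkl Ha); simpl.
      pose proof (V_mono Hlo Hrl Hx) as Hxl; exists x; split; [exact Hxl|].
      apply (IHp l); auto; apply Hup; auto; intros j; exact (V_mono Hlo Hkl (Ha j)).
Qed.

End Reflective.

(** ** [V_k] satisfies ZFC *)

Section Denotation.
Context {M : Type} {E : M -> M -> Prop} {Z : model E}.
Local Notation "x ∈ y" := (E x y) (at level 70, no associativity).
#[local] Hint Extern 0 (Syntax (M -> Prop)) => exact (code_syntax E) : typeclass_instances.

(** The counterpart of [means] for codes: it reads an axiom inside a set, even if the axiom contains
    a nonstandard formula. The first clause provides a code to which internal elementarity can be
    applied. *)
Definition denotes (P : M -> Prop) (Q : M -> M -> Prop) : Prop :=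
  (exists c, P c) /\ forall c, P c -> is_form E c /\
    forall A e, assignment E A e -> Sat E A c e <-> Q A e.

Lemma denotes_self x : is_form E x -> denotes (eq x) (fun A e => Sat E A x e).
Proof. intros Hx; split; [eauto|]; intros c <-; split; [exact Hx | tauto]. Qed.

Lemma denotes_Mem i j : denotes (Mem i j) (fun A e => ap e (num i) ∈ ap e (num j)).
Proof.
  split.
  - exists (cmem (num i) (num j)), (num i), (num j).
    rewrite !is_numeral_eq, code_mem_eq; auto.
  - intros c [x [y [Hx [Hy Hc]]]]; apply is_numeral_eq in Hx, Hy; apply code_mem_eq in Hc; subst.
    split; [exact (form_mem (num_om i) (num_om j))|].
    intros A e He; exact (Sat_mem He (num_om i) (num_om j)).
Qed.

Lemma denotes_Eql i j : denotes (Eql i j) (fun A e => ap e (num i) = ap e (num j)).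
Proof.
  split.
  - exists (ceql (num i) (num j)), (num i), (num j).
    rewrite !is_numeral_eq, code_eql_eq; auto.
  - intros c [x [y [Hx [Hy Hc]]]]; apply is_numeral_eq in Hx, Hy; apply code_eql_eq in Hc; subst.
    split; [exact (form_eql (num_om i) (num_om j))|].
    intros A e He; exact (Sat_eql He (num_om i) (num_om j)).
Qed.

Lemma denotes_Neg P Q : denotes P Q -> denotes (Neg P) (fun A e => ~ Q A e).
Proof.
  intros [[x Hx] H]; split.
  - exists (cneg x), x; rewrite code_neg_eq; auto.
  - intros c [y [Hy Hc]]; apply code_neg_eq in Hc; subst.
    destruct (H y Hy) as [Hf HS]; split; [exact (form_neg Hf)|].
    intros A e He; rewrite (Sat_neg He Hf), HS; tauto.
Qed.

Lemma denotes_And P P' Q Q' : denotes P Q -> denotes P' Q' ->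
  denotes (And P P') (fun A e => Q A e /\ Q' A e).
Proof.
  intros [[x Hx] H] [[x' Hx'] H']; split.
  - exists (cand x x'), x, x'; rewrite code_and_eq; auto.
  - intros c [y [y' [Hy [Hy' Hc]]]]; apply code_and_eq in Hc; subst.
    destruct (H y Hy) as [Hf HS], (H' y' Hy') as [Hf' HS']; split; [exact (form_and Hf Hf')|].
    intros A e He; rewrite (Sat_and He Hf Hf'), HS, HS'; tauto.
Qed.

Lemma denotes_Ex i P Q : denotes P Q ->
  denotes (Ex i P) (fun A e => exists x, x ∈ A /\ Q A (upd e (num i) x)).
Proof.
  intros [[x Hx] H]; split.
  - exists (cex (num i) x), (num i), x; rewrite is_numeral_eq, code_ex_eq; auto.
  - intros c [n [y [Hn [Hy Hc]]]]; apply is_numeral_eq in Hn; apply code_ex_eq in Hc; subst.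
    destruct (H y Hy) as [Hf HS]; split; [exact (form_ex (num_om i) Hf)|].
    intros A e He; rewrite (Sat_ex He (num_om i) Hf); apply ex_iff; intros z.
    split; intros [Hz H1]; (split; [exact Hz|]); apply (HS A _ (upd_assignment He (num_om i) Hz)), H1.
Qed.

Lemma denotes_equiv P Q Q' : denotes P Q -> (forall A e, Q A e <-> Q' A e) -> denotes P Q'.
Proof.
  intros [H1 H2] H; split; [exact H1|]; intros c Hc; destruct (H2 c Hc) as [Hf HS].
  split; [exact Hf|]; intros A e He; rewrite HS; auto.
Qed.

Lemma denotes_Imp P P' Q Q' : denotes P Q -> denotes P' Q' ->
  denotes (Imp P P') (fun A e => Q A e -> Q' A e).
Proof.
  intros H H'; apply (denotes_equiv (denotes_Neg (denotes_And H (denotes_Neg H')))).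
  intros; tauto.
Qed.

Lemma denotes_Iff P P' Q Q' : denotes P Q -> denotes P' Q' ->
  denotes (Iff P P') (fun A e => Q A e <-> Q' A e).
Proof.
  intros H H'; exact (denotes_And (denotes_Imp H H') (denotes_Imp H' H)).
Qed.

Lemma denotes_All i P Q : denotes P Q ->
  denotes (All i P) (fun A e => forall x, x ∈ A -> Q A (upd e (num i) x)).
Proof.
  intros H; apply (denotes_equiv (denotes_Neg (denotes_Ex i (denotes_Neg H)))).
  intros A e; split; [|intros K [x [Hx H']]; auto].
  intros K x Hx; apply NNPP; intros H'; apply K; eauto.
Qed.

Ltac denotes_tac Hx :=
  lazymatch goal with
  | |- denotes (eq _) _ => exact (denotes_self Hx)
  | |- denotes (Mem _ _) _ => apply denotes_Mem
  | |- denotes (Eql _ _) _ => apply denotes_Eql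
  | |- denotes (Iff _ _) _ => eapply denotes_Iff; denotes_tac Hx
  | |- denotes (Imp _ _) _ => eapply denotes_Imp; denotes_tac Hx
  | |- denotes (All _ _) _ => eapply denotes_All; denotes_tac Hx
  | |- denotes (And _ _) _ => eapply denotes_And; denotes_tac Hx
  | |- denotes (Ex _ _) _ => eapply denotes_Ex; denotes_tac Hx
  end.

Lemma separation_code x : is_form E x ->
  denotes (ax_separation (eq x)) (fun A e => forall a, a ∈ A -> exists b, b ∈ A /\
    forall z, z ∈ A ->
    let f := upd (upd (upd e (num 0) a) (num 1) b) (num 2) z in
    ap f (num 2) ∈ ap f (num 1) <-> ap f (num 2) ∈ ap f (num 0) /\ Sat E A x f).
Proof.
  intros Hx; unfold ax_separation; eapply denotes_equiv; [denotes_tac Hx | intros A e; apply iff_refl].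
Qed.

(** The two halves of [ax_replacement] are kept apart because elementarity moves them in opposite
    directions between [V_k] and [V_l]. *)
Definition replacement_premise x : M -> Prop :=
  All 2 (Imp (Mem 2 0) (Ex 1 (All 3 (Iff (eq x) (Eql 3 1))))).

Definition replacement_conclusion x : M -> Prop :=
  Ex 1 (All 3 (Iff (Mem 3 1) (Ex 2 (And (Mem 2 0) (eq x))))).

Lemma premise_code x : is_form E x ->
  denotes (replacement_premise x) (fun A e => forall z, z ∈ A ->
    ap (upd e (num 2) z) (num 2) ∈ ap (upd e (num 2) z) (num 0) ->
    exists w, w ∈ A /\ forall y, y ∈ A ->
    let f := upd (upd (upd e (num 2) z) (num 1) w) (num 3) y in
    Sat E A x f <-> ap f (num 3) = ap f (num 1)).
Proof.
  intros Hx; unfold replacement_premise; eapply denotes_equiv; [denotes_tac Hx | intros A e; apply iff_refl].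
Qed.

Lemma conclusion_code x : is_form E x ->
  denotes (replacement_conclusion x) (fun A e => exists b, b ∈ A /\ forall y, y ∈ A ->
    let f := upd (upd e (num 1) b) (num 3) y in
    ap f (num 3) ∈ ap f (num 1) <-> exists z, z ∈ A /\
    ap (upd f (num 2) z) (num 2) ∈ ap (upd f (num 2) z) (num 0) /\ Sat E A x (upd f (num 2) z)).
Proof.
  intros Hx; unfold replacement_conclusion; eapply denotes_equiv; [denotes_tac Hx | intros A e; apply iff_refl].
Qed.

(** The axioms outside the schemas have only standard codes, so they pass to [V_k] by elementarity
    for actual formulas. *)
Definition codes_of (P : M -> Prop) (p : fml) : Prop := forall c, P c -> c = code p.

Lemma codes_of_Mem i j : codes_of (Mem i j) (Mem i j).
Proof.
  intros c [x [y [Hx [Hy Hc]]]]; apply is_numeral_eq in Hx, Hy; apply code_mem_eq in Hc.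
  subst; reflexivity.
Qed.

Lemma codes_of_Eql i j : codes_of (Eql i j) (Eql i j).
Proof.
  intros c [x [y [Hx [Hy Hc]]]]; apply is_numeral_eq in Hx, Hy; apply code_eql_eq in Hc.
  subst; reflexivity.
Qed.

Lemma codes_of_Neg P p : codes_of P p -> codes_of (Neg P) (Neg p).
Proof.
  intros H c [x [Hx Hc]]; apply code_neg_eq in Hc; apply H in Hx; subst; reflexivity.
Qed.

Lemma codes_of_And P Q p q : codes_of P p -> codes_of Q q -> codes_of (And P Q) (And p q).
Proof.
  intros H K c [x [y [Hx [Hy Hc]]]]; apply code_and_eq in Hc; apply H in Hx; apply K in Hy.
  subst; reflexivity.
Qed.

Lemma codes_of_Ex i P p : codes_of P p -> codes_of (Ex i P) (Ex i p).
Proof.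
  intros H c [n [x [Hn [Hx Hc]]]]; apply code_ex_eq in Hc; apply is_numeral_eq in Hn.
  apply H in Hx; subst; reflexivity.
Qed.

Ltac codes_tac :=
  unfold ax_extensionality, ax_foundation, ax_pairing, ax_union, ax_powerset, ax_infinity,
    ax_choice, All, Iff, Imp, Or;
  repeat first [apply codes_of_Mem | apply codes_of_Eql | apply codes_of_Neg
    | apply codes_of_And | apply codes_of_Ex].

Lemma codes_of_finite_part P : In P ZFC_finite_part ->
  exists p, In p ZFC_finite_part /\ codes_of P p.
Proof.
  unfold ZFC_finite_part; intros [<-|[<-|[<-|[<-|[<-|[<-|[<-|[]]]]]]]];
    [ exists ax_extensionality | exists ax_foundation | exists ax_pairing | exists ax_union
    | exists ax_powerset | exists ax_infinity | exists ax_choice ];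
    (split; [repeat (first [left; reflexivity | right]) | codes_tac]).
Qed.

End Denotation.

Section Models.
Context {M : Type} {E : M -> M -> Prop} {Z : model E}.
Local Notation "x ∈ y" := (E x y) (at level 70, no associativity).
Variable R : M -> Prop.
Hypothesis theory : reflective_theory E R.

Lemma separation_in_V k x e : reflective R k -> is_form E x -> ~ is_free E (num 1) x ->
  assignment E (V k) e -> forall a, a ∈ V k -> exists b, b ∈ V k /\
    forall z, z ∈ V k ->
    let f := upd (upd (upd e (num 0) a) (num 1) b) (num 2) z in
    ap f (num 2) ∈ ap f (num 1) <-> ap f (num 2) ∈ ap f (num 0) /\ Sat E (V k) x f.
Proof.
  intros Hk Hx Hfree He a Ha; pose proof (reflective_ord theory Hk) as Hko.
  assert (H0 := upd_assignment He (num_om 0) Ha).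
  assert (H1 := fun b (Hb : b ∈ V k) => upd_assignment H0 (num_om 1) Hb).
  assert (H2 := fun b (Hb : b ∈ V k) z (Hz : z ∈ V k) => upd_assignment (H1 b Hb) (num_om 2) Hz).
  (* [v_1] is to have the value [b], which does not exist yet. Since [v_1] is not free in [x], the
     value [a] can stand in for it. *)
  destruct (@separation _ _ Z (fun z => exists e', assignment E (V k) e' /\
      is_update E e' (upd (upd e (num 0) a) (num 1) a) (num 2) z /\ Sat E (V k) x e'))
    with (a := a) as [b Hb]; [df|].
  assert (Hbk : b ∈ V k) by (apply (V_subset Hko Ha); intros z Hz; apply Hb, Hz).
  exists b; split; [exact Hbk|]; intros z Hz f.
  assert (Hf2 : ap f (num 2) = z) by exact (ap_upd_eq (H1 b Hbk) (num_om 2) Hz).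
  assert (Hn : forall i j, i <> j -> num i <> num j) by (intros i j H K; exact (H (num_inj K))).
  assert (Hf1 : ap f (num 1) = b).
  { unfold f; rewrite (ap_upd_neq (H1 b Hbk) (num_om 2) Hz (num_om 1)) by (apply Hn; lia).
    exact (ap_upd_eq H0 (num_om 1) Hbk). }
  assert (Hf0 : ap f (num 0) = a).
  { unfold f; rewrite (ap_upd_neq (H1 b Hbk) (num_om 2) Hz (num_om 0)) by (apply Hn; lia).
    rewrite (ap_upd_neq H0 (num_om 1) Hbk (num_om 0)) by (apply Hn; lia).
    exact (ap_upd_eq He (num_om 0) Ha). }
  rewrite Hf0, Hf1, Hf2, Hb.
  enough (HS : Sat E (V k) x f <->
    Sat E (V k) x (upd (upd (upd e (num 0) a) (num 1) a) (num 2) z)).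
  { rewrite HS; split; intros [Hza H]; (split; [exact Hza|]).
    - destruct H as [e' [He' [Hup H]]].
      apply (is_update_eq (H1 a Ha) He' (num_om 2) Hz) in Hup; subst e'; exact H.
    - eexists; split; [exact (H2 a Ha z Hz) | split; [apply upd_is_update | exact H]]. }
  apply (Sat_not_free Hx (num_om 1) Hfree (H2 b Hbk z Hz) (H2 a Ha z Hz)).
  intros j y Hj; rewrite !has_pair_eq; unfold f; rewrite !upd_pair; tauto.
Qed.

Lemma denotes_elementary P Q k l e : denotes (E := E) P Q -> reflective R k -> reflective R l ->
  k ∈ l -> assignment E (V k) e -> Q (V k) e <-> Q (V l) e.
Proof.
  intros [[c Hc] H] Hk Hl Hkl He; destruct (H c Hc) as [Hf HS].
  rewrite <- (HS _ _ He), <- (HS _ _ (assignment_mono (V_mono (reflective_ord theory Hl) Hkl) He)).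
  exact (internal_elementary theory Hk Hl Hkl Hf He).
Qed.

(* Elementarity moves the premise of the instance up to a larger [V_l], where
   the subset [b] of [V_k] is an element. *)
Lemma replacement_in_V k x e : reflective R k -> is_form E x -> ~ is_free E (num 1) x ->
  assignment E (V k) e ->
  (forall z, z ∈ V k ->
    ap (upd e (num 2) z) (num 2) ∈ ap (upd e (num 2) z) (num 0) ->
    exists w, w ∈ V k /\ forall y, y ∈ V k ->
    let f := upd (upd (upd e (num 2) z) (num 1) w) (num 3) y in
    Sat E (V k) x f <-> ap f (num 3) = ap f (num 1)) ->
  exists b, b ∈ V k /\ forall y, y ∈ V k ->
    let f := upd (upd e (num 1) b) (num 3) y in
    ap f (num 3) ∈ ap f (num 1) <-> exists z, z ∈ V k /\
    ap (upd f (num 2) z) (num 2) ∈ ap (upd f (num 2) z) (num 0) /\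
    Sat E (V k) x (upd f (num 2) z).
Proof.
  intros Hk Hx Hfree He Hprem.
  pose proof (reflective_ord theory Hk) as Hko.
  destruct (reflective_above theory Hko) as [l [Hl Hkl]].
  pose proof (reflective_ord theory Hl) as Hlo.
  pose proof (V_mono Hlo Hkl) as HV.
  pose proof (assignment_mono HV He) as Hel.
  pose proof (proj1 (denotes_elementary (premise_code Hx) Hk Hl Hkl He) Hprem) as Hprem'.
  apply (denotes_elementary (conclusion_code Hx) Hk Hl Hkl He).
  cbv beta zeta in Hprem, Hprem' |- *.
  assert (Hn : forall i j, i <> j -> num i <> num j) by (intros i j H K; exact (H (num_inj K))).
  pose (a := ap e (num 0)).
  (* A normal form: premise and conclusion update the variables in different orders and give [v_1]
     different values, to which [x] is insensitive. [HS1] and [HS2] bring both to [S]. *)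
  pose (S A z y := Sat E A x (upd (upd (upd e (num 1) a) (num 2) z) (num 3) y)).
  assert (Ha : a ∈ V k) by exact (ap_in He (num_om 0)).
  assert (Hu2 : forall A e z, assignment E A e -> z ∈ A ->
    assignment E A (upd e (num 2) z) /\ ap (upd e (num 2) z) (num 2) = z /\
    ap (upd e (num 2) z) (num 0) = ap e (num 0)).
  { intros A f z Hf Hz; split; [exact (upd_assignment Hf (num_om 2) Hz) | split].
    - exact (ap_upd_eq Hf (num_om 2) Hz).
    - apply (ap_upd_neq Hf (num_om 2) Hz (num_om 0)), Hn; lia. }
  assert (Hu13 : forall A e w y, assignment E A e -> w ∈ A -> y ∈ A ->
    assignment E A (upd (upd e (num 1) w) (num 3) y) /\
    ap (upd (upd e (num 1) w) (num 3) y) (num 3) = y /\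
    ap (upd (upd e (num 1) w) (num 3) y) (num 1) = w /\
    ap (upd (upd e (num 1) w) (num 3) y) (num 0) = ap e (num 0)).
  { intros A f w y Hf Hw Hy; pose proof (upd_assignment Hf (num_om 1) Hw) as Hf1.
    split; [exact (upd_assignment Hf1 (num_om 3) Hy) | split; [exact (ap_upd_eq Hf1 (num_om 3) Hy)|]].
    rewrite !(ap_upd_neq Hf1 (num_om 3) Hy (num_om _)) by (apply Hn; lia).
    rewrite (ap_upd_neq Hf (num_om 1) Hw (num_om 0)) by (apply Hn; lia).
    split; [exact (ap_upd_eq Hf (num_om 1) Hw) | reflexivity]. }
  assert (Hn12 := Hn 1 2 ltac:(lia)); assert (Hn13 := Hn 1 3 ltac:(lia));
    assert (Hn23 := Hn 2 3 ltac:(lia)).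
  assert (HS1 : forall A z w y, assignment E A e -> a ∈ A -> z ∈ A -> w ∈ A -> y ∈ A ->
    Sat E A x (upd (upd (upd e (num 2) z) (num 1) w) (num 3) y) <-> S A z y).
  { intros A z w y HeA HaA Hz Hw Hy; unfold S.
    apply (Sat_not_free Hx (num_om 1) Hfree).
    - apply Hu13; auto; apply Hu2; auto.
    - refine (upd_assignment _ (num_om 3) Hy); apply Hu2; [|exact Hz].
      exact (upd_assignment HeA (num_om 1) HaA).
    - intros j t Hj; rewrite !has_pair_eq, !upd_pair.
      split; intros H; decompose [and or] H; subst; auto 8; congruence. }
  assert (HS2 : forall A z w y, assignment E A e -> a ∈ A -> z ∈ A -> w ∈ A -> y ∈ A ->
    Sat E A x (upd (upd (upd e (num 1) w) (num 3) y) (num 2) z) <-> S A z y).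
  { intros A z w y HeA HaA Hz Hw Hy; unfold S.
    apply (Sat_not_free Hx (num_om 1) Hfree).
    - apply Hu2; auto; apply Hu13; auto.
    - refine (upd_assignment _ (num_om 3) Hy); apply Hu2; [|exact Hz].
      exact (upd_assignment HeA (num_om 1) HaA).
    - intros j t Hj; rewrite !has_pair_eq, !upd_pair.
      split; intros H; decompose [and or] H; subst; auto 8; congruence. }
  assert (Hel' : forall z y, z ∈ V k -> y ∈ V k -> S (V k) z y <-> S (V l) z y).
  { intros z y Hz Hy; apply (internal_elementary theory Hk Hl Hkl Hx).
    refine (upd_assignment _ (num_om 3) Hy); apply Hu2; [|exact Hz].
    exact (upd_assignment He (num_om 1) Ha). }
  (* The unique value in [V k] is still the only one in [V l], so the image formed in [V l] stays
     within [V k]. *)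
  assert (Hfun : forall z, z ∈ a -> exists w, w ∈ V k /\ S (V k) z w /\
    forall y, y ∈ V l -> S (V l) z y -> y = w).
  { intros z Hza; pose proof (V_trans Hko Ha Hza) as Hz.
    destruct (Hu2 _ _ _ He Hz) as [H1 [H2 H3]].
    destruct (Hu2 _ _ _ Hel (HV z Hz)) as [H1' _].
    destruct (Hprem z Hz) as [w [Hw Hwu]]; [rewrite H2, H3; exact Hza|].
    destruct (Hprem' z (HV z Hz)) as [w' [Hw' Hwu']]; [rewrite H2, H3; exact Hza|].
    assert (Hup : forall y, y ∈ V l -> S (V l) z y <-> y = w').
    { intros y Hy; rewrite <- (HS1 (V l) z w' y) by auto; rewrite Hwu' by exact Hy.
      destruct (Hu13 _ _ w' y H1' Hw' Hy) as [_ [-> [-> _]]]; tauto. }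
    assert (Hww : S (V k) z w).
    { apply (HS1 (V k) z w w); auto; apply Hwu; [exact Hw|].
      destruct (Hu13 _ _ w w H1 Hw Hw) as [_ [-> [-> _]]]; reflexivity. }
    exists w; split; [exact Hw | split; [exact Hww|]].
    intros y Hy HSy; apply Hup in HSy; [|exact Hy]; rewrite HSy; symmetry.
    apply Hup, Hel'; auto. }
  (* This spells out [S (V k) z y] as a formula: the two updates are described by the assignments
     [e1] and [e2], as [upd] itself is a chosen function. *)
  destruct (@separation _ _ Z (fun y => exists z, z ∈ a /\ exists e1 e2,
      assignment E (V k) e1 /\ assignment E (V k) e2 /\
      is_update E e1 (upd e (num 1) a) (num 2) z /\ is_update E e2 e1 (num 3) y /\
      Sat E (V k) x e2))
    with (a := V k) as [b Hb]; [df|].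
  assert (Hb' : forall y, y ∈ b <-> y ∈ V k /\ exists z, z ∈ a /\ S (V k) z y).
  { pose proof (upd_assignment He (num_om 1) Ha) as H1.
    intros y; rewrite Hb; split; intros [Hy [z [Hza H]]]; (split; [exact Hy|]);
      exists z; (split; [exact Hza|]); pose proof (V_trans Hko Ha Hza) as Hz;
      destruct (Hu2 _ _ _ H1 Hz) as [H2 _].
    - destruct H as [e1 [e2 [He1 [He2 [Hup1 [Hup2 H]]]]]].
      apply (is_update_eq H1 He1 (num_om 2) Hz) in Hup1; subst e1.
      apply (is_update_eq H2 He2 (num_om 3) Hy) in Hup2; subst e2; exact H.
    - eexists _, _; split; [exact H2 | split; [exact (upd_assignment H2 (num_om 3) Hy)|]].
      split; [apply upd_is_update | split; [apply upd_is_update | exact H]]. }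
  assert (Hbl : b ∈ V l) by (apply in_V; [exact Hlo|]; exists k; split; [exact Hkl|];
    intros y Hy; apply Hb' in Hy; tauto).
  exists b; split; [exact Hbl|]; intros y Hy.
  destruct (Hu13 _ _ b y Hel Hbl Hy) as [H1 [-> [-> H0]]]; rewrite Hb'; split.
  - intros [Hyk [z [Hza H]]]; pose proof (V_trans Hko Ha Hza) as Hz; exists z.
    destruct (Hu2 _ _ _ H1 (HV z Hz)) as [_ [-> ->]]; rewrite H0.
    split; [exact (HV z Hz) | split; [exact Hza|]].
    apply HS2; auto; apply Hel'; auto.
  - intros [z [Hz [Hza H]]]; destruct (Hu2 _ _ _ H1 Hz) as [_ [Hz2 Hz0]].
    rewrite Hz2, Hz0, H0 in Hza; apply HS2 in H; auto.
    destruct (Hfun z Hza) as [w [Hw [HSw Hu]]].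
    rewrite (Hu y Hy H); eauto.
Qed.

Lemma V_models_ZFC k : reflective R k -> set_models_ZFC E (V k).
Proof.
  intros Hk c Hc e He; pose proof (reflective_ord theory Hk) as Hko.
  destruct Hc as [[P [HP Hc]]|[x [Hx [Hfree [Hc|Hc]]]]].
  - destruct (codes_of_finite_part HP) as [p [Hp HPp]]; rewrite (HPp c Hc).
    apply (Sat_code p He), (rsat_V_sat theory); [exact Hk | |].
    + intros i; exact (ap_in He (num_om i)).
    + apply (model_ZFC (E := E)); left; exact Hp.
  - apply (proj2 (proj2 (separation_code Hx) c Hc)); [exact He|].
    apply separation_in_V; auto; apply Hfree, is_numeral_eq; reflexivity.
  - pose proof (denotes_All 0 (denotes_Imp (premise_code Hx) (conclusion_code Hx))) as H.
    apply (proj2 (proj2 H c Hc)); [exact He|]; intros a Ha.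
    apply replacement_in_V; auto; [apply Hfree, is_numeral_eq; reflexivity|].
    exact (upd_assignment He (num_om 0) Ha).
Qed.

Lemma V_elementary k : reflective R k -> elementary_substructure E (fun x => x ∈ V k).
Proof.
  intros Hk; split.
  - exists emp; exact (V_ord (reflective_ord theory Hk) (proj2 Hk)).
  - intros p e; rewrite sat_restr; apply (rsat_V_sat theory); [exact Hk|].
    intros i; apply proj2_sig.
Qed.

End Models.

(** * Ordinal definability *)

Definition relation3 := forall N : Type, (N -> N -> Prop) -> N -> N -> N -> Prop.

Definition Rf3 (P : relation3) : Prop := Rf (fun N E e => P N E (e 0) (e 1) (e 2)).

Lemma Rf3_app P i j k : Rf3 P -> Rf (fun N E e => P N E (e i) (e j) (e k)).
Proof. intros HP; exact (Rf_ren (scons i (scons j (fun _ => k))) HP). Qed.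

(** [OD] with stage, code and assignment exposed, so that stages and assignments can be
    minimized. *)
Definition defines {N : Type} (E : N -> N -> Prop) (a c e y : N) : Prop :=
  exists v z, is_V E a v /\ assignment E v e /\
    (forall j u, has_pair E e j u -> ordinal E u) /\ is_numeral E 0 z /\ E y v /\
    forall y' e', E y' v -> assignment E v e' -> is_update E e' e z y' ->
      (Sat E v c e' <-> y' = y).

(* [e] is lexicographically at most [e'], as far as the first [n] values go. *)
Definition lexle {N : Type} (E : N -> N -> Prop) (n e e' : N) : Prop :=
  forall j, E j n -> forall u u', has_pair E e j u -> has_pair E e' j u' ->
    agree E j e e' -> ~ E u' u.

Lemma Rf_defines i j k l : Rf (fun N E e => defines E (e i) (e j) (e k) (e l)).
Proof. unfold defines; rf. Qed.
Lemma Rf_lexle i j k : Rf (fun N E e => lexle E (e i) (e j) (e k)).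
Proof. unfold lexle; rf. Qed.
#[local] Hint Resolve Rf_defines Rf_lexle : rf.

Section Selection.
Variable P : relation3.
Hypothesis HP : Rf3 P.

Definition candidate {N : Type} (E : N -> N -> Prop) (x s c a e y : N) : Prop :=
  defines E a c e y /\ HOD E y /\ P E x s y.

(* [y] comes from the least stage and, there, the lexicographically least
   ordinals that define an element as required with the formula [c]. *)
Definition selected {N : Type} (E : N -> N -> Prop) (x s c n y : N) : Prop :=
  exists a e, ordinal E a /\ candidate E x s c a e y /\
    (forall a', E a' a -> ~ exists e' y', candidate E x s c a' e' y') /\
    forall e' y', candidate E x s c a e' y' -> lexle E n e e'.

(** A3 allows one parameter, so [s], [c] and [n] are packed into one set. *)
Definition some_selected : relation2 := fun N E x p =>
  exists s q c n y, is_pair E p s q /\ is_pair E q c n /\ selected E x s c n y.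

(** The selected set need not be in [V_k]. It is compared through its elements, with [t] packed into
    the parameter. *)
Definition in_selected : relation2 := fun N E x p =>
  exists t r s q c n y, is_pair E p t r /\ is_pair E r s q /\ is_pair E q c n /\
    selected E x s c n y /\ E t y.

Lemma Rf_P i j k : Rf (fun N E e => P E (e i) (e j) (e k)).
Proof. apply Rf3_app, HP. Qed.
#[local] Hint Resolve Rf_P : rf.

Lemma some_selected_Rf : Rf2 some_selected.
Proof. unfold Rf2, some_selected, selected, candidate; rf. Qed.

Lemma in_selected_Rf : Rf2 in_selected.
Proof. unfold Rf2, in_selected, selected, candidate; rf. Qed.

Context {M : Type} {E : M -> M -> Prop} {Z : model E}.
Local Notation "x ∈ y" := (E x y) (at level 70, no associativity).

Lemma defines_assignment a c e y : defines E a c e y -> ordinal E a /\ assignment E (V a) e /\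
  (forall j, j ∈ om -> ordinal E (ap e j)) /\ y ∈ V a /\
  forall y', y' ∈ V a -> Sat E (V a) c (upd e (num 0) y') <-> y' = y.
Proof.
  intros [v [z [Hv [He [Ho [Hz [Hy H]]]]]]]; apply is_V_eq in Hv as [Ha ->].
  apply is_numeral_eq in Hz; subst z.
  split; [exact Ha | split; [exact He | split; [|split; [exact Hy|]]]].
  - intros j Hj; apply (Ho j), has_pair_eq, (ap_iff _ He Hj); reflexivity.
  - intros y' Hy'; apply H; [exact Hy' | exact (upd_assignment He (num_om 0) Hy')|].
    apply upd_is_update.
Qed.

Lemma candidate_df x s c a t u : Tm t -> Tm u ->
  Df E (fun e => candidate E x s c a (t e) (u e)).
Proof. intros Ht Hu; unfold candidate; df. Qed.
#[local] Hint Extern 1 (Df _ (fun e => candidate _ _ _ _ _ _ _)) => apply candidate_df; tm : rf.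

(** The lexicographic order of infinite sequences of ordinals is not well-founded; comparing only
    [n] values makes a minimum exist. Each step of the induction minimizes the next value among the
    candidates that agree with the minimum reached so far. *)
Lemma lexicographic_minimum x s c a e0 y0 : candidate E x s c a e0 y0 ->
  forall n, n ∈ om -> exists e y, candidate E x s c a e y /\
    forall e' y', candidate E x s c a e' y' -> lexle E n e e'.
Proof.
  intros H0; apply (@om_ind _ _ _ (fun n => exists e y, candidate E x s c a e y /\
    forall e' y', candidate E x s c a e' y' -> lexle E n e e')); [df| |].
  - exists e0, y0; split; [exact H0|]; intros e' y' _ j Hj; destruct (in_emp Hj).
  - intros n Hn [e [y [He Hmin]]].
    pose (P' u := exists e' y', candidate E x s c a e' y' /\ agree E n e e' /\ has_pair E e' n u).
    destruct (defines_assignment (proj1 He)) as [Ha [Hea [Ho _]]].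
    destruct (@ord_least _ _ _ P') with (a := ap e n) as [u [Hu [[e1 [y1 [He1 [Hag Hu1]]]] Hleast]]].
    + unfold P'; df.
    + exact (Ho n Hn).
    + exists e, y; split; [exact He | split; [intros i _ z; tauto|]].
      apply has_pair_eq, (ap_iff _ Hea Hn); reflexivity.
    + exists e1, y1; split; [exact He1|]; intros e' y' He' j Hj w w' Hw Hw' Hjag Hww'.
      apply in_suc in Hj as [Hj| ->].
      * pose proof (proj1 (ord_nat Hn) j Hj) as Hjn.
        apply (Hmin e' y' He' j Hj w w'); auto.
        -- apply (Hag j Hj), Hw.
        -- intros i Hi z; rewrite <- (Hjag i Hi z); apply Hag, Hjn, Hi.
      * destruct (defines_assignment (proj1 He1)) as [_ [He1a _]].
        apply has_pair_eq, (ap_iff _ He1a Hn) in Hw; apply has_pair_eq, (ap_iff _ He1a Hn) in Hu1.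
        subst w; rewrite <- Hu1 in Hww'; apply (Hleast w' Hww').
        exists e', y'; split; [exact He' | split; [|exact Hw']].
        intros i Hi z; rewrite <- (Hjag i Hi z); apply Hag, Hi.
Qed.

Lemma selected_exists x s c a e y n : candidate E x s c a e y -> n ∈ om ->
  exists y', selected E x s c n y'.
Proof.
  intros H Hn.
  destruct (@ord_least _ _ _ (fun a => exists e y, candidate E x s c a e y)) with (a := a)
    as [m [Hm [[e0 [y0 H0]] Hmin]]].
  - unfold candidate; df.
  - exact (proj1 (defines_assignment (proj1 H))).
  - eauto.
  - destruct (lexicographic_minimum H0 Hn) as [e1 [y1 [H1 Hlex]]].
    exists y1, m, e1; auto.
Qed.

(** At a first disagreement below [n] one of the two values would be smaller, which one of the
    comparisons excludes. *)
Lemma lexle_antisym A B n e e' : n ∈ om -> assignment E A e -> assignment E B e' ->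
  (forall j, j ∈ om -> ordinal E (ap e j)) -> (forall j, j ∈ om -> ordinal E (ap e' j)) ->
  lexle E n e e' -> lexle E n e' e -> agree E n e e'.
Proof.
  intros Hn He He' Ho Ho' Hle Hle'.
  assert (H : forall j, ordinal E j -> j ∈ n -> forall z, has_pair E e j z <-> has_pair E e' j z).
  { apply (@ord_ind _ _ _ (fun j => j ∈ n -> forall z, has_pair E e j z <-> has_pair E e' j z)); [df|].
    intros j Hj IH Hjn.
    assert (Hag : agree E j e e') by (intros i Hi; apply (IH i Hi), (ord_trans (ord_nat Hn) Hjn Hi)).
    pose proof (om_trans Hn Hjn) as Hjo.
    assert (H1 : has_pair E e j (ap e j)) by (apply has_pair_eq, (ap_iff _ He Hjo); reflexivity).
    assert (H2 : has_pair E e' j (ap e' j)) by (apply has_pair_eq, (ap_iff _ He' Hjo); reflexivity).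
    pose proof (Hle j Hjn _ _ H1 H2 Hag) as Hn1.
    pose proof (Hle' j Hjn _ _ H2 H1 (agree_sym Hag)) as Hn2.
    destruct (ord_trichotomy (Ho j Hjo) (Ho' j Hjo)) as [H3|[H3|H3]]; [tauto| |tauto].
    intros z; rewrite !has_pair_eq, (ap_iff z He Hjo), (ap_iff z He' Hjo), H3; tauto. }
  intros j Hj; exact (H j (ord_nat (om_trans Hn Hj)) Hj).
Qed.

(** Two minimal assignments may differ from [n] on, but by [Hsupp] the truth of [c] does not depend
    on that, so they define the same element. *)
Lemma selected_unique x s c n y y' : n ∈ om ->
  (forall A e e', assignment E A e -> assignment E A e' -> agree E n e e' ->
     Sat E A c e <-> Sat E A c e') ->
  selected E x s c n y -> selected E x s c n y' -> y = y'.
Proof.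
  intros Hn Hsupp [a [e [Ha [H [Hmin Hlex]]]]] [a' [e' [Ha' [H' [Hmin' Hlex']]]]].
  assert (a' = a) as ->.
  { destruct (ord_trichotomy Ha Ha') as [K|[K|K]]; [|auto|].
    - destruct (Hmin' a K); eauto.
    - destruct (Hmin a' K); eauto. }
  destruct (defines_assignment (proj1 H)) as [_ [He [Ho [Hy Hd]]]].
  destruct (defines_assignment (proj1 H')) as [_ [He' [Ho' [Hy' Hd']]]].
  pose proof (lexle_antisym Hn He He' Ho Ho' (Hlex e' y' H') (Hlex' e y H)) as Hag.
  apply (Hd' y Hy).
  apply (Hsupp (V a) (upd e (num 0) y) (upd e' (num 0) y)).
  - exact (upd_assignment He (num_om 0) Hy).
  - exact (upd_assignment He' (num_om 0) Hy).
  - exact (agree_upd (num 0) y Hag).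
  - apply (Hd y Hy); reflexivity.
Qed.

Lemma HOD_OD x : HOD E x -> OD E x.
Proof. intros H; apply H; auto. Qed.

Lemma OD_defines x : OD E x -> exists a c e, is_form E c /\ defines E a c e x.
Proof.
  intros [a [v [c [e [z [Hv [Hc [He [Ho [Hz [Hx H]]]]]]]]]]].
  exists a, c, e; split; [exact Hc|]; exists v, z; auto 6.
Qed.

Variable R : M -> Prop.
Hypothesis theory : reflective_theory E R.

(** By elementarity, truth in [V_l] and in [V_m] is truth in the universe, so the levels disappear
    from A3. *)
Lemma indiscernible Q k l s : Rf2 Q -> reflective R k -> reflective R l -> k ∈ l -> s ∈ V k ->
  Q M E k s <-> Q M E l s.
Proof.
  intros HQ Hk Hl Hkl Hs.
  destruct (reflective_above theory (reflective_ord theory Hl)) as [m [Hm Hlm]].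
  pose proof (reflective_ord theory Hk) as Hko; pose proof (reflective_ord theory Hl) as Hlo.
  pose proof (reflective_ord theory Hm) as Hmo.
  destruct (lift_V (V_ord Hlo Hkl)) as [k' Hk'], (lift_V (V_ord Hmo Hlm)) as [l' Hl'].
  destruct (lift_V (V_mono Hlo Hkl Hs)) as [s' Hs'].
  destruct (lift_V (V_mono Hmo Hlm (V_mono Hlo Hkl Hs))) as [s'' Hs''].
  assert (Hsk : proj1_sig s' ∈ V k) by (rewrite Hs'; exact Hs).
  pose proof (@indiscernible_in_V _ _ _ _ theory Q k l m k' s' l' s''
    HQ Hk Hl Hm Hkl Hlm Hk' Hl' ltac:(congruence) Hsk) as Hi.
  assert (Hup : forall m (x y : {x | x ∈ V m}), reflective R m ->
    Q _ (restr E (fun x => x ∈ V m)) x y <-> Q M E (proj1_sig x) (proj1_sig y)).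
  { intros r x y Hr; destruct (Rf2_formula HQ) as [p [_ Hp]].
    rewrite <- (Hp _ _ (fun i => match i with 0 => x | _ => y end)), sat_restr.
    rewrite (rsat_V_sat theory) by (auto; intros i; apply proj2_sig).
    apply (Hp _ _ (fun i => proj1_sig (match i with 0 => x | _ => y end))). }
  rewrite (Hup l), (Hup m), Hk', Hl', Hs', Hs'' in Hi by assumption; exact Hi.
Qed.

(* The formula [c] and the number [n] of relevant variables lie in [V_k], so
   they can be kept fixed when the definition of [y] is transferred to [l]. *)
Lemma coherent_choice k l s A : reflective R k -> reflective R l -> k ∈ l -> s ∈ V k ->
  HOD E A -> P E k s A ->
  exists y y', HOD E y /\ HOD E y' /\ P E k s y /\ P E l s y' /\
    forall t, t ∈ V k -> t ∈ y <-> t ∈ y'.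
Proof.
  intros Hk Hl Hkl Hs HA HPA.
  pose proof (reflective_ord theory Hk) as Hko; pose proof (reflective_limit theory Hk) as Hlk.
  (* [A] supplies a code [c] for which candidates exist; the set selected with [c] may be a
     different one. *)
  destruct (OD_defines (HOD_OD HA)) as [a [c [e [Hc Hdef]]]].
  destruct (finite_support Hc) as [n [Hn Hsupp]].
  assert (Hcn : pr c n ∈ V k).
  { apply (limit_pr Hlk); [exact (form_V Hko (reflective_om theory Hk) Hc)|].
    exact (V_ord Hko (limit_nat Hlk Hn)). }
  pose proof (limit_pr Hlk Hs Hcn) as Hscn.
  destruct (selected_exists (conj Hdef (conj HA HPA)) Hn) as [y Hy].
  assert (Hl' : some_selected E l (pr s (pr c n))).
  { apply (indiscernible some_selected_Rf Hk Hl Hkl Hscn).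
    exists s, (pr c n), c, n, y; rewrite !is_pair_eq; auto. }
  destruct Hl' as [s' [q [c' [n' [y' [Hp [Hq Hy']]]]]]].
  apply is_pair_eq, pr_inj in Hp as [<- <-]; apply is_pair_eq, pr_inj in Hq as [<- <-].
  (* Uniqueness turns the existential [in_selected] into membership in the given selected set, at
     [k] as well as at [l]. *)
  assert (Hin : forall x z t, selected E x s c n z ->
    in_selected E x (pr t (pr s (pr c n))) <-> t ∈ z).
  { intros x z t Hz; split.
    - intros [t' [r [s' [q [c' [n' [z' [Hp [Hr [Hq [Hz' Ht]]]]]]]]]]].
      apply is_pair_eq, pr_inj in Hp as [<- <-]; apply is_pair_eq, pr_inj in Hr as [<- <-].
      apply is_pair_eq, pr_inj in Hq as [<- <-].
      rewrite (selected_unique Hn Hsupp Hz Hz'); exact Ht.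
    - intros Ht; exists t, (pr s (pr c n)), s, (pr c n), c, n, z; rewrite !is_pair_eq; auto. }
  exists y, y'.
  pose proof Hy as [b [f [_ [[_ [Hy1 Hy2]] _]]]].
  pose proof Hy' as [b' [f' [_ [[_ [Hy1' Hy2']] _]]]].
  split; [exact Hy1 | split; [exact Hy1' | split; [exact Hy2 | split; [exact Hy2'|]]]].
  intros t Ht; rewrite <- (Hin k y t Hy), <- (Hin l y' t Hy').
  apply (indiscernible in_selected_Rf Hk Hl Hkl), (limit_pr Hlk Ht Hscn).
Qed.

End Selection.

(** * Indescribability in HOD *)

Definition rsat_HOD (p : fml) : relation2 := fun N E x y =>
  rsat E (HOD E) (fun i => match i with 0 => x | _ => y end) p.

Lemma Rf_rsat_HOD p : forall f, Rf (fun N E e => rsat E (HOD E) (fun i => e (f i)) p).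
Proof.
  induction p; intros f; simpl; rf; auto.
  (* Index 0 goes to the quantified variable, and the other names are shifted past it. *)
  pose (g j := if Nat.eqb j i then 0 else S (f j)).
  apply (Rf_equiv (IHp g)); intros N E e.
  replace (update (fun j => e (S (f j))) i (e 0)) with (fun j => e (g j)); [tauto|].
  extensionality j; unfold update, g; destruct (Nat.eqb j i); reflexivity.
Qed.

Lemma Rf_rsat_HOD2 p i j : Rf (fun N E e => rsat_HOD p E (e i) (e j)).
Proof.
  apply (Rf_equiv (Rf_rsat_HOD p (fun k => match k with 0 => i | _ => j end))).
  intros N E e; unfold rsat_HOD.
  replace (fun k => e (match k with 0 => i | _ => j end))
    with (fun k => match k with 0 => e i | _ => e j end); [tauto|].
  extensionality k; destruct k; reflexivity.
Qed.
#[local] Hint Resolve Rf_rsat_HOD2 : rf.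

(* [A] witnesses that [x] is not indescribable with respect to [p]. *)
Definition describes (p : fml) : relation3 := fun N E x _ A =>
  subset E A x /\ rsat_HOD p E x A /\
  forall l B, HOD E l -> HOD E B -> E l x -> is_inter E B A l -> ~ rsat_HOD p E l B.

Lemma describes_Rf p : Rf3 (describes p).
Proof. unfold Rf3, describes; rf. Qed.

Definition bijection_to : relation3 := fun N E x s f => bijection E f s x.

Lemma bijection_to_Rf : Rf3 bijection_to.
Proof. unfold Rf3, bijection_to; rf. Qed.

Section HOD.
Context {M : Type} {E : M -> M -> Prop} {Z : model E}.
Local Notation "x ∈ y" := (E x y) (at level 70, no associativity).
Local Notation "$ x" := (proj1_sig x) (at level 1, format "$ x").

#[local] Instance HOD_transitive : transitive_class E (HOD E).
Proof.
  intros x y Hx Hy z Hz; apply Hx; intros t Ht Hxt; apply Hz; [exact Ht | exact (Ht x Hxt y Hy)].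
Qed.

Lemma ord_OD a : ordinal E a -> OD E a.
Proof.
  intros Ha; pose proof (V_ord (ord_suc Ha) (suc_self a)) as HaV.
  destruct (constant_assignment HaV) as [e [He Hconst]].
  (* In [V (suc a)] the formula [v_0 = v_1] defines [a] under the assignment with constant value
     [a]. *)
  exists (suc a), (V (suc a)), (ceql (num 0) (num 1)), e, (num 0).
  split; [exact (V_is_V (ord_suc Ha)) | split; [exact (form_eql (num_om 0) (num_om 1)) | split; [exact He|]]].
  split; [intros j y Hy; apply has_pair_eq in Hy; rewrite (Hconst j y Hy); exact Ha|].
  split; [apply is_numeral_eq; reflexivity | split; [exact HaV|]].
  intros y e' Hy He' Hup; apply (is_update_eq He He' (num_om 0) Hy) in Hup; subst e'.
  rewrite (Sat_eql He' (num_om 0) (num_om 1)), (ap_upd_eq He (num_om 0) Hy).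
  rewrite (ap_upd_neq He (num_om 0) Hy (num_om 1)) by (intros H; apply num_inj in H; discriminate H).
  rewrite (Hconst (num 1) (ap e (num 1))); [tauto|].
  apply (ap_iff _ He (num_om 1)); reflexivity.
Qed.

Lemma ord_HOD a : ordinal E a -> HOD E a.
Proof.
  intros Ha y Hy; apply ord_OD.
  pose proof (ord_suc Ha) as Hs; apply (ord_mem Hs), Hy; [exact (proj1 Hs) | apply suc_self].
Qed.

Variable R : M -> Prop.
Hypothesis theory : reflective_theory E R.

(** Let [y] and [y'] map an ordinal below [k] onto [k] and onto [l], agreeing on elements of [V_k].
    If [y'] sends [i] to [k] and [y] sends [i] to [t], then the pair of [i] and [t] is in [V_k], so
    [y'] sends [i] to [t] too. Hence [t = k], although [t] is below [k]. *)
Lemma HOD_cardinal k (Hk : HOD E k) : reflective R k ->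
  cardinal (restr E (HOD E)) (exist (HOD E) k Hk).
Proof.
  intros Hr; pose proof (reflective_ord theory Hr) as Hko.
  split; [apply abs_ordinal; exact Hko|]; intros a Ha [f Hf].
  apply abs_bijection in Hf; unfold restr in Ha; simpl in Ha, Hf.
  destruct (reflective_above theory Hko) as [l [Hl Hkl]].
  destruct (coherent_choice bijection_to_Rf theory Hr Hl Hkl (V_ord Hko Ha) (proj2_sig f) Hf)
    as [y [y' [_ [_ [Hy [Hy' Hag]]]]]].
  destruct Hy' as [[[Hdom Hfun'] _] [_ Hsurj]]; destruct (Hsurj k Hkl) as [i Hi].
  assert (Hia : i ∈ $a).
  { pose proof (proj1 (has_pair_eq _ _ _) Hi) as Hp; destruct (Hdom _ Hp) as [i' [z [Hi' Hz]]].
    apply is_pair_eq, pr_inj in Hz as [-> _]; exact Hi'. }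
  destruct Hy as [[[_ Hfun] Hrange] _]; destruct (Hfun i Hia) as [t [Ht _]].
  pose proof (Hrange i t Ht) as Htk.
  apply has_pair_eq, Hag, has_pair_eq in Ht; [|apply (limit_pr (reflective_limit theory Hr))].
  - destruct (Hfun' i Hia) as [u [_ Hu]].
    rewrite <- (Hu t Ht), (Hu k Hi) in Htk; exact (mem_irrefl Htk).
  - exact (V_ord Hko (ord_trans Hko Ha Hia)).
  - exact (V_ord Hko Htk).
Qed.

Lemma HOD_indescribable k (Hk : HOD E k) : reflective R k ->
  fully_indescribable (restr E (HOD E)) (exist (HOD E) k Hk).
Proof.
  intros Hr; split; [apply HOD_cardinal, Hr|]; intros p _ A HAk HA.
  pose proof (reflective_ord theory Hr) as Hko.
  assert (Hsat : forall x y : {x | HOD E x}, sat2 (restr E (HOD E)) p x y <-> rsat_HOD p E $x $y).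
  { intros x y; unfold sat2; rewrite sat_restr; unfold rsat_HOD.
    replace (fun i => $(match i with 0 => x | _ => y end))
      with (fun i => match i with 0 => $x | _ => $y end); [tauto|].
    extensionality i; destruct i; reflexivity. }
  apply NNPP; intros Hn.
  assert (HP : describes p E k emp $A).
  { split; [apply abs_subset in HAk; exact HAk | split; [apply Hsat in HA; exact HA|]].
    intros l B Hl HB Hlk Hint Hp; apply Hn; exists (exist _ l Hl), (exist _ B HB).
    split; [exact Hlk | split; [|apply Hsat, Hp]].
    intros w; apply (Hint $w). }
  destruct (reflective_above theory Hko) as [l [Hl Hkl]].
  destruct (coherent_choice (describes_Rf p) theory Hr Hl Hkl (V_ord Hko (proj2 Hr)) (proj2_sig A) HP)
    as [y [y' [HyH [_ [[Hy1 [Hy2 _]] [[_ [_ Hy']] Hag]]]]]].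
  (* By the agreement on [V_k], and since [y] is a subset of [k], [y] is the intersection of [y']
     with [k]. *)
  apply (Hy' k y Hk HyH Hkl); [|exact Hy2].
  intros w; split.
  - intros Hw; pose proof (Hy1 w Hw) as Hwk; split; [apply Hag|]; auto; exact (V_ord Hko Hwk).
  - intros [Hw Hwk]; apply Hag; [exact (V_ord Hko Hwk) | exact Hw].
Qed.

End HOD.

Theorem theorem1 (M : Type) (E : M -> M -> Prop) (R : M -> Prop)
  (T : reflective_theory E R) (kappa : M) (Hkappa : R kappa)
  (kappa_gt0 : positive E kappa) :
  (exists v : M,
     is_V E kappa v /\ set_models_ZFC E v /\
     elementary_substructure E (fun x => E x v)) /\
  (exists kappa_HOD : HOD E kappa,
     fully_indescribable (restr E (HOD E)) (exist (HOD E) kappa kappa_HOD)).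
Proof.
  pose (Z := {| model_ZFC := reflective_ZFC T; point := kappa |}).
  assert (Hk : reflective R kappa).
  { split; [exact Hkappa|]; destruct kappa_gt0 as [z [Hz H]].
    apply empty_eq in Hz; subst z; exact H. }
  pose proof (reflective_ord T Hk) as Hko; split.
  - exists (V kappa); split; [exact (V_is_V Hko) | split].
    + exact (V_models_ZFC T Hk).
    + exact (V_elementary T Hk).
  - exists (ord_HOD Hko); exact (HOD_indescribable T (ord_HOD Hko) Hk).
Qed.
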